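(* Let $m\ge1$ and let $\phi_1,\dots,\phi_m$ be real numbers. Put $y_{i,j}=y_i-y_j$. Then the following identity of formal power series in $y_1,\dots,y_m$ holds: \begin{align*} &\sum_{j=0}^m(-1)^j\,e(\phi_1+\dots+\phi_j)\,\mathcal{L}i^t_{T=\log2}(\phi_{j+1},\dots,\phi_m\mid y_{j+1},\dots,y_m)\,\mathcal{L}i^t_{T=\log2}(-\phi_j,\dots,-\phi_1\mid -y_j,\dots,-y_1)\\ &-\frac{1}{2^{m-1}}\sum_{j=1}^m(-1)^{j-1}\mathcal{L}i_{T=0}(-\phi_{j-1},\dots,-\phi_1\mid \tfrac12y_{j,j-1},\dots,\tfrac12y_{j,1})\,B^t_{T=\log2}(\phi_1+\dots+\phi_m\mid y_j)\,\mathcal{L}i_{T=0}(\phi_{j+1},\dots,\phi_m\mid\tfrac12y_{j+1,j},\dots,\tfrac12y_{m,j})\\ &=\begin{cases}\dfrac{1}{m!}\Big(\dfrac{i\pi}{2}\Big)^m & \text{if all }\phi_i\in\mathbb{Z}\text{ and }m\text{ is even},\\ 0&\text{otherwise.}\end{cases} \end{align*}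
   Context: $e(x)=\exp(2\pi i x)$. For $\varepsilon_1,\dots,\varepsilon_m\in\mathbb{C}$ with $|\varepsilon_i|=1$ and positive integers $n_i$, define $\zeta\binom{\varepsilon_1,\dots,\varepsilon_m}{n_1,\dots,n_m}=\sum_{0<k_1<\dots<k_m}\prod_i\varepsilon_i^{k_i}k_i^{-n_i}$ and $t\binom{\varepsilon_1,\dots,\varepsilon_m}{n_1,\dots,n_m}=\sum_{0<k_1<\dots<k_m}\prod_i\varepsilon_i^{k_i}(2k_i-1)^{-n_i}$; these converge iff $(\varepsilon_m,n_m)\ne(1,1)$. Stuffle regularization: consider words in letters $[\varepsilon,n]$ ($|\varepsilon|=1$, $n\ge1$) with the quasi-shuffle product $[a]u*[b]v=[a](u*[b]v)+[b]([a]u*v)+([a]\diamond[b])(u*v)$, where $[\varepsilon,n]\diamond[\varepsilon',n']=[\varepsilon\varepsilon',n+n']$. The truncated sums (with $k_m\le M$) give algebra homomorphisms for this product; the algebra is a polynomial algebra in the letter $[1,1]$ over the subalgebra spanned by words not ending in $[1,1]$, on which $\zeta$ (resp. $t$) is an algebra homomorphism; $\operatorname{reg}_{T=c}\zeta$ (resp. $\operatorname{reg}_{T=c}t$) is the unique algebra-homomorphism extension sending $[1,1]$ to $c$. Generating series: $\mathcal{L}i_{T=c}(\phi_1,\dots,\phi_m\mid y_1,\dots,y_m)=\sum_{n_1,\dots,n_m\ge1}\operatorname{reg}_{T=c}\zeta\binom{e(\phi_1),\dots,e(\phi_m)}{n_1,\dots,n_m}y_1^{n_1-1}\cdots y_m^{n_m-1}$,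 and $\mathcal{L}i^t_{T=c}$ likewise with $t$; a series with an empty list of arguments equals $1$. Finally $B^t_{T=\log2}(\phi\mid y)=\mathcal{L}i^t_{T=\log2}(\phi\mid y)-e(\phi)\,\mathcal{L}i^t_{T=\log2}(-\phi\mid -y)$. *)

(* Defs.v *)
From HB Require Import structures.
From mathcomp Require Import all_boot all_order all_algebra.
From mathcomp Require Import all_classical all_reals all_analysis.
From mathcomp Require Import complex.
From mathcomp Require mpoly.
(* The notations of mpoly are incompatible with those of mathcomp-analysis. *)
Import -(notations) mpoly.

Set Implicit Arguments.
Unset Strict Implicit.
Unset Printing Implicit Defensive.

Import Order.TTheory GRing.Theory Num.Theory.
Import numFieldNormedType.Exports.

Local Open Scope classical_set_scope.
Local Open Scope ring_scope.

Definition cexp (R : realType) (z : R[i]) : R[i] :=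
  let: (a +i* b)%C := z in (expR a)%:C%C * (cos b +i* sin b)%C.

Definition e (R : realType) (x : R) : R[i] :=
  cexp (2 * pi%:C%C * 'i%C * x%:C%C).

(* The letter [eps, n] is the pair (eps, n); a word lists its letters in the
   order of increasing summation indices. *)
Definition letter (R : realType) : Type := (R[i] * nat)%type.
Definition word (R : realType) : Type := seq (letter R).

Definition valid_letter (R : realType) (a : letter R) : bool :=
  (`|a.1| == 1) && (0 < a.2)%N.
Definition valid_word (R : realType) (w : word R) : bool :=
  all (@valid_letter R) w.

Definition letter11 (R : realType) : letter R := (1, 1%N).

Definition diamond (R : realType) (a b : letter R) : letter R :=
  (a.1 * b.1, (a.2 + b.2)%N).

(* The quasi-shuffle product of two words, a sum of words, is represented by
   the sequence of its terms, repeated according to multiplicity. *)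
Fixpoint stuffle (R : realType) (u : word R) : word R -> seq (word R) :=
  match u with
  | [::] => fun v => [:: v]
  | a :: u' =>
      fix stuffle_u (v : word R) : seq (word R) :=
        match v with
        | [::] => [:: u]
        | b :: v' =>
               [seq a :: w | w <- stuffle u' v]
            ++ [seq b :: w | w <- stuffle_u v']
            ++ [seq diamond a b :: w | w <- stuffle u' v']
        end
  end.

(* trunc_sum den M l [:: (eps_1, n_1); ...; (eps_m, n_m)] is the sum over
   l < k_1 < ... < k_m <= M of the products of the eps_i ^ k_i / den k_i ^ n_i. *)
Fixpoint trunc_sum (R : realType) (den : nat -> R[i]) (M l : nat) (w : word R)
    : R[i] :=
  match w with
  | [::] => 1
  | (eps, n) :: w' =>
      \sum_(l.+1 <= k < M.+1) eps ^+ k / den k ^+ n * trunc_sum den M k w'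
  end.

Definition den_zeta (R : realType) (k : nat) : R[i] := k%:R.
Definition den_t (R : realType) (k : nat) : R[i] := 2 * k%:R - 1.

(* A linear form f on the quasi-shuffle algebra is given by its values on
   words. The conditions say that f is an algebra homomorphism, that it
   extends the map sending a word not ending in [1,1] to the corresponding
   convergent series, and that f([1,1]) = c. *)
Definition is_reg (R : realType) (den : nat -> R[i]) (c : R[i])
    (f : word R -> R[i]) : Prop :=
  [/\ f [::] = 1,
      (forall u v, valid_word u -> valid_word v ->
         f u * f v = \sum_(w <- stuffle u v) f w),
      (forall w, valid_word w -> ~~ suffix [:: letter11 R] w ->
         (fun M => trunc_sum den M 0 w) @ \oo --> (f w : R[i]^o))
    & f [:: letter11 R] = c].

(* The values of the regularization on valid words are determined by is_reg;
   the other words are never used. *)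
Definition reg (R : realType) (den : nat -> R[i]) (c : R[i])
  : word R -> R[i] := xget (fun=> 0) [set f | is_reg den c f].

Definition reg_zeta (R : realType) (c : R[i]) := reg (@den_zeta R) c.
Definition reg_t (R : realType) (c : R[i]) := reg (@den_t R) c.

(* A formal power series in m variables over R[i] is its family of
   coefficients. Sum and scaling are the pointwise operations, but the
   pointwise product is not the product of series: see fps_mul. *)
Notation fps R m := (multinom m -> R[i]^o).

Definition fps_const (R : realType) (m : nat) (c : R[i]) : fps R m :=
  fun nu => if nu == mnm0 then c else 0.

Definition fps_mul (R : realType) (m : nat) (F G : fps R m) : fps R m :=
  fun nu =>
    \sum_(k : bmultinom m (mdeg nu).+1 * bmultinom m (mdeg nu).+1
           | nu == mnm_add k.1 k.2) (F k.1 : R[i]) * G k.2.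

Definition yvar (R : realType) (m : nat) (i : 'I_m) : mpoly m R[i] :=
  mpolyX R[i] (mnm1 i).

(* gen_series f [:: (phi_1, l_1); ...; (phi_k, l_k)] is the sum over
   n_1, ..., n_k >= 0 of
     f [:: (e phi_1, n_1 + 1); ...; (e phi_k, n_k + 1)] l_1 ^ n_1 ... l_k ^ n_k,
   for polynomials l_i without constant term: the indices n_i > mdeg nu do not
   contribute to the coefficient of the monomial nu. *)
Definition gen_series (R : realType) (m : nat) (f : word R -> R[i])
    (s : seq (R * mpoly m R[i])) : fps R m :=
  fun nu =>
    \sum_(n : (size s).-tuple 'I_(mdeg nu).+1)
      f [seq (e p.1.1, p.2.+1) | p : (R * mpoly m R[i]) * 'I_(mdeg nu).+1
                                   <- zip s n]
      * mcoeff nu (\prod_(p <- zip s n) p.1.2 ^+ p.2).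

Definition Li (R : realType) (m : nat) (c : R[i]) (s : seq (R * mpoly m R[i]))
  : fps R m := gen_series (reg_zeta c) s.

Definition Lit (R : realType) (m : nat) (c : R[i]) (s : seq (R * mpoly m R[i]))
  : fps R m := gen_series (reg_t c) s.

Definition clog2 (R : realType) : R[i] := (ln 2)%:C%C.

Definition Bt (R : realType) (m : nat) (phi : R) (y : mpoly m R[i]) : fps R m :=
  Lit (clog2 R) [:: (phi, y)] - e phi *: Lit (clog2 R) [:: (- phi, - y)].

(* Main.v *)
(* The first sum is the bilateral sum of the
     prod_i e(phi_i k_i) / (2 k_i - 1 - y_i)   over k_1 < ... < k_m in Z,
   cut at 0. The partial fraction identity
     prod_i 1/x_i = sum_j 1/x_j prod_(i != j) 1/(x_i - x_j)
   rewrites it as a sum over the distinguished index k_j of two Li-type sums,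
   over the indices below and above k_j; this is the second sum, except that the
   truncations of the inner sums depend on k_j. All truncated sums are
   polynomials in the harmonic number up to O(log^r n / n), and regularization
   evaluates these polynomials, so it remains to bound the error made by
   replacing the inner truncations by M. If phi_1 + ... + phi_m is not an
   integer, this is an Abel summation against e(k (phi_1 + ... + phi_m)).
   Otherwise let Q(p, q) = sum_j (-1)^j A_j(p) B_j(q) be the alternating sum of
   the inner sums. By the partial fraction identity again, Q has mean zero on
   each line p + q = n, while differentiating its asymptotic polynomial strips
   an end letter, so by induction that polynomial vanishes. The only exception
   is the constant coefficient when all phi_i are integers; it is computed
   directly from prod_k (1 - u^2 / (2 k - 1)^2) = cos(pi u / 2). *)
Require Import Defs.
From HB Require Import structures.
From mathcomp Require Import all_boot all_order all_algebra.
From mathcomp Require Import all_classical all_reals all_analysis.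
From mathcomp Require Import complex ring lra zify.
From mathcomp Require mpoly.
Import -(notations) mpoly.

Set Implicit Arguments.
Unset Strict Implicit.
Unset Printing Implicit Defensive.

Import Order.TTheory GRing.Theory Num.Theory.
Import numFieldNormedType.Exports.
Import Normc.

Local Open Scope ring_scope.

(** * Growth rates *)

(** Errors carry an explicit rate [O(log^r n / n)], not mere convergence: truncated sums grow like
    powers of the logarithm, and only an error with a power saving survives multiplication by them.
    As harmonic numbers are unbounded, an identity of truncated sums up to such errors is a
    polynomial identity in [T], which can then be evaluated. Since [sum 1/(2k-1)] is half the
    harmonic number plus [log 2] up to [o(1)], the value [T = 0] for zeta corresponds to [T = log 2]
    for [t]. The factor [2^(1-m)] and the halved variables come from [(2 k_i - y_i) - (2 k_j - y_j)
    = 2 ((k_i - k_j) - (y_i - y_j)/2)]. The obstacle is the replacement of the inner truncations: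
    moving them by [k] costs about [k/M], against a weight [1/(2k+1)], and the total over [k < M]
    need not tend to 0 term by term. Either an oscillating phase or the cancellation in the
    alternating sum over [j] must help. To reach that alternating sum, [1/(2k-1-y_j)] is split into
    [1/(2k-1)], which is the same for all [j], and a remainder [O(1/k^2)]. *)

Section Bounds.
Variable R : realType.
Notation C := R[i].

(** The harmonic number plus 1: the shift gives [1 <= Lg n] for all [n], so powers increase with the
    exponent and bounds with different exponents can be merged. *)
Definition Lg (n : nat) : R := 1 + \sum_(k < n) k.+1%:R^-1.

Lemma LgS n : Lg n.+1 = Lg n + n.+1%:R^-1.
Proof. by rewrite /Lg big_ord_recr addrA. Qed.

Lemma Lg0 : Lg 0 = 1.
Proof. by rewrite /Lg big_ord0 addr0. Qed.

Lemma Lg_homo : {homo Lg : m n / (m <= n)%N >-> m <= n}.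
Proof.
apply: homo_leq => // [? ? ?|n]; first exact: le_trans.
by rewrite LgS lerDl invr_ge0 ler0n.
Qed.

Lemma Lg_ge1 n : 1 <= Lg n.
Proof. by rewrite -Lg0; apply: Lg_homo. Qed.

Lemma Lg_gt0 n : 0 < Lg n.
Proof. exact: lt_le_trans (Lg_ge1 n). Qed.

Lemma Lg_ge0 n : 0 <= Lg n.
Proof. exact: ltW (Lg_gt0 n). Qed.

Lemma LgX_ge0 n r : 0 <= Lg n ^+ r.
Proof. exact/exprn_ge0/Lg_ge0. Qed.

Lemma LgX_homo n r s : (r <= s)%N -> Lg n ^+ r <= Lg n ^+ s.
Proof. by move=> rs; rewrite ler_weXn2l // Lg_ge1. Qed.

Lemma LgXl_homo m n r : (m <= n)%N -> Lg m ^+ r <= Lg n ^+ r.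
Proof. by move=> mn; rewrite lerXn2r ?nnegrE ?Lg_ge0 // Lg_homo. Qed.

Lemma LgS_le n : Lg n.+1 <= 2 * Lg n.
Proof.
rewrite LgS mulr_natl mulr2n lerD2l (le_trans _ (Lg_ge1 n)) //.
by rewrite invf_le1 ?ltr0n // ler1n.
Qed.

Lemma Lg_double n : Lg (n + n) <= 2 * Lg n.
Proof.
have -> : Lg (n + n) = Lg n + \sum_(k < n) (n + k).+1%:R^-1.
  by rewrite /Lg big_split_ord /= addrA.
suff : \sum_(k < n) ((n + k).+1%:R^-1 : R) <= 1 by move=> ?; have := Lg_ge1 n; lra.
apply: (@le_trans _ _ (\sum_(k < n) n%:R^-1)).
  apply: ler_sum => k _; rewrite lef_pV2 ?posrE ?ltr0n ?ler_nat //; first lia.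
  by case: n k => [[]|].
rewrite sumr_const card_ord; case: n => [|n]; first by rewrite mulr0n.
by rewrite -[X in X <= _]mulr_natr mulVf ?pnatr_eq0.
Qed.

(* Modelled on the integral of [u^r exp(-u)] over [x, +oo[, which is
   [(x^r + r x^(r-1) + r (r-1) x^(r-2) + ...) exp(-x)]. *)
Fixpoint LgInt (r n : nat) : R :=
  if r is r'.+1 then Lg n ^+ r + r%:R * LgInt r' n else 1.

Lemma LgInt_ge0 r n : 0 <= LgInt r n.
Proof.
elim: r => [|r IH] /=; first exact: ler01.
by rewrite addr_ge0 ?mulr_ge0 ?LgX_ge0 ?ler0n.
Qed.

Lemma ler_subXn (x y : R) r : 0 <= x -> x <= y ->
  y ^+ r.+1 - x ^+ r.+1 <= r.+1%:R * y ^+ r * (y - x).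
Proof.
move=> x0 xy; have y0 := le_trans x0 xy.
rewrite subrXX mulrC ler_wpM2r ?subr_ge0 //.
have -> : r.+1%:R * y ^+ r = \sum_(i < r.+1) y ^+ r by rewrite sumr_const card_ord mulr_natl.
apply: ler_sum => i _.
have -> : y ^+ r = y ^+ (r.+1.-1 - i) * y ^+ i.
  by rewrite -exprD /= subnK // -ltnS.
by rewrite ler_wpM2l ?exprn_ge0 // lerXn2r.
Qed.

(** Discrete form of [P_r' = r P_(r-1)] for the polynomials modelled by [LgInt], with the increment
    of [Lg] as [dx]. *)
Lemma LgInt_incr r n : LgInt r n.+1 - LgInt r n <=
  n.+1%:R^-1 * (r%:R * LgInt r.-1 n.+1).
Proof.
elim: r => [|r IH] /=; first by rewrite subrr mul0r mulr0.
have h := ler_subXn r (Lg_ge0 n) (Lg_homo (leqnSn n)).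
have e : Lg n.+1 - Lg n = n.+1%:R^-1 by rewrite LgS addrC addKr.
rewrite e in h.
apply: (@le_trans _ _ (r.+1%:R * Lg n.+1 ^+ r / n.+1%:R +
   r.+1%:R * (n.+1%:R^-1 * (r%:R * LgInt r.-1 n.+1)))).
  rewrite opprD addrACA lerD // -mulrBr ler_wpM2l ?ler0n //.
rewrite le_eqVlt; apply/orP; left; apply/eqP.
case: r {IH h} => [|r] /=; first by rewrite expr0; ring.
ring.
Qed.

(** Up to a factor 2, a majorant of the tail from [n] of the series of [Lg k ^ r / (k+1)^2]. *)
Definition LgTail r n : R := LgInt r n.+1 / n.+1%:R.

Lemma LgTail_ge0 r n : 0 <= LgTail r n.
Proof. by rewrite divr_ge0 ?LgInt_ge0 ?ler0n. Qed.

(** Discrete form of [- (P_r(x) exp(-x))' = x^r exp(-x)], as [P_r - r P_(r-1) = x^r]. The factor 2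
    pays for replacing [(n+1)(n+2)] by [(n+1)^2]. *)
Lemma LgTail_incr r n :
  Lg n ^+ r / n.+1%:R ^+ 2 <= 2 * (LgTail r n - LgTail r n.+1).
Proof.
have h1 := LgInt_incr r n.+1.
have h2 : LgInt r n.+2 - r%:R * LgInt r.-1 n.+2 >= Lg n ^+ r.
  case: r {h1} => [|r] /=; first by rewrite mul0r subr0 expr0.
  by rewrite addrK LgXl_homo //; lia.
have e : n.+1%:R != 0 :> R by rewrite pnatr_eq0.
have e' : n.+2%:R != 0 :> R by rewrite pnatr_eq0.
have p1 : 0 < n.+1%:R :> R by rewrite ltr0n.
have p2 : 0 < n.+2%:R :> R by rewrite ltr0n.
have h3 : Lg n ^+ r / (n.+1%:R * n.+2%:R) <= LgTail r n - LgTail r n.+1.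
  have -> : LgTail r n - LgTail r n.+1 = LgInt r n.+2 / (n.+1%:R * n.+2%:R) -
     (LgInt r n.+2 - LgInt r n.+1) / n.+1%:R.
    rewrite /LgTail.
    have : n.+2%:R = n.+1%:R + 1 :> R by rewrite natr1.
    move: (n.+1%:R) (n.+2%:R) e e' => x y x0 y0 yx.
    rewrite yx in y0 *; field; exact/andP.
  apply: (@le_trans _ _ ((LgInt r n.+2 - r%:R * LgInt r.-1 n.+2) /
     (n.+1%:R * n.+2%:R))).
    by rewrite ler_wpM2r // invr_ge0 mulr_ge0 // ltW.
  rewrite mulrBl lerB // ler_pdivrMr // (le_trans h1) //.
  move: (n.+1%:R) (n.+2%:R) e e' => x y x0 y0.
  rewrite le_eqVlt; apply/orP; left; apply/eqP; field; exact/andP.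
apply: (@le_trans _ _ (2 * (Lg n ^+ r / (n.+1%:R * n.+2%:R)))); last by rewrite ler_pM2l.
rewrite mulrCA ler_wpM2l ?LgX_ge0 //.
rewrite ler_pdivlMr ?mulr_gt0 // mulrC ler_pdivrMr ?exprn_gt0 //.
rewrite -natrX -!natrM ler_nat; nia.
Qed.

Lemma LgInt_le r n : LgInt r n <= (LgInt r 0) * Lg n ^+ r.
Proof.
elim: r => [|r IH] /=; first by rewrite expr0 mulr1.
rewrite mulrDl Lg0 expr1n mul1r lerD2l -mulrA ler_wpM2l ?ler0n //.
rewrite (le_trans IH) // ler_wpM2l ?LgInt_ge0 // LgX_homo //.
Qed.

Lemma LgTail_le r : exists K, forall n, LgTail r n <= K * Lg n ^+ r / n.+1%:R.
Proof.
exists (LgInt r 0 * 2 ^+ r) => n.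
rewrite /LgTail ler_wpM2r ?invr_ge0 ?ler0n // (le_trans (LgInt_le _ _)) //.
rewrite -mulrA ler_wpM2l ?LgInt_ge0 // -exprMn lerXn2r ?nnegrE ?mulr_ge0 ?Lg_ge0 //.
exact: LgS_le.
Qed.

Lemma Lg_unbounded (A : R) : exists N, forall n, (N <= n)%N -> A < Lg n.
Proof.
(* Doubling argument: the block of reciprocals from [N+2] to [2N+2] adds at least 1/2. *)
have h : forall k : nat, exists N, (k.+1%:R / 2 : R) <= Lg N.
  elim=> [|k [N hN]]; first by exists 0%N; rewrite Lg0; lra.
  exists (N.+1 + N.+1)%N.
  have -> : Lg (N.+1 + N.+1) = Lg N.+1 + \sum_(k < N.+1) (N.+1 + k).+1%:R^-1.
    by rewrite /Lg big_split_ord /= addrA.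
  have h1 : \sum_(k < N.+1) ((N.+1 + k).+1%:R^-1 : R) >= 2^-1.
    apply: (@le_trans _ _ (\sum_(k < N.+1) (N.+1 + N.+1)%:R^-1)).
      rewrite sumr_const card_ord -[X in _ <= X]mulr_natr natrD.
      have p : N.+1%:R != 0 :> R by rewrite pnatr_eq0.
      move: (N.+1%:R) p => x x0; rewrite le_eqVlt; apply/orP; left; apply/eqP; field.
      by rewrite -mulr2n -mulr_natl mulf_neq0 ?pnatr_eq0.
    apply: ler_sum => i _; rewrite lef_pV2 ?posrE ?ltr0n ?ler_nat //.
    by have := ltn_ord i; lia.
  have := Lg_homo (leqnSn N).
  rewrite -[k.+2]addn1 natrD.
  move=> h2; rewrite mulrDl mul1r; apply: lerD => //; exact: le_trans hN h2.
have [N hN] := h (Num.bound (2 * `|A|)).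
exists N => n Nn; apply: lt_le_trans (le_trans hN (Lg_homo Nn)).
have := archi_boundP (mulr_ge0 (ler0n R 2) (normr_ge0 A)).
rewrite -[(Num.bound _).+1%:R]natr1; have := ler_norm A; lra.
Qed.

Lemma LgX_small r (A eps : R) : 0 < eps ->
  exists N, forall n, (N <= n)%N -> A * Lg n ^+ r / n.+1%:R <= eps.
Proof.
move=> eps0.
(* One logarithm is spent: the quotient with exponent [r+1] stays bounded because [LgTail] is
   nonincreasing, and dividing it by the unbounded [Lg n] makes it small. *)
have B n : Lg n ^+ r.+1 / n.+1%:R <= LgInt r.+1 1.
  have h : LgTail r.+1 n <= LgTail r.+1 0.
    elim: n => [//|n IH]; apply: le_trans IH.
    have p : 0 <= Lg n ^+ r.+1 / n.+1%:R ^+ 2 by rewrite divr_ge0 ?LgX_ge0 ?exprn_ge0 ?ler0n.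
    by have := le_trans p (LgTail_incr r.+1 n); rewrite pmulr_rge0 // subr_ge0.
  rewrite /LgTail invr1 mulr1 in h; apply: le_trans h.
  rewrite ler_wpM2r ?invr_ge0 ?ler0n //.
  rewrite (le_trans (LgXl_homo r.+1 (leqnSn n))) // [X in _ <= X]/=.
  by rewrite lerDl mulr_ge0 ?ler0n // LgInt_ge0.
have [N hN] := Lg_unbounded (`|A| * LgInt r.+1 1 / eps).
exists N => n Nn; have {hN} hN := hN n Nn.
have L0 := Lg_gt0 n.
rewrite ltr_pdivrMr // in hN.
have Bn := B n.
have -> : A * Lg n ^+ r / n.+1%:R = A * (Lg n ^+ r.+1 / n.+1%:R) / Lg n.
  have p : n.+1%:R != 0 :> R by rewrite pnatr_eq0.
  move: (n.+1%:R) p => x x0; rewrite exprS; field.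
  by rewrite x0 gt_eqF.
rewrite ler_pdivrMr // mulrC.
have B0 : 0 <= Lg n ^+ r.+1 / n.+1%:R by rewrite divr_ge0 ?LgX_ge0 ?ler0n.
rewrite mulrC [X in _ <= X]mulrC; apply: le_trans (ltW hN).
exact: le_trans (ler_wpM2r B0 (ler_norm A)) (ler_wpM2l (normr_ge0 A) Bn).
Qed.

(* Since [Lg n] grows like [log n], this means [a n = O(log^r n / n^d)] for some r. *)
Definition bnd (d : nat) (a : nat -> C) : Prop :=
  exists K : R, exists r : nat,
    forall n, normc (a n) <= K * Lg n ^+ r / n.+1%:R ^+ d.

Lemma bnd_ext d (a b : nat -> C) : a =1 b -> bnd d a -> bnd d b.
Proof. by move=> ab [K [r h]]; exists K, r => n; rewrite -ab. Qed.

Lemma normc_ge0 (z : C) : 0 <= normc z.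
Proof. by case: z => x y; apply: sqrtr_ge0. Qed.

Lemma bnd_pos d a : bnd d a -> exists K : R, 0 <= K /\ exists r : nat,
  forall n s, (r <= s)%N -> normc (a n) <= K * Lg n ^+ s / n.+1%:R ^+ d.
Proof.
move=> [K [r h]]; have K0 : 0 <= K.
  by have := le_trans (normc_ge0 _) (h 0%N); rewrite Lg0 !expr1n mulr1 divr1.
exists K; split=> //; exists r => n s rs; apply: le_trans (h n) _.
by rewrite ler_wpM2r ?invr_ge0 ?exprn_ge0 ?ler0n // ler_wpM2l // LgX_homo.
Qed.

Lemma bndW d d' a : (d' <= d)%N -> bnd d a -> bnd d' a.
Proof.
move=> dd /bnd_pos[K [K0 [r h]]]; exists K, r => n; apply: le_trans (h n r _) _ => //.
rewrite ler_wpM2l ?mulr_ge0 ?LgX_ge0 // lef_pV2 ?posrE ?exprn_gt0 ?ltr0n //.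
by rewrite ler_weXn2l // ler1n.
Qed.

Lemma bndD d a b : bnd d a -> bnd d b -> bnd d (fun n => a n + b n).
Proof.
move=> /bnd_pos[K [K0 [r h]]] /bnd_pos[K' [K0' [r' h']]].
exists (K + K'), (r + r')%N => n; apply: le_trans (le_normcD _ _) _.
by rewrite !mulrDl lerD ?h ?h' ?leq_addr ?leq_addl.
Qed.

Lemma bndM d d' a b : bnd d a -> bnd d' b -> bnd (d + d') (fun n => a n * b n).
Proof.
move=> [K [r h]] [K' [r' h']]; exists (K * K'), (r + r')%N => n.
rewrite normcM !exprD invfM.
have -> : K * K' * (Lg n ^+ r * Lg n ^+ r') * ((n.+1%:R ^+ d)^-1 * (n.+1%:R ^+ d')^-1) =
  (K * Lg n ^+ r / n.+1%:R ^+ d) * (K' * Lg n ^+ r' / n.+1%:R ^+ d') by ring.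
by rewrite ler_pM ?normc_ge0.
Qed.

Lemma bnd_cst (z : C) : bnd 0 (fun=> z).
Proof. by exists (normc z), 0%N => n; rewrite !expr0 mulr1 divr1. Qed.

Lemma bnd0 d : bnd d (fun=> 0).
Proof. by exists 0, 0%N => n; rewrite normc0 !mul0r. Qed.

Lemma bndZ d z a : bnd d a -> bnd d (fun n => z * a n).
Proof. by move=> h; apply: (bndM (bnd_cst z) h). Qed.

Lemma bndN d a : bnd d a -> bnd d (fun n => - a n).
Proof. by move/(bndZ (-1)); apply: bnd_ext => n; rewrite mulN1r. Qed.

Lemma bndB d a b : bnd d a -> bnd d b -> bnd d (fun n => a n - b n).
Proof. by move=> ha /bndN hb; apply: bndD. Qed.

Lemma bnd_sum d (I : Type) (r : seq I) (P : pred I) (F : I -> nat -> C) :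
  (forall i, P i -> bnd d (F i)) -> bnd d (fun n => \sum_(i <- r | P i) F i n).
Proof.
move=> h; elim: r => [|i r IH].
  by apply: bnd_ext (bnd0 d) => n; rewrite big_nil.
have [Pi|nPi] := boolP (P i).
  by apply: bnd_ext (bndD (h i Pi) IH) => n; rewrite big_cons Pi.
by apply: bnd_ext IH => n; rewrite big_cons (negbTE nPi).
Qed.

Lemma bndS d a : bnd d a -> bnd d (fun n => a n.+1).
Proof.
move=> /bnd_pos[K [K0 [r h]]]; exists (K * 2 ^+ r), r => n.
apply: le_trans (h n.+1 r (leqnn _)) _.
apply: ler_pM; rewrite ?invr_ge0 ?exprn_ge0 ?ler0n ?mulr_ge0 ?LgX_ge0 //.
- rewrite -mulrA -exprMn ler_wpM2l // lerXn2r ?nnegrE ?mulr_ge0 ?Lg_ge0 //.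
  exact: LgS_le.
- by rewrite lef_pV2 ?posrE ?exprn_gt0 ?ltr0n // lerXn2r ?nnegrE ?ler0n // ler_nat.
Qed.

(** The intervals [[v n - D n, v n + D n]] are nested, so the supremum of their left ends lies in
    all of them; the rate comes together with the limit. *)
Lemma real_tail_limit (v D : nat -> R) :
  (forall n, 0 <= D n) -> (forall n, `|v n.+1 - v n| <= D n - D n.+1) ->
  exists l, forall n, `|v n - l| <= D n.
Proof.
move=> D0 h.
have inc m n : (m <= n)%N -> v m - D m <= v n - D n.
  apply: (@homo_leq _ (fun n => v n - D n) <=%O) => [//|? ? ?|k]; first exact: le_trans.
  by have := h k; rewrite ler_norml => /andP[]; lra.
have dec m n : (m <= n)%N -> v n + D n <= v m + D m.
  move=> mn; rewrite -lerN2; move: m n mn.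
  apply: (@homo_leq _ (fun n => - (v n + D n)) <=%O) => [//|? ? ?|k]; first exact: le_trans.
  by have := h k; rewrite ler_norml => /andP[] /= *; lra.
have vD m n : v m - D m <= v n + D n.
  have [mn|/ltnW nm] := leqP m n.
    by have := inc _ _ mn; have := D0 n; lra.
  by have := dec _ _ nm; have := D0 m; lra.
pose A := range (fun n => v n - D n).
have Aub n : ubound A (v n + D n) by move=> _ [k _ <-]; apply: vD.
exists (sup A) => n; rewrite ler_norml; apply/andP; split.
  have : sup A <= v n + D n by apply: ge_sup; [exists (v 0%N - D 0%N), 0%N | exact: Aub].
  lra.
have : v n - D n <= sup A.
  by apply: ub_le_sup; [exists (v 0%N + D 0%N); exact: Aub | exists n].
lra.
Qed.

Lemma normc_ReIm (z : C) : `|complex.Re z| <= normc z /\ `|complex.Im z| <= normc z.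
Proof.
case: z => x y /=; rewrite -!sqrtr_sqr; split; rewrite ler_wsqrtr //.
  by rewrite lerDl sqr_ge0.
by rewrite lerDr sqr_ge0.
Qed.

Lemma normc_le_ReIm (z : C) : normc z <= `|complex.Re z| + `|complex.Im z|.
Proof.
case: z => x y /=; rewrite -(ler_pXn2r (n := 2)) ?nnegrE ?sqrtr_ge0 ?addr_ge0 //.
rewrite sqr_sqrtr ?addr_ge0 ?sqr_ge0 // sqrrD !real_normK ?num_real //.
by rewrite -addrA [_ *+ 2 + _]addrC addrA lerDl mulrn_wge0 // mulr_ge0.
Qed.

Lemma bnd_limit v : bnd 2 (fun n => v n.+1 - v n) ->
  exists l, bnd 1 (fun n => v n - l).
Proof.
move=> /bnd_pos[K [K0 [r h]]].
pose D n := K * 2 * LgTail r n.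
have hD n : normc (v n.+1 - v n) <= D n - D n.+1.
  apply: le_trans (h n r (leqnn _)) _; rewrite -mulrBr -!mulrA ler_wpM2l //.
  exact: LgTail_incr.
have D0 n : 0 <= D n by rewrite /D mulr_ge0 ?LgTail_ge0 // mulr_ge0.
have [l hl] : exists l, forall n, `|complex.Re (v n) - l| <= D n.
  apply: real_tail_limit => // n; apply: le_trans (hD n).
  by rewrite -raddfB; exact: (normc_ReIm _).1.
have [l' hl'] : exists l, forall n, `|complex.Im (v n) - l| <= D n.
  apply: real_tail_limit => // n; apply: le_trans (hD n).
  by rewrite -raddfB; exact: (normc_ReIm _).2.
have [K' hK'] := LgTail_le r.
exists (l +i* l')%C; exists (2 * (K * 2 * K')), r => n.
apply: le_trans (normc_le_ReIm _) _.
apply: (@le_trans _ _ (D n + D n)).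
  by apply: lerD; case: (v n) (hl n) (hl' n).
have -> : 2 * (K * 2 * K') * Lg n ^+ r / n.+1%:R ^+ 1 =
  2 * (K * 2) * (K' * Lg n ^+ r / n.+1%:R) by rewrite expr1; ring.
have -> : D n + D n = 2 * (K * 2) * LgTail r n by rewrite /D; ring.
by rewrite ler_wpM2l ?mulr_ge0.
Qed.

Lemma bnd1_small a (eps : R) : bnd 1 a -> 0 < eps ->
  exists N, forall n, (N <= n)%N -> normc (a n) <= eps.
Proof.
move=> [K [r h]] e0; have [N hN] := LgX_small r K e0.
by exists N => n Nn; apply: le_trans (h n) (hN n Nn).
Qed.

Lemma bnd1_cst z : bnd 1 (fun=> z) -> z = 0.
Proof.
move=> h; apply: eq0_normc; apply/eqP; rewrite eq_le normc_ge0 andbT.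
apply/ler_addgt0Pl => e e0; rewrite addr0.
by have [N /(_ N (leqnn _))] := bnd1_small h e0.
Qed.

(** Increments [O(log^r n / n)] add up to [O(log^(r+1) n)]: each summation costs one logarithm. *)
Lemma bnd_inc_bnd a : bnd 1 (fun n => a n.+1 - a n) -> bnd 0 a.
Proof.
move=> /bnd_pos[K [K0 [r h]]]; exists (normc (a 0%N) + K), r.+1 => n.
have {}h n' : normc (a n'.+1 - a n') <= K * Lg n' ^+ r / n'.+1%:R by apply: h.
have : normc (a n) <= normc (a 0%N) + K * Lg n ^+ r * (Lg n - 1).
  elim: n => [|n IH]; first by rewrite Lg0 subrr mulr0 addr0.
  rewrite -[a n.+1](subrK (a n)) addrC (le_trans (le_normcD _ _)) //.
  rewrite (le_trans (lerD IH (h n))) // -addrA lerD2l.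
  apply: (@le_trans _ _ (K * Lg n ^+ r * (Lg n.+1 - 1))).
    by rewrite LgS le_eqVlt; apply/orP; left; apply/eqP; ring.
  have L1 := Lg_ge1 n.+1.
  by rewrite ler_wpM2r ?subr_ge0 // ler_wpM2l // LgXl_homo.
move=> /le_trans; apply; rewrite expr0 divr1 mulrDl lerD //.
  by rewrite ler_peMr ?normc_ge0 // exprn_ege1 // Lg_ge1.
rewrite exprSr mulrA ler_wpM2l ?mulr_ge0 ?LgX_ge0 //; lra.
Qed.

End Bounds.

(** * Nested sums and regularization *)

Section Nest.
Variable A : comNzRingType.
Implicit Types (F : nat -> A) (Fs : seq (nat -> A)).

(** Stated over any commutative ring, because the same sums occur with real, complex and power
    series terms. The bound [l] is exclusive, [N] inclusive. *)
Fixpoint nest Fs (N l : nat) : A :=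
  if Fs is F :: Fs' then \sum_(l.+1 <= k < N.+1) F k * nest Fs' N k else 1.

Lemma exchange_triangle (f : nat -> nat -> A) a b :
  \sum_(a <= k < b) \sum_(k.+1 <= k' < b) f k k' =
  \sum_(a <= k' < b) \sum_(a <= k < k') f k k'.
Proof.
have [ba|/ltnW ab] := leqP b a; first by rewrite !big_geq.
elim: b ab => [|b IH] ab; first by rewrite !big_geq.
move: ab; rewrite leq_eqVlt => /orP[/eqP <-|]; first by rewrite !big_geq.
rewrite ltnS => ab; rewrite [LHS]big_nat_recr //= [X in _ + X]big_geq // addr0.
rewrite [RHS]big_nat_recr //= -IH //.
rewrite -big_split /=; apply: eq_big_nat => k /andP[_ kb].
by rewrite big_nat_recr.
Qed.

Lemma nest_rcons Fs F N l :
  nest (rcons Fs F) N l = \sum_(l.+1 <= k < N.+1) nest Fs k.-1 l * F k.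
Proof.
elim: Fs l => [|G Fs IH] l /=.
  by apply: eq_bigr => k _; rewrite mulr1 mul1r.
under eq_bigr do rewrite IH big_distrr /=.
rewrite exchange_triangle; apply: eq_big_nat => -[//|k] /= _.
by rewrite big_distrl /=; apply: eq_bigr => j _; rewrite mulrA.
Qed.

Lemma nestS_rcons Fs F N :
  nest (rcons Fs F) N.+1 0 = nest (rcons Fs F) N 0 + nest Fs N 0 * F N.+1.
Proof. by rewrite !nest_rcons [LHS]big_nat_recr. Qed.

Lemma mulr_sum_nat F G a b :
  (\sum_(a <= k < b) F k) * (\sum_(a <= k < b) G k) =
  \sum_(a <= k < b) F k * (\sum_(k.+1 <= k' < b) G k') +
  \sum_(a <= k < b) G k * (\sum_(k.+1 <= k' < b) F k') +
  \sum_(a <= k < b) F k * G k.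
Proof.
have E H H' : \sum_(a <= k < b) H k * (\sum_(k.+1 <= k' < b) H' k') =
    \sum_(a <= k' < b) (\sum_(a <= k < k') H k) * H' k' :> A.
  under eq_bigr do rewrite big_distrr /=.
  by rewrite exchange_triangle; apply: eq_bigr => k _; rewrite big_distrl.
rewrite !E; have [ba|/ltnW ab] := leqP b a; first by rewrite !big_geq ?mul0r ?addr0.
elim: b ab {E} => [|b IH] ab; first by rewrite !big_geq ?mul0r ?addr0.
move: ab; rewrite leq_eqVlt => /orP[/eqP <-|].
  by rewrite !big_geq ?mul0r ?addr0.
rewrite ltnS => ab; rewrite !big_nat_recr //= mulrDl !mulrDr IH //; ring.
Qed.

End Nest.

Section Words.
Variable R : realType.
Notation C := R[i].
Implicit Types (den : nat -> C) (a : letter R) (u v w : word R).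

Definition lfun den a : nat -> C := fun k => a.1 ^+ k / den k ^+ a.2.

Lemma trunc_sumE den M l w : trunc_sum den M l w = nest (map (lfun den) w) M l.
Proof. by elim: w l => [//|[eps n] w IH] l /=; apply: eq_bigr => k _; rewrite IH. Qed.

Local Arguments trunc_sum : simpl never.

Lemma trunc_sum_stuffle den M l u v :
  trunc_sum den M l u * trunc_sum den M l v =
  \sum_(w <- stuffle u v) trunc_sum den M l w.
Proof.
elim: u v l => [|a u IHu] v l; first by rewrite big_seq1 mul1r.
elim: v l => [|b v IHv] l; first by rewrite big_seq1 mulr1.
rewrite [stuffle _ _]/= !big_cat !big_map /=.
have E j c t : trunc_sum den M j (c :: t) =
    \sum_(j.+1 <= k < M.+1) lfun den c k * trunc_sum den M k t by case: c.
(* Of the two first indices, one is smaller, or the other, or they are equal: these are the three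
   terms of the quasi-shuffle product. *)
rewrite !E mulr_sum_nat -addrA; congr (_ + (_ + _)).
- under [RHS]eq_bigr do rewrite E.
  rewrite [RHS]exchange_big /=; apply: eq_bigr => k _.
  by rewrite -mulrA -big_distrr -IHu E.
- under [RHS]eq_bigr do rewrite E.
  rewrite [RHS]exchange_big /=; apply: eq_bigr => k _.
  rewrite -mulrA -big_distrr /=; congr (_ * _).
  by rewrite mulrC -E; exact: IHv.
- under [RHS]eq_bigr do rewrite E.
  rewrite [RHS]exchange_big /=; apply: eq_bigr => k _.
  rewrite -big_distrr -IHu /lfun /= exprMn exprD invfM; ring.
Qed.

Lemma valid_stuffle u v w : valid_word u -> valid_word v -> w \in stuffle u v ->
  valid_word w.
Proof.
elim: u v w => [|a u IHu] v w; first by move=> _ hv; rewrite mem_seq1 => /eqP ->.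
move=> hau; have /andP[ha hu] := hau.
elim: v w => [|b v IHv] w; first by rewrite mem_seq1 => _ /eqP ->.
move=> hbv; have /andP[hb hv] := hbv.
rewrite [stuffle _ _]/= !mem_cat => /or3P[] /mapP[t ht ->] /=.
- by rewrite ha (IHu (b :: v)).
- by rewrite hb IHv.
rewrite (IHu v) // andbT /valid_letter /= normrM.
move: ha hb => /andP[/eqP -> ha] /andP[/eqP -> hb]; rewrite mulr1 eqxx /=.
by rewrite addn_gt0 ha.
Qed.

Lemma stuffle_nil u : stuffle u [::] = [:: u].
Proof. by case: u. Qed.

Lemma mem_stuffle1 u x w : w \in stuffle u [:: x] ->
  exists u1 u2, (u = u1 ++ u2 /\ w = u1 ++ x :: u2) \/
    exists a, u = u1 ++ a :: u2 /\ w = u1 ++ diamond a x :: u2.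
Proof.
elim: u w => [|a u IH] w.
  by rewrite mem_seq1 => /eqP ->; exists [::], [::]; left.
rewrite [stuffle _ _]/= !mem_cat => /or3P[/mapP[t ht ->]||/mapP[t ht ->]].
- have [u1 [u2 [[-> ->]|[b [-> ->]]]]] := IH _ ht.
    by exists (a :: u1), u2; left.
  by exists (a :: u1), u2; right; exists b.
- by move=> /eqP ->; exists [::], (a :: u); left.
- move: ht; rewrite stuffle_nil mem_seq1 => /eqP ->.
  by exists [::], u; right; exists a.
Qed.

Lemma rcons_in_stuffle1 u x : rcons u x \in stuffle u [:: x].
Proof.
elim: u => [|a u IH]; first by rewrite mem_seq1.
by rewrite [stuffle _ _]/= mem_cat; apply/orP; left; apply: map_f.
Qed.

(** The number of final letters [[1,1]], the induction parameter for the uniqueness of the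
    regularization. *)
Definition trailing w : nat := find (predC1 (letter11 R)) (rev w).

(** Inserting [[1,1]] within the final block gives [rcons u [1,1]]; inserting it earlier leaves the
    block alone; merging it into a letter gives weight at least 2, which can only shorten the
    block. *)
Lemma trailing_stuffle1 u w : valid_word u -> w \in stuffle u [:: letter11 R] ->
  w = rcons u (letter11 R) \/ (trailing w <= trailing u)%N.
Proof.
move=> hu /mem_stuffle1[u1 [u2 [[ue ->]|[a [ue ->]]]]].
  have [h|nh] := boolP (has (predC1 (letter11 R)) u2).
    right; rewrite ue /trailing !rev_cat !find_cat rev_cons -cats1.
    by rewrite has_cat !has_rev h /= find_cat has_rev h.
  left; rewrite ue.
  suff -> : u2 = nseq (size u2) (letter11 R).
    by rewrite rcons_cat; congr (_ ++ _); elim: (size u2) => //= n ->.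
  apply/all_pred1P; move: nh; rewrite -all_predC; apply: sub_all => b /=.
  by rewrite negbK.
right; rewrite ue /trailing !rev_cat !rev_cons -!cats1 -!catA !find_cat.
have -> : has (predC1 (letter11 R)) [:: diamond a (letter11 R)].
  rewrite /= orbF; apply/eqP => -[_ h].
  have : valid_letter a by move: hu; rewrite ue /valid_word all_cat => /andP[_ /andP[]].
  by move=> /andP[_ ha]; move: h => /=; lia.
have -> : find (predC1 (letter11 R)) [:: diamond a (letter11 R)] = 0%N.
  rewrite /=; case: ifP => // /negbFE /eqP -[_ h].
  have : valid_letter a by move: hu; rewrite ue /valid_word all_cat => /andP[_ /andP[]].
  by move=> /andP[_ ha]; move: h => /=; lia.
by case: ifP => // _; rewrite leq_add2l.
Qed.

End Words.

(** * Polynomials evaluated along an unbounded sequence *)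

Section NullSequences.
Variable R : realType.
Notation C := R[i].
Implicit Types (a b h : nat -> C) (p : {poly C}).

Definition null a : Prop := forall eps : R, 0 < eps ->
  exists N, forall n, (N <= n)%N -> normc (a n) <= eps.

Lemma null_ext a b : a =1 b -> null a -> null b.
Proof.
by move=> ab h eps /h[N hN]; exists N => n Nn; rewrite -ab; apply: hN.
Qed.

Lemma bnd1_null a : bnd 1 a -> null a.
Proof. by move=> ha eps e0; apply: bnd1_small. Qed.

Lemma null_cst z : null (fun=> z) -> z = 0.
Proof.
move=> h; apply: eq0_normc; apply/eqP; rewrite eq_le normc_ge0 andbT.
apply/ler_addgt0Pl => e e0; rewrite addr0.
by have [N /(_ N (leqnn _))] := h e e0.
Qed.

Definition unbounded h : Prop :=
  forall A : R, exists N, forall n, (N <= n)%N -> A <= normc (h n).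

(** Write the polynomial as [p X + c]. Its values are eventually bounded, so [p.[h n]] is at most a
    constant over [|h n|], hence null, and induction gives [p = 0]; then [c = 0]. This makes
    asymptotic polynomials unique. *)
Lemma null_horner h p : unbounded h -> null (fun n => p.[h n]) -> p = 0.
Proof.
move=> hh; elim/poly_ind: p => [//|p c IH] hp.
have hp0 : p = 0.
  apply: IH => eps e0.
  have [N1 hN1] := hp 1 ltr01.
  have [N2 hN2] := hh ((1 + normc c) / eps).
  exists (maxn N1 N2) => n; rewrite geq_max => /andP[/hN1 h1 /hN2 h2].
  have q1 : normc (p.[h n] * h n) <= 1 + normc c.
    have -> : p.[h n] * h n = (p * 'X + c%:P).[h n] + (- c) by rewrite !hornerE addrK.
    by rewrite (le_trans (le_normcD _ _)) // normcN lerD2r.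
  have c0 := normc_ge0 c.
  have hpos : 0 < normc (h n).
    by apply: lt_le_trans h2; rewrite divr_gt0 //; lra.
  rewrite -(ler_pM2r hpos) -normcM (le_trans q1) //.
  by rewrite mulrC -ler_pdivrMr.
move: hp; rewrite hp0 mul0r add0r => hp.
suff -> : c = 0 by rewrite polyC0.
by apply: null_cst; apply: null_ext hp => n; rewrite hornerC.
Qed.

Lemma bnd_exp h k : bnd 0 h -> bnd 0 (fun n => h n ^+ k).
Proof.
move=> hh; elim: k => [|k IH].
  by apply: bnd_ext (bnd_cst 1) => n; rewrite expr0.
by apply: bnd_ext (bndM hh IH) => n; rewrite exprS.
Qed.

Lemma bnd_horner h p : bnd 0 h -> bnd 0 (fun n => p.[h n]).
Proof.
move=> hh; apply: (@bnd_ext _ _ (fun n => \sum_(i < size p) p`_i * h n ^+ i)).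
  by move=> n; rewrite horner_coef.
by apply: bnd_sum => i _; apply: bndZ; apply: bnd_exp.
Qed.

Lemma bnd1_exp (d : nat -> C) k : bnd 1 d -> (0 < k)%N -> bnd 1 (fun n => d n ^+ k).
Proof.
case: k => // k hd _; apply: (@bndW _ (1 + 0)) => //.
by apply: bnd_ext (bndM hd (bnd_exp k (bndW (leq0n 1) hd))) => n; rewrite exprS.
Qed.

Lemma bnd_horner_taylor h (d : nat -> C) p : bnd 0 h -> bnd 1 d ->
  bnd 2 (fun n => p.[h n + d n] - p.[h n] - d n * p^`().[h n]).
Proof.
move=> hh hd.
apply: (@bnd_ext _ _ (fun n =>
   \sum_(i < size p | (1 < i)%N) p^`N(i).[h n] * d n ^+ i)).
  move=> n; rewrite (nderiv_taylor p (mulrC (h n) (d n))).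
  case: (ltnP 1 (size p)) => sp.
    case: (size p) sp => [//|[//|s]] _.
    rewrite big_mkcond /= big_ord_recl big_ord_recl [in RHS]big_ord_recl [in RHS]big_ord_recl /=.
    rewrite poly.nderivn0 poly.nderivn1 expr0 expr1 mulr1 !add0r /bump /=.
    ring.
  rewrite big_pred0 => [|i]; last by have := ltn_ord i; lia.
  have -> : p = (p`_0)%:P by apply: size1_polyC.
  rewrite derivC hornerC hornerC mulr0 subr0.
  have [->|c0] := eqVneq p`_0 0; first by rewrite size_polyC eqxx big_ord0 subrr.
  by rewrite size_polyC c0 big_ord1 poly.nderivn0 hornerC expr0 mulr1 subrr.
apply: bnd_sum => i i1; apply: (@bndM _ 0 2).
  exact: bnd_horner.
case: (val i) i1 => [//|[//|k]] _.
apply: (@bnd_ext _ _ (fun n => d n * (d n ^+ k.+1))).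
  by move=> n; rewrite [RHS]exprS.
by apply: (bndM hd (bnd1_exp hd _)).
Qed.

Definition antideriv p : {poly C} := \poly_(i < (size p).+1) (p`_i.-1 / i%:R).

Lemma deriv_antideriv p : (antideriv p)^`() = p.
Proof.
apply/polyP => i; rewrite coef_deriv coef_poly /= ltnS.
case: ltnP => hi; last by rewrite mul0rn nth_default.
by rewrite -[LHS]mulr_natr divfK // pnatr_eq0.
Qed.

End NullSequences.

(** * Asymptotic polynomials of truncated sums and the regularized values *)

Section Regularization.
Variable R : realType.
Notation C := R[i].
Variable den : nat -> C.
Implicit Types (w u v : word R) (a : letter R) (p : {poly C}).

Notation x := (letter11 R).
Notation T w := (fun n : nat => trunc_sum den n 0 w).

(** The common properties of the zeta and [t] denominators: the bound on differences serves Abel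
    summation for a last letter [[z,1]] with [z != 1]; unboundedness gives uniqueness of the
    asymptotic polynomial. *)
Definition good_den : Prop :=
  [/\ bnd 1 (fun k => (den k.+1)^-1),
      bnd 2 (fun k => (den k.+2)^-1 - (den k.+1)^-1) &
      unbounded (T [:: x])].

Hypothesis gden : good_den.

Lemma trunc_sum0r n l : trunc_sum den n l [::] = 1.
Proof. by []. Qed.

Lemma truncS_rcons n w a :
  T (rcons w a) n.+1 = T (rcons w a) n + T w n * lfun den a n.+1.
Proof. by rewrite /= !trunc_sumE map_rcons nestS_rcons. Qed.

Lemma truncS_x n : T [:: x] n.+1 = T [:: x] n + (den n.+1)^-1.
Proof.
have := truncS_rcons n [::] x; rewrite /= => ->.
by rewrite /lfun /= expr1n mul1r mul1r expr1.
Qed.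

Lemma normc_unit (z : C) : `|z| = 1 -> normc z = 1.
Proof. by case: z => u v; rewrite normc_def /= => -[]. Qed.

Lemma bnd_unitX (z : C) : `|z| = 1 -> bnd 0 (fun n => z ^+ n).
Proof.
move=> z1; exists 1, 0%N => n; rewrite !expr0 divr1 mulr1.
by elim: n => [|n IH]; rewrite ?expr0 ?normc1 // exprS normcM normc_unit // mul1r.
Qed.

Lemma bnd_lfun a : valid_letter a -> bnd a.2 (fun n => lfun den a n.+1).
Proof.
move=> /andP[/eqP h _]; have [hd _ _] := gden.
rewrite -[a.2]add0n; apply: bndM; first exact: (bndS (bnd_unitX h)).
elim: (a.2) => [|k IH].
  by apply: bnd_ext (bnd_cst 1) => n; rewrite expr0 invr1.
by apply: bnd_ext (bndM hd IH) => n; rewrite exprS invfM.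
Qed.

Lemma trunc_bnd w : valid_word w ->
  bnd 0 (T w) /\ bnd 1 (fun n => T w n.+1 - T w n).
Proof.
elim/last_ind: w => [|w a IH].
  move=> _; split; first exact: bnd_cst.
  by apply: bnd_ext (bnd0 _ 1) => n; rewrite !trunc_sum0r subrr.
rewrite /valid_word all_rcons => /andP[ha hw].
have [h0 _] := IH hw.
suff h : bnd 1 (fun n => T (rcons w a) n.+1 - T (rcons w a) n).
  by split=> //; exact: bnd_inc_bnd.
apply: (@bnd_ext _ _ (fun n => T w n * lfun den a n.+1)).
  by move=> n; rewrite /= truncS_rcons addrAC subrr add0r.
by apply: (bndM h0); apply: bndW (bnd_lfun ha); move/andP: ha => [].
Qed.

Definition asymp w p : Prop := bnd 1 (fun n => T w n - p.[T [:: x] n]).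

Lemma valid_x : valid_letter x.
Proof. by rewrite /valid_letter /= normr1 eqxx. Qed.

Lemma bnd_h : bnd 0 (T [:: x]).
Proof. by have [] := @trunc_bnd [:: x] (introT andP (conj valid_x isT)). Qed.

Lemma asymp_inj w p q : asymp w p -> asymp w q -> p = q.
Proof.
move=> hp hq; apply/eqP; rewrite -subr_eq0; apply/eqP.
have [_ _ hu] := gden; apply: (null_horner hu).
apply: null_ext (bnd1_null (bndB hq hp)) => n; rewrite !hornerE; ring.
Qed.

(** The increment of the sum for [w x] is about [p.[h] / den], which by Taylor is the increment of
    an antiderivative of [p] along [h], up to [O(log^r n / n^2)]. The difference therefore
    converges, and its limit is the constant of integration. *)
Lemma asymp_rcons_x w p : valid_word w -> asymp w p ->
  exists q, q^`() = p /\ asymp (rcons w x) q.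
Proof.
move=> hw hp; have [hd _ _] := gden.
pose q := antideriv p.
have [l hl] : exists l, bnd 1 (fun n => T (rcons w x) n - q.[T [:: x] n] - l).
  apply: bnd_limit.
  apply: (@bnd_ext _ _ (fun n => (T w n - p.[T [:: x] n]) * (den n.+1)^-1 -
     (q.[T [:: x] n + (den n.+1)^-1] - q.[T [:: x] n] -
       (den n.+1)^-1 * q^`().[T [:: x] n]))).
    move=> n; rewrite deriv_antideriv truncS_x truncS_rcons.
    rewrite /lfun /= expr1n expr1; ring.
  apply: bndB; first exact: (bndM hp hd).
  apply: bnd_horner_taylor => //; exact: bnd_h.
exists (q + l%:P); split; first by rewrite derivD derivC addr0 deriv_antideriv.
by apply: bnd_ext hl => n; rewrite hornerD hornerC opprD addrA.
Qed.

Lemma asymp_rcons w a : valid_word w -> valid_letter a -> a != x ->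
  exists l, asymp (rcons w a) l%:P.
Proof.
move=> hw ha ax; have [hd hd2 _] := gden; have [tb ti] := trunc_bnd hw.
have hl := bnd_lfun ha.
suff [l h] : exists l, bnd 1 (fun n => T (rcons w a) n - l).
  by exists l; apply: bnd_ext h => n; rewrite hornerC.
case: (ltnP 1 a.2) => a2.
  apply: bnd_limit; apply: (@bnd_ext _ _ (fun n => T w n * lfun den a n.+1)).
    by move=> n; rewrite truncS_rcons addrAC subrr add0r.
  by apply: (bndM tb); apply: bndW hl.
case: a ha ax hl a2 => z k /= ha ax hl a2.
have k1 : k = 1%N by case/andP: ha => _ /=; lia.
subst k; clear a2.
have z1 : z != 1 by apply: contra ax => /eqP ->.
have nz : `|z| = 1 by case/andP: ha => /eqP.
pose G n := T w n / den n.+1.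
have G1 : bnd 1 G by apply: (bndM tb hd).
have G2 : bnd 2 (fun n => G n.+1 - G n).
  apply: (@bnd_ext _ _ (fun n => (T w n.+1 - T w n) * (den n.+2)^-1 +
       T w n * ((den n.+2)^-1 - (den n.+1)^-1))).
    by move=> n; rewrite /G; ring.
  apply: bndD; [exact: (bndM ti (bndS hd)) | exact: (bndM tb hd2)].
have E n : T (rcons w (z, 1%N)) n.+1 = T (rcons w (z, 1%N)) n + z ^+ n.+1 * G n.
  by rewrite truncS_rcons /G /lfun /= expr1; ring.
have zz : z - 1 != 0 by rewrite subr_eq0.
have hz := bnd_unitX nz.
(* Abel summation: after subtraction of the boundary term, the increments are multiples of
   [z^(n+2) (G (n+1) - G n)], hence [O(log^r n / n^2)]. *)
have [l h] : exists l, bnd 1 (fun n => T (rcons w (z, 1%N)) n.+1 -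
    z ^+ n.+2 * G n / (z - 1) - l).
  apply: bnd_limit.
  apply: (@bnd_ext _ _ (fun n => - (z - 1)^-1 * (z ^+ n.+2 * (G n.+1 - G n)))).
    by move=> n; rewrite (E n.+1) (exprS z n.+2) (exprS z n.+1); field.
  apply: bndZ; exact: (bndM (bndS (bndS hz)) G2).
exists l.
apply: (@bnd_ext _ _ (fun n => (T (rcons w (z, 1%N)) n.+1 -
    z ^+ n.+2 * G n / (z - 1) - l) + ((z - 1)^-1 * (z ^+ n.+2 * G n) - z ^+ n.+1 * G n))).
  by move=> n; rewrite E; ring.
apply: bndD => //; apply: bndB; last exact: (bndM (bndS hz) G1).
by apply: bndZ; exact: (bndM (bndS (bndS hz)) G1).
Qed.

Lemma asymp_exists w : valid_word w -> exists p, asymp w p.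
Proof.
elim/last_ind: w => [_|w a IH].
  by exists 1; apply: bnd_ext (bnd0 _ 1) => n; rewrite hornerC subrr.
rewrite /valid_word all_rcons => /andP[ha hw].
have [p hp] := IH hw.
have [->|ax] := eqVneq a x.
  by have [q [_ hq]] := asymp_rcons_x hw hp; exists q.
by have [l hl] := asymp_rcons hw ha ax; exists l%:P.
Qed.

(** The regularized value with [T] left free. The default 0 is never reached on valid words, by
    [asymp_exists]. *)
Definition asymp_poly w : {poly C} := xget 0 [set p | asymp w p]%classic.

Lemma asymp_polyP w : valid_word w -> asymp w (asymp_poly w).
Proof. by move=> /asymp_exists[p hp]; apply: (xgetPex 0); exists p. Qed.

Lemma asymp_polyE w p : valid_word w -> asymp w p -> asymp_poly w = p.
Proof. by move=> /asymp_polyP; apply: asymp_inj. Qed.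

Lemma asymp_poly_nil : asymp_poly [::] = 1.
Proof.
by apply: asymp_polyE => //; apply: bnd_ext (bnd0 _ 1) => n; rewrite hornerC subrr.
Qed.

Lemma asymp_poly_x : asymp_poly [:: x] = 'X.
Proof.
apply: asymp_polyE; first by rewrite /valid_word /= valid_x.
by apply: bnd_ext (bnd0 _ 1) => n; rewrite hornerX subrr.
Qed.

Lemma deriv_asymp_poly w a : valid_word w -> valid_letter a ->
  (asymp_poly (rcons w a))^`() = if a == x then asymp_poly w else 0.
Proof.
move=> hw ha; have hwa : valid_word (rcons w a) by rewrite /valid_word all_rcons ha.
case: eqVneq => [ax|ax].
  rewrite ax in hwa *.
  have [q [<- hq]] := asymp_rcons_x hw (asymp_polyP hw).
  by congr (_^`()); apply: asymp_polyE.
have [l hl] := asymp_rcons hw ha ax.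
by rewrite (asymp_polyE hwa hl) derivC.
Qed.

Lemma asymp_poly_stuffle u v : valid_word u -> valid_word v ->
  asymp_poly u * asymp_poly v = \sum_(w <- stuffle u v) asymp_poly w.
Proof.
move=> hu hv; apply/eqP; rewrite -subr_eq0; apply/eqP.
have [_ _ hun] := gden; apply: (null_horner hun); apply: bnd1_null.
pose E w n := T w n - (asymp_poly w).[T [:: x] n].
have B s : (forall w, w \in s -> valid_word w) -> bnd 1 (fun n => \sum_(w <- s) E w n).
  elim: s => [|w s IH] hs.
    by apply: bnd_ext (bnd0 _ 1) => n; rewrite big_nil.
  apply: (@bnd_ext _ _ (fun n => E w n + \sum_(w <- s) E w n)).
    by move=> n; rewrite big_cons.
  apply: bndD; first by apply: asymp_polyP; apply: hs; rewrite mem_head.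
  by apply: IH => w' w's; apply: hs; rewrite inE w's orbT.
apply: (@bnd_ext _ _ (fun n => \sum_(w <- stuffle u v) E w n -
   (E u n * T v n + (asymp_poly u).[T [:: x] n] * E v n))).
  move=> n; rewrite /E sumrB -trunc_sum_stuffle hornerD hornerN hornerM horner_sum.
  ring.
apply: bndB; first by apply: B => w; apply: valid_stuffle.
apply: bndD; first exact: (bndM (asymp_polyP hu) (trunc_bnd hv).1).
exact: (bndM (bnd_horner _ bnd_h) (asymp_polyP hv)).
Qed.

Lemma bnd1_cvg (a : nat -> C) l : bnd 1 (fun n => a n - l) ->
  (a @ \oo --> (l : C^o))%classic.
Proof.
move=> h; apply/(@cvgrPdist_le C C^o) => eps eps0.
have [e0 ee] : 0 < complex.Re eps /\ eps = (complex.Re eps)%:C%C.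
  by move: eps0; case: (eps) => p q; rewrite ltcE /= => /andP[/eqP -> ->].
have [N hN] := bnd1_small h e0.
exists N => // n /= Nn.
rewrite distrC ee; have := hN _ Nn.
by case: (a n - l) => p q /=; rewrite normc_def /= lecR.
Qed.

Lemma is_reg_asymp_poly c : is_reg den c (fun w => (asymp_poly w).[c]).
Proof.
split.
- by rewrite asymp_poly_nil hornerC.
- by move=> u v hu hv; rewrite -hornerM asymp_poly_stuffle // horner_sum.
- move=> w; elim/last_ind: w => [|w a _].
    move=> _ _; rewrite asymp_poly_nil hornerC.
    by apply: bnd1_cvg; apply: bnd_ext (bnd0 _ 1) => n; rewrite subrr.
  move=> hwa; have := hwa; rewrite /valid_word all_rcons => /andP[ha hw] sx.
  have ax : a != x.
    by apply: contra sx => /eqP ->; rewrite -cats1 suffix_suffix.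
  have [l hl] := asymp_rcons hw ha ax.
  rewrite (asymp_polyE hwa hl) hornerC; apply: bnd1_cvg.
  by apply: bnd_ext hl => n; rewrite hornerC.
- by rewrite asymp_poly_x hornerX.
Qed.

Lemma is_reg_unique c f g : is_reg den c f -> is_reg den c g ->
  forall w, valid_word w -> f w = g w.
Proof.
move=> [f1 fM fcv fx] [g1 gM gcv gx] w.
have [n] := ubnP (trailing w); elim: n w => // n IH w tw hw.
have [sx|sx] := boolP (suffix [:: x] w); last first.
  have hf := fcv _ hw sx; have hg := gcv _ hw sx.
  by have := cvg_unique (@norm_hausdorff C C^o) hf hg; apply.
have [u we] : exists u, w = rcons u x.
  by move/suffixP: sx => [u ->]; exists u; rewrite cats1.
have tru : trailing w = (trailing u).+1 by rewrite we /trailing rev_rcons /= eqxx.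
have hu : valid_word u by move: hw; rewrite we /valid_word all_rcons => /andP[].
have hx : valid_word [:: x] by rewrite /valid_word /= valid_x.
have fgu : f u = g u by apply: IH => //; rewrite tru in tw; lia.
have : \sum_(t <- stuffle u [:: x]) (f t - g t) = 0.
  by rewrite sumrB -fM // -gM // fgu fx gx subrr.
(* All terms of the product of [u] and [[1,1]] other than [w] have fewer final letters [[1,1]] than
   [w], so [f] and [g] agree there by induction. What remains is a positive multiple of
   [f w - g w]. *)
rewrite big_seq (eq_bigr (fun t => if t == w then f w - g w else 0)); last first.
  move=> t tm; case: eqVneq => [-> //|tnw].
  apply/eqP; rewrite subr_eq0; apply/eqP; apply: IH.
    have [tw'|] := trailing_stuffle1 hu tm; first by rewrite tw' -we eqxx in tnw.
    by rewrite tru in tw; lia.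
  exact: valid_stuffle tm.
rewrite -big_seq -big_mkcond /= big_const_seq iter_addr_0 => /eqP.
rewrite mulrn_eq0 subr_eq0 => /orP[|/eqP //].
have := rcons_in_stuffle1 u x; rewrite -we -has_pred1 has_count lt0n.
by move=> /negbTE h; rewrite h.
Qed.

Lemma reg_asymp_poly c w : valid_word w -> reg den c w = (asymp_poly w).[c].
Proof.
apply: (@is_reg_unique c _ (fun w => (asymp_poly w).[c])); last exact: is_reg_asymp_poly.
rewrite /reg; apply: (@xgetPex _ (fun=> 0) [set f | is_reg den c f]%classic).
by exists (fun w => (asymp_poly w).[c]); apply: is_reg_asymp_poly.
Qed.

End Regularization.

(** * The ring of formal power series *)

Section PowerSeries.
Variables (R : realType) (m : nat).
Notation C := R[i].

(* A copy of [fps] on which the ring product is [fps_mul] and not the pointwise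
   product. *)
Definition pser : Type := multinom m -> C.

HB.instance Definition _ := gen_eqMixin pser.
HB.instance Definition _ := gen_choiceMixin pser.
HB.instance Definition _ := GRing.Zmodule.copy pser (multinom m -> C^o).
HB.instance Definition _ := GRing.Lmodule.copy pser (multinom m -> C^o).

Implicit Types (F G H : pser) (p q l : mpoly m C) (nu : multinom m).

Lemma pserP F G : (forall nu, F nu = G nu) -> F = G.
Proof. by move=> h; apply/funext. Qed.

Lemma pserDE F G nu : (F + G) nu = F nu + G nu. Proof. by []. Qed.
Lemma pserNE F nu : (- F) nu = - F nu. Proof. by []. Qed.
Lemma pserBE F G nu : (F - G) nu = F nu - G nu. Proof. by []. Qed.
Lemma pserZE c F nu : (c *: F) nu = c * F nu. Proof. by []. Qed.
Lemma pser_sumE (I : Type) (r : seq I) (P : pred I) (E : I -> pser) nu :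
  (\sum_(i <- r | P i) E i) nu = \sum_(i <- r | P i) E i nu.
Proof. exact: (big_morph (fun F : pser => F nu)). Qed.

(** A coefficient of a product depends only on terms of no larger degree, so the ring laws of series
    are inherited from polynomials through truncation. *)
Definition trunc_pser (d : nat) F : mpoly m C :=
  \sum_(k : bmultinom m d.+1) F k *: mpolyX C k.

Lemma mcoeff_trunc_pser d F nu : (mdeg nu <= d)%N ->
  mcoeff nu (trunc_pser d F) = F nu.
Proof. by move=> h; rewrite /trunc_pser mcoeff_mpoly. Qed.

Lemma eq_mcoeffM p p' q q' nu :
  (forall mu, (mdeg mu <= mdeg nu)%N -> mcoeff mu p = mcoeff mu p') ->
  (forall mu, (mdeg mu <= mdeg nu)%N -> mcoeff mu q = mcoeff mu q') ->
  mcoeff nu (p * q) = mcoeff nu (p' * q').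
Proof.
move=> hp hq; rewrite !mcoeffM; apply: eq_bigr => k _.
by rewrite hp ?hq // -ltnS; apply: bmdeg.
Qed.

Definition psmul F G : pser := fps_mul F G.

Lemma psmulE d F G nu : (mdeg nu <= d)%N ->
  psmul F G nu = mcoeff nu (trunc_pser d F * trunc_pser d G).
Proof.
move=> h; rewrite mcoeffM /psmul /fps_mul; apply: eq_bigr => k _.
have b (j : bmultinom m (mdeg nu).+1) : (mdeg j <= d)%N.
  by apply: leq_trans h; rewrite -ltnS; apply: bmdeg.
by rewrite !mcoeff_trunc_pser.
Qed.

Lemma psmulA : associative psmul.
Proof.
move=> F G H; apply: pserP => nu; rewrite !(psmulE _ _ (leqnn _)).
transitivity (mcoeff nu (trunc_pser (mdeg nu) F *
   (trunc_pser (mdeg nu) G * trunc_pser (mdeg nu) H))).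
  by apply: eq_mcoeffM => // mu h; rewrite mcoeff_trunc_pser // (psmulE _ _ h).
rewrite mulrA.
by apply: eq_mcoeffM => // mu h; rewrite mcoeff_trunc_pser // (psmulE _ _ h).
Qed.

Lemma psmulC : commutative psmul.
Proof. by move=> F G; apply: pserP => nu; rewrite !(psmulE _ _ (leqnn _)) mulrC. Qed.

Lemma trunc_pserD d F G : trunc_pser d (F + G) = trunc_pser d F + trunc_pser d G.
Proof.
by rewrite /trunc_pser -big_split; apply: eq_bigr => k _; rewrite pserDE scalerDl.
Qed.

Lemma psmulDl : left_distributive psmul +%R.
Proof.
move=> F G H; apply: pserP => nu.
by rewrite pserDE !(psmulE _ _ (leqnn _)) trunc_pserD mulrDl mcoeffD.
Qed.

Definition psone : pser := fun nu => mcoeff nu (1 : mpoly m C).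

Lemma psmul1 : left_id psone psmul.
Proof.
move=> F; apply: pserP => nu; rewrite (psmulE _ _ (leqnn _)).
rewrite (@eq_mcoeffM _ 1 _ (trunc_pser (mdeg nu) F)) //.
  by rewrite mul1r mcoeff_trunc_pser.
by move=> mu h; rewrite mcoeff_trunc_pser.
Qed.

Lemma psone_neq0 : psone != 0.
Proof.
apply/eqP => /(congr1 (fun F : pser => F mnm0)).
by rewrite /psone mcoeff1 eqxx => /eqP; rewrite oner_eq0.
Qed.

HB.instance Definition _ := GRing.Zmodule_isComNzRing.Build pser
  psmulA psmulC psmul1 psmulDl psone_neq0.

(** Taken classically: later, the concrete inverses are identified with geometric series by
    [geo_unit]. *)
Definition psunit : pred pser := fun F => `[< exists G, G * F = 1 >].
Definition psinv F : pser :=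
  if psunit F then xget 0 [set G | G * F = 1]%classic else F.

Lemma psmulV : {in psunit, left_inverse 1 psinv *%R}.
Proof.
move=> F hF; rewrite /psinv (_ : psunit F = true) //.
by move/asboolP: hF => h; exact: (xgetPex (0 : pser) h).
Qed.

Lemma psunitP F G : G * F = 1 -> psunit F.
Proof. by move=> h; apply/asboolP; exists G. Qed.

Lemma psinv_out : {in [predC psunit], psinv =1 id}.
Proof. by move=> F hF; rewrite /psinv (_ : psunit F = false) //; apply/negbTE. Qed.

HB.instance Definition _ := GRing.ComNzRing_hasMulInverse.Build pser
  psmulV psunitP psinv_out.

Lemma scale_pserAl c F G : c *: (F * G) = (c *: F) * G.
Proof.
apply: pserP => nu; rewrite pserZE /GRing.mul /= !(psmulE _ _ (leqnn _)).
have -> : trunc_pser (mdeg nu) (c *: F) = c *: trunc_pser (mdeg nu) F.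
  by rewrite /trunc_pser scaler_sumr; apply: eq_bigr => k _; rewrite scalerA.
by rewrite -scalerAl mcoeffZ.
Qed.

HB.instance Definition _ := GRing.Lmodule_isLalgebra.Build C pser scale_pserAl.
HB.instance Definition _ := GRing.Lalgebra_isComAlgebra.Build C pser.

Definition ps p : pser := fun nu => mcoeff nu p.

Lemma psD p q : ps (p + q) = ps p + ps q.
Proof. by apply: pserP => nu; rewrite /ps mcoeffD. Qed.
Lemma psN p : ps (- p) = - ps p.
Proof. by apply: pserP => nu; rewrite /ps mcoeffN. Qed.
Lemma psB p q : ps (p - q) = ps p - ps q.
Proof. by rewrite psD psN. Qed.
Lemma psZ c p : ps (c *: p) = c *: ps p.
Proof. by apply: pserP => nu; rewrite /ps mcoeffZ. Qed.
Lemma psM p q : ps (p * q) = ps p * ps q.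
Proof. by apply: pserP => nu; rewrite /ps mcoeffM. Qed.
Lemma ps1 : ps 1 = 1. Proof. by []. Qed.

Lemma pserME F G nu : (F * G) nu =
  \sum_(k : bmultinom m (mdeg nu).+1 * bmultinom m (mdeg nu).+1
           | nu == mnm_add k.1 k.2) F k.1 * G k.2.
Proof. by []. Qed.

Lemma pser1E nu : (1 : pser) nu = (nu == mnm0)%:R.
Proof. by rewrite -ps1 /ps mcoeff1. Qed.

Lemma pserM0 F G : (F * G) mnm0 = F mnm0 * G mnm0.
Proof.
rewrite /GRing.mul /= (psmulE _ _ (leqnn _)) -!(@mcoeff_trunc_pser (mdeg (@mnm0 m))) //.
exact: rmorphM.
Qed.

Definition nocst l : Prop := mcoeff mnm0 l = 0.

Lemma mcoeff_ordM p q (a b : nat) nu :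
  (forall mu, (mdeg mu < a)%N -> mcoeff mu p = 0) ->
  (forall mu, (mdeg mu < b)%N -> mcoeff mu q = 0) ->
  (mdeg nu < a + b)%N -> mcoeff nu (p * q) = 0.
Proof.
move=> hp hq h; rewrite mcoeffM big1 // => k /eqP e.
have : (mdeg k.1 < a)%N || (mdeg k.2 < b)%N.
  have : (mdeg k.1 + mdeg k.2 < a + b)%N by rewrite -mdegD -e.
  by move: (mdeg k.1) (mdeg k.2) => x y; lia.
by case/orP => h'; rewrite ?(hp _ h') ?(hq _ h') ?mul0r ?mulr0.
Qed.

Lemma mcoeff_exp_nocst l n nu : nocst l -> (mdeg nu < n)%N ->
  mcoeff nu (l ^+ n) = 0.
Proof.
move=> hl; elim: n nu => // n IH nu h; rewrite exprS.
apply: (@mcoeff_ordM _ _ 1 n) => // mu; rewrite ltnS leqn0 mdeg_eq0 => /eqP ->.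
exact: hl.
Qed.

(** The cut-off in [gen_series] depends on the coefficient being computed, which prevents induction
    on the list. Here [d] is fixed, and [gs_trunc_stable] shows that any large enough [d] gives the
    same coefficient. *)
Fixpoint gs_trunc (d : nat) (f : word R -> C) (s : seq (R * mpoly m C)) : mpoly m C :=
  if s is p :: s' then
    \sum_(n < d.+1) p.2 ^+ n * gs_trunc d (fun w => f ((e p.1, n.+1) :: w)) s'
  else f [::] *: 1.

Lemma gs_truncE d f s :
  \sum_(n : (size s).-tuple 'I_d.+1)
      f [seq (e p.1.1, p.2.+1) | p : (R * mpoly m C) * 'I_d.+1 <- zip s n] *:
      (\prod_(p <- zip s n) p.1.2 ^+ p.2) = gs_trunc d f s.
Proof.
elim: s f => [|a s IH] f /=.
  rewrite (big_pred1 [tuple]) /=; last by move=> t; apply/esym/eqP/tuple0.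
  by rewrite big_nil.
under [RHS]eq_bigr do rewrite -IH mulr_sumr.
rewrite pair_bigA /=.
rewrite (reindex (fun p : 'I_d.+1 * (size s).-tuple 'I_d.+1 => [tuple of p.1 :: p.2])) /=.
  by apply: eq_bigr => -[n t] _ /=; rewrite big_cons /= -scalerAr.
exists (fun t => (thead t, [tuple of behead t])) => [[n t]|t] _ /=.
  by rewrite theadE; congr (_, _); apply: val_inj.
by rewrite -tuple_eta.
Qed.

Lemma gen_seriesE f s nu :
  gen_series f s nu = mcoeff nu (gs_trunc (mdeg nu) f s).
Proof.
rewrite -gs_truncE /gen_series (raddf_sum (mcoeff nu)).
by apply: eq_bigr => t _; rewrite /= mcoeffZ.
Qed.

Definition nocsts (s : seq (R * mpoly m C)) : Prop :=
  forall a : R * mpoly m C, a \in s -> nocst a.2.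

Lemma nocsts_cons a s : nocsts (a :: s) -> nocst a.2 /\ nocsts s.
Proof.
move=> h; split; first by apply: h; rewrite mem_head.
by move=> p ps; apply: h; rewrite inE ps orbT.
Qed.

Lemma gs_trunc_stable d d' f s nu : nocsts s ->
  (mdeg nu <= d)%N -> (mdeg nu <= d')%N ->
  mcoeff nu (gs_trunc d f s) = mcoeff nu (gs_trunc d' f s).
Proof.
wlog dd : d d' / (d <= d')%N.
  move=> h hs h1 h2; have [dd|/ltnW dd] := leqP d d'; first exact: h.
  by apply/esym/h.
elim: s f nu => [//|a s IH] f nu /nocsts_cons[ha hs] hd hd' /=.
rewrite !(raddf_sum (mcoeff nu)) /= (big_ord_widen _ (fun n => mcoeff nu
   (a.2 ^+ n * gs_trunc d (fun w => f ((e a.1, n.+1) :: w)) s)) (_ : d.+1 <= d'.+1)%N) //.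
rewrite big_mkcond; apply: eq_bigr => n _; case: ltnP => hn.
  apply: eq_mcoeffM => // mu hmu; apply: IH => //; exact: leq_trans hmu _.
apply/esym; apply: (@mcoeff_ordM _ _ n 0) => //; last by rewrite addn0 (leq_ltn_trans hd).
by move=> mu; apply: mcoeff_exp_nocst.
Qed.

Definition gser (f : word R -> C) (s : seq (R * mpoly m C)) : pser := gen_series f s.

Lemma gser_nil f : gser f [::] = f [::] *: 1.
Proof. by apply: pserP => nu; rewrite /gser gen_seriesE /= mcoeffZ. Qed.

Lemma gser_cons f a s nu d : nocsts (a :: s) -> (mdeg nu <= d)%N ->
  gser f (a :: s) nu =
  \sum_(n < d.+1) (ps (a.2 ^+ n) * gser (fun w => f ((e a.1, n.+1) :: w)) s) nu.
Proof.
move=> has hd; have [ha hs] := nocsts_cons has.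
rewrite /gser gen_seriesE (gs_trunc_stable _ has (leqnn _) hd) /=.
rewrite (raddf_sum (mcoeff nu)); apply: eq_bigr => n _ /=.
rewrite mcoeffM pserME; apply: eq_bigr => k _; congr (_ * _).
rewrite gen_seriesE; apply: gs_trunc_stable => //.
by apply: leq_trans hd; rewrite -ltnS; apply: bmdeg.
Qed.

Lemma gser_sum (I : Type) (r : seq I) (c : I -> C) (f : I -> word R -> C) s :
  gser (fun w => \sum_(i <- r) c i * f i w) s = \sum_(i <- r) c i *: gser (f i) s.
Proof.
apply: pserP => nu; rewrite pser_sumE /gser /gen_series.
under [RHS]eq_bigr do rewrite pserZE big_distrr /=.
rewrite [RHS]exchange_big /=; apply: eq_bigr => n _.
by rewrite big_distrl /=; apply: eq_bigr => i _; rewrite mulrA.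
Qed.

(** The geometric expansion of [1 / (c - l)]. *)
Definition geo (c : C) l : pser := fun nu =>
  \sum_(n < (mdeg nu).+1) c^-1 ^+ n.+1 * mcoeff nu (l ^+ n).

Lemma geoM c l F nu d : nocst l -> (mdeg nu <= d)%N ->
  (geo c l * F) nu = \sum_(n < d.+1) c^-1 ^+ n.+1 * (ps (l ^+ n) * F) nu.
Proof.
move=> hl hd; rewrite pserME.
under [RHS]eq_bigr do rewrite pserME big_distrr /=.
rewrite exchange_big /=; apply: eq_bigr => k _.
rewrite /geo (big_ord_widen _ (fun n => c^-1 ^+ n.+1 * mcoeff k.1 (l ^+ n))
   (_ : (mdeg k.1).+1 <= d.+1)%N); last first.
  by apply: leq_trans (_ : mdeg nu < d.+1)%N; [apply: bmdeg|].
rewrite big_mkcond big_distrl /=; apply: eq_bigr => n _.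
rewrite mulrA; case: ltnP => // hn; rewrite /ps mcoeff_exp_nocst // mulr0 !mul0r //.
Qed.

Lemma geo_inv c l : c != 0 -> nocst l -> geo c l * (c *: 1 - ps l) = 1.
Proof.
move=> c0 hl; apply: pserP => nu; rewrite (geoM _ _ hl (leqnn _)).
rewrite (eq_bigr (fun n : 'I_(mdeg nu).+1 =>
   (c^-1 ^+ n * ps (l ^+ n) nu) - (c^-1 ^+ n.+1 * ps (l ^+ n.+1) nu))); last first.
  move=> n _; rewrite mulrBr pserBE -psM -exprSr -scalerAr mulr1 pserZE mulrBr.
  have E : c^-1 ^+ n.+1 * c = c^-1 ^+ n by rewrite exprSr -mulrA mulVf // mulr1.
  by rewrite mulrA E.
rewrite -(big_mkord xpredT (fun n => (c^-1 ^+ n * ps (l ^+ n) nu) -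
   (c^-1 ^+ n.+1 * ps (l ^+ n.+1) nu))).
rewrite -[LHS]opprK -sumrN; under eq_bigr do rewrite opprB.
rewrite telescope_sumr // opprB !expr0 mul1r [X in _ - X](_ : _ = 0) ?subr0 //.
by rewrite /ps mcoeff_exp_nocst // mulr0.
Qed.

Lemma geo_unit c l : c != 0 -> nocst l ->
  (c *: 1 - ps l \is a GRing.unit) /\ geo c l = (c *: 1 - ps l)^-1.
Proof.
move=> c0 hl; have h := geo_inv c0 hl.
have u : c *: 1 - ps l \is a GRing.unit.
  by apply/unitrP; exists (geo c l); split; [exact: h | rewrite mulrC; exact: h].
by split=> //; apply: (mulIr u); rewrite h mulVr.
Qed.

(** Summing over the exponents first turns the powers [l^(n-1) / den k ^ n] into [1 / (den k - l)].
    The generating series becomes a nested sum of fractions in the ring of series, where partial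
    fractions apply. *)
Lemma gser_trunc_sum den N j s : nocsts s ->
  gser (trunc_sum den N j) s =
  nest [seq (fun k => e p.1 ^+ k *: geo (den k) p.2) | p : R * mpoly m C <- s] N j.
Proof.
elim: s j => [|a s IH] j has; first by rewrite gser_nil /= scale1r.
have [ha hs] := nocsts_cons has.
apply: pserP => nu; rewrite (gser_cons _ has (leqnn _)) /= pser_sumE.
under [RHS]eq_bigr => k _.
  rewrite -scalerAl pserZE (geoM _ _ ha (leqnn _)) big_distrr /= -IH //.
  over.
rewrite [RHS]exchange_big /=; apply: eq_bigr => n _.
rewrite gser_sum mulr_sumr pser_sumE. apply: eq_bigr => k _.
by rewrite -scalerAr pserZE exprVn mulrA.
Qed.

End PowerSeries.

(** * Partial fractions and sums with a distinguished index *)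

Section NestSums.
Variable A : comNzRingType.
Implicit Types (F : nat -> A) (Fs : seq (nat -> A)).

(** Here [j] counts the summation indices not exceeding the cut [M]. *)
Lemma nest_split Fs N M l : (l <= M)%N -> (M <= N)%N ->
  nest Fs N l = \sum_(j < (size Fs).+1) nest (take j Fs) M l * nest (drop j Fs) N M.
Proof.
move=> + MN; elim: Fs l => [|F Fs IH] l lM; first by rewrite big_ord1 /= mulr1.
rewrite big_ord_recl /= mul1r (big_cat_nat (n := M.+1)) //= addrC; congr (_ + _).
under [RHS]eq_bigr do rewrite mulr_suml.
rewrite exchange_big /=; apply: eq_big_nat => k /andP[lk kM].
by rewrite IH // mulr_sumr; apply: eq_bigr => j _; rewrite mulrA.
Qed.

Lemma eq_nest (T : eqType) (s : seq T) (F G : T -> nat -> A) N l :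
  (forall p k, p \in s -> (l < k <= N)%N -> F p k = G p k) ->
  nest [seq F p | p <- s] N l = nest [seq G p | p <- s] N l.
Proof.
elim: s l => [//|p s IH] l h /=; apply: eq_big_nat => k /andP[lk kN].
rewrite h ?mem_head ?lk //; congr (_ * _); apply: IH => q k' qs /andP[kk' k'N].
by apply: h; rewrite ?inE ?qs ?orbT // k'N andbT (ltn_trans lk).
Qed.

Lemma nest_shift (T : Type) (s : seq T) (F : T -> nat -> A) N l c :
  nest [seq (fun k => F p (k + c)%N) | p <- s] N l =
  nest [seq F p | p <- s] (N + c) (l + c).
Proof.
elim: s l => [//|p s IH] l /=.
rewrite -addSn big_addn -addSn addnK; apply: eq_bigr => k _.
by rewrite IH.
Qed.

Lemma nest_shift_sub (T : Type) (s : seq T) (F : T -> nat -> A) N k : (k <= N)%N ->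
  nest [seq (fun k' => F p (k' - k)%N) | p <- s] N k = nest [seq F p | p <- s] (N - k) 0.
Proof.
move=> kN; have := nest_shift s (fun p k' => F p (k' - k)%N) (N - k) 0 k.
rewrite subnK // add0n => <-; congr (nest _ _ _); apply: eq_map => p.
by apply/funext => k' /=; rewrite addnK.
Qed.

Lemma sum_reflect (f : nat -> A) N l c : (N < c)%N ->
  \sum_(l.+1 <= k < N.+1) f k =
  \sum_((c.-1 - N).+1 <= k < (c.-1 - l).+1) f (c - k)%N.
Proof.
move=> Nc; have [Nl|/ltnW lN] := leqP N l.
  by rewrite !big_geq //; lia.
rewrite big_nat_rev /= (_ : (c.-1 - l).+1 = (N - l + (c.-1 - N).+1)%N); last by lia.
rewrite -[(c.-1 - N).+1 in X in _ = bigop.body _ X _]add0n big_addn addnK.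
rewrite -[l.+1 in X in bigop.body _ X _]add0n big_addn subSS.
by apply: eq_big_nat => k hk; congr f; lia.
Qed.

Lemma nest_rev (T : Type) (s : seq T) (F : T -> nat -> A) N l c : (N < c)%N ->
  nest [seq (fun k => F p (c - k)%N) | p <- rev s] N l =
  nest [seq F p | p <- s] (c.-1 - l) (c.-1 - N).
Proof.
elim: s N l => [//|p s IH] N l Nc.
rewrite rev_cons map_rcons nest_rcons /=.
rewrite (@sum_reflect _ _ _ c) //; apply: eq_big_nat => k /andP[k1 k2].
rewrite mulrC IH; last by lia.
have -> : (c - (c - k))%N = k by lia.
by congr (_ * nest _ _ _); lia.
Qed.

Lemma nest_cat_cons Fs1 F Fs2 N l :
  nest (Fs1 ++ F :: Fs2) N l =
  \sum_(l.+1 <= k < N.+1) nest Fs1 k.-1 l * F k * nest Fs2 N k.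
Proof.
elim: Fs1 l => [|G Fs1 IH] l /=; first by apply: eq_bigr => k _; rewrite mul1r.
under eq_bigr do rewrite IH big_distrr /=.
rewrite exchange_triangle; apply: eq_big_nat => -[//|k] /= _.
by rewrite !big_distrl /=; apply: eq_bigr => j _; rewrite !mulrA.
Qed.

Definition delta_at (k : nat) : nat -> A := fun k' => (k' == k)%:R.

Lemma nest_delta Fs1 Fs2 N l k : (l < k <= N)%N ->
  nest (Fs1 ++ delta_at k :: Fs2) N l = nest Fs1 k.-1 l * nest Fs2 N k.
Proof.
move=> /andP[lk kN]; rewrite nest_cat_cons.
rewrite (bigD1_seq k) /= ?mem_index_iota ?iota_uniq ?lk //.
rewrite /delta_at eqxx mulr1 big1 ?addr0 // => j /negbTE ->.
by rewrite mulr0 mul0r.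
Qed.

(** Partial fractions produce factors that depend on two indices, so the summand is no longer a
    product over single indices as in [nest]. *)
Fixpoint sum_incr (n : nat) (g : seq nat -> A) (N l : nat) : A :=
  if n is n'.+1 then \sum_(l.+1 <= k < N.+1) sum_incr n' (fun t => g (k :: t)) N k
  else g [::].

Lemma eq_sum_incr n g g' N l :
  (forall t, size t = n -> path ltn l t -> all (leq^~ N) t -> g t = g' t) ->
  sum_incr n g N l = sum_incr n g' N l.
Proof.
elim: n g g' l => [|n IH] g g' l h /=; first exact: h.
apply: eq_big_nat => k /andP[lk kN]; apply: IH => t st pt at'.
by apply: h => /=; rewrite ?st ?lk ?pt //= at' andbT -ltnS.
Qed.

Lemma sum_incr_sum (I : Type) (r : seq I) n (g : I -> seq nat -> A) N l :
  sum_incr n (fun t => \sum_(i <- r) g i t) N l = \sum_(i <- r) sum_incr n (g i) N l.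
Proof.
elim: n g l => [//|n IH] g l /=; rewrite exchange_big /=.
by apply: eq_bigr => k _; rewrite IH.
Qed.

Lemma sum_incrZ n c (g : seq nat -> A) N l :
  sum_incr n (fun t => c * g t) N l = c * sum_incr n g N l.
Proof.
elim: n g l => [//|n IH] g l /=; rewrite big_distrr /=.
by apply: eq_bigr => k _; rewrite IH.
Qed.

Lemma sum_incr0 n N l : sum_incr n (fun=> 0) N l = 0.
Proof. by elim: n l => [//|n IH] l /=; rewrite big1. Qed.

Lemma nest_sum_incr n (F : nat -> nat -> A) i0 N l :
  nest [seq F i | i <- iota i0 n] N l =
  sum_incr n (fun t => \prod_(i < n) F (i0 + i)%N (nth 0%N t i)) N l.
Proof.
elim: n i0 l => [|n IH] i0 l /=; first by rewrite big_ord0.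
apply: eq_bigr => k _; rewrite IH -sum_incrZ; apply: eq_sum_incr => t _ _ _.
rewrite big_ord_recl /= addn0; congr (_ * _).
by apply: eq_bigr => i _; rewrite /bump /= addnCA addnA.
Qed.

Lemma sum_incr_marker n j (X : nat -> A) (Y : nat -> nat -> nat -> A) N l : (j < n)%N ->
  sum_incr n (fun t => X (nth 0%N t j) *
     \prod_(i < n | i != j :> nat) Y i (nth 0%N t i) (nth 0%N t j)) N l =
  \sum_(l.+1 <= k < N.+1) X k *
    (nest [seq Y i ^~ k | i <- iota 0 j] k.-1 l *
     nest [seq Y i ^~ k | i <- iota j.+1 (n - j.+1)] N k).
Proof.
move=> jn.
(* Placing [delta_at k] at position [j] fixes the distinguished index to [k]; every other factor
   then depends on one index only, which leads back to [nest]. *)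
pose F k i := if i == j then delta_at k else Y i ^~ k.
transitivity (sum_incr n (fun t => \sum_(l.+1 <= k < N.+1)
    X k * \prod_(i < n) F k i (nth 0%N t i)) N l).
  apply: eq_sum_incr => t st pt at'.
  have tj : nth 0%N t j \in t by rewrite mem_nth // st.
  have tjl : (l < nth 0%N t j)%N.
    by move: pt => /(order_path_min ltn_trans) /allP /(_ _ tj).
  have tjN : (nth 0%N t j < N.+1)%N by move: at' => /allP /(_ _ tj).
  rewrite (bigD1_seq (nth 0%N t j)) /= ?mem_index_iota ?iota_uniq ?tjl //.
  rewrite [X in _ = _ + X]big1 ?addr0.
    rewrite [in RHS](bigD1 (Ordinal jn)) //= /F (eqxx j) /delta_at /= eqxx mul1r.
    congr (_ * _); apply: eq_big => [i|i ij]; first by rewrite -val_eqE.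
    by rewrite (negbTE ij).
  move=> k /negbTE kj; rewrite (bigD1 (Ordinal jn)) //= /F (eqxx j) /delta_at /= eq_sym kj.
  by rewrite mul0r mulr0.
rewrite sum_incr_sum; apply: eq_big_nat => k hk; rewrite sum_incrZ; congr (_ * _).
have -> : sum_incr n (fun t => \prod_(i < n) F k i (nth 0%N t i)) N l =
    nest [seq F k i | i <- iota 0 n] N l by rewrite nest_sum_incr.
have -> : iota 0 n = iota 0 j ++ j :: iota j.+1 (n - j.+1).
  by rewrite -{1}(subnKC (ltnW jn)) iotaD add0n -(subnSK jn).
rewrite map_cat /= {2}/F eqxx -nest_delta //; congr (nest (_ ++ _ :: _) _ _).
  by apply/eq_in_map => i; rewrite mem_iota /F => hi; case: eqP => // ?; lia.
by apply/eq_in_map => i; rewrite mem_iota /F => hi; case: eqP => // ?; lia.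
Qed.

End NestSums.

Section PartialFractions.
Variable A : comUnitRingType.

Lemma inv_sub_mul (a b : A) : a \is a GRing.unit -> b \is a GRing.unit ->
  b - a \is a GRing.unit -> a^-1 * b^-1 = (a^-1 - b^-1) * (b - a)^-1.
Proof.
move=> ua ub uab; apply: (mulIr uab); rewrite mulrVK // mulrBr mulrVK //.
by rewrite mulrAC mulVr // mul1r.
Qed.

Definition separated (X : nat -> A) n : Prop :=
  forall i j, (i < n)%N -> (j < n)%N -> i != j -> X i - X j \is a GRing.unit.

Lemma partial_fractions n (X : nat -> A) :
  separated X n.+1 -> (forall i, (i < n.+1)%N -> X i \is a GRing.unit) ->
  \prod_(i < n.+1) (X i)^-1 =
  \sum_(j < n.+1) (X j)^-1 * \prod_(i < n.+1 | i != j :> nat) (X i - X j)^-1.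
Proof.
elim: n X => [|n IH] X sX uX.
  by rewrite !big_ord1 big_pred0 ?mulr1 // => i; rewrite ord1.
have sX' : separated X n.+1 by move=> i j hi hj; apply: sX; rewrite ltnS ltnW.
have uX' i : (i < n.+1)%N -> X i \is a GRing.unit by move=> hi; apply: uX; rewrite ltnS ltnW.
have E (c : A) (j : 'I_n.+1) : c * \prod_(i < n.+2 | i != j :> nat) (X i - X j)^-1 =
    c * (X n.+1 - X j)^-1 * \prod_(i < n.+1 | i != j :> nat) (X i - X j)^-1.
  rewrite -mulrA; congr (c * _).
  rewrite big_mkcond big_ord_recr /= -big_mkcond /= mulrC.
  by rewrite (gtn_eqF (ltn_ord j)).
(* The induction hypothesis at the differences [X i - X n.+1] supplies the term of the last pole;
   [inv_sub_mul] then treats the other poles one by one. *)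
have h2 : \prod_(i < n.+1) (X i - X n.+1)^-1 =
    - \sum_(j < n.+1) (X n.+1 - X j)^-1 * \prod_(i < n.+1 | i != j :> nat) (X i - X j)^-1.
  rewrite (IH (fun i => X i - X n.+1)).
  - rewrite -sumrN; apply: eq_bigr => j _; rewrite -mulNr -invrN; congr (_ * _).
      by rewrite opprB.
    by apply: eq_bigr => i _; congr (_^-1); rewrite opprB addrA subrK.
  - by move=> i j hi hj ij; rewrite opprB addrA subrK; apply: sX'.
  - by move=> i hi; apply: sX; [lia | lia | rewrite ltn_eqF].
rewrite big_ord_recr /= IH // mulr_suml [RHS]big_ord_recr /=.
have -> : \prod_(i < n.+2 | i != n.+1 :> nat) (X i - X n.+1)^-1 =
    \prod_(i < n.+1) (X i - X n.+1)^-1.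
  rewrite big_mkcond big_ord_recr /= eqxx mulr1.
  by apply: eq_bigr => i _; rewrite ltn_eqF.
rewrite h2 mulrN mulr_sumr -sumrB; apply: eq_bigr => j _.
have u : X n.+1 - X j \is a GRing.unit.
  by apply: sX; [lia | have := ltn_ord j; lia | rewrite gtn_eqF].
rewrite E mulrAC (inv_sub_mul (uX' j (ltn_ord j)) (uX n.+1 (ltnSn _)) u).
by rewrite !mulrA -mulrBl -mulrBl.
Qed.

(** Partial fractions at the points [X i - X n.+1] express the last summand as minus the sum of the
    others. *)
Lemma partial_fractions0 n (X : nat -> A) : separated X n.+2 ->
  \sum_(j < n.+2) \prod_(i < n.+2 | i != j :> nat) (X i - X j)^-1 = 0.
Proof.
move=> sX; rewrite big_ord_recr /=.
have -> : \prod_(i < n.+2 | i != n.+1 :> nat) (X i - X n.+1)^-1 =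
    \prod_(i < n.+1) (X i - X n.+1)^-1.
  rewrite big_mkcond big_ord_recr /= eqxx mulr1.
  by apply: eq_bigr => i _; rewrite ltn_eqF.
rewrite (@partial_fractions n (fun i => X i - X n.+1)); last first.
- by move=> i hi; apply: sX; [lia | lia | rewrite ltn_eqF].
- by move=> i j hi hj ij; rewrite opprB addrA subrK; apply: sX => //; lia.
rewrite -big_split big1 //= => j _.
rewrite big_mkcond big_ord_recr /= -big_mkcond /= (gtn_eqF (ltn_ord j)) /=.
rewrite [X in X + _]mulrC -[X n.+1 - X j]opprB invrN mulNr; apply/eqP.
rewrite addrC subr_eq0; apply/eqP; congr (_ * _); apply: eq_bigr => i _.
by congr (_^-1); rewrite opprB addrA subrK.
Qed.

End PartialFractions.

(** * Asymptotics of the truncated generating series *)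

Section Exponential.
Variable R : realType.
Implicit Types (x y : R).

Lemma e_cos_sin x : e x = (cos (2 * pi * x) +i* sin (2 * pi * x))%C.
Proof.
rewrite /e /cexp; set z := (_ * _).
have -> : z = (0 +i* (2 * pi * x))%C.
  apply/eqP; rewrite /z eq_complex /=; apply/andP; split; apply/eqP; ring.
by rewrite expR0 mul1r.
Qed.

Lemma eD x y : e (x + y) = e x * e y.
Proof.
rewrite !e_cos_sin mulrDr cosD sinD.
by apply/eqP; rewrite eq_complex /= [X in _ && (_ == X)]addrC !eqxx.
Qed.

Lemma e0 : e (0 : R) = 1.
Proof. by rewrite e_cos_sin mulr0 cos0 sin0. Qed.

Lemma e_neq0 x : e x != 0.
Proof.
apply/eqP => h; have := eD x (- x); rewrite subrr e0 h mul0r => /eqP.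
by rewrite oner_eq0.
Qed.

Lemma eN x : e (- x) = (e x)^-1.
Proof. by apply: (mulfI (e_neq0 x)); rewrite -eD subrr e0 divff // e_neq0. Qed.

Lemma normr_e x : `|e x| = 1.
Proof. by rewrite e_cos_sin normc_def /= cos2Dsin2 sqrtr1. Qed.

Lemma eX x n : e x ^+ n = e (x * n%:R).
Proof.
elim: n => [|n IH]; first by rewrite mulr0 e0 expr0.
by rewrite exprS IH -eD -natr1 mulrDr mulr1 addrC.
Qed.

Lemma e_sum (I : Type) (r : seq I) (P : pred I) (f : I -> R) :
  e (\sum_(i <- r | P i) f i) = \prod_(i <- r | P i) e (f i).
Proof. exact: (big_morph (@e R) eD e0). Qed.

Lemma e_int x : x \is a Num.int -> e x = 1.
Proof.
have e1 : e (1 : R) = 1 by rewrite e_cos_sin mulr1 mulr_natl cos2pi sin2pi.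
move=> /intrP[n ->]; case: n => n.
  by rewrite -[n%:~R]mul1r -eX e1 expr1n.
by rewrite NegzE mulrNz eN -[_.+1%:~R]mul1r -eX e1 expr1n invr1.
Qed.

Lemma e_eq1 x : (e x == 1) = (x \is a Num.int).
Proof.
apply/eqP/idP => [|/e_int //].
(* Only the fractional part [y] matters; if [0 < y < 1], then [cos (2 pi y) = 1 - 2 sin^2 (pi y)] is
   less than 1. *)
have hx : x = (Num.floor x)%:~R + (x - (Num.floor x)%:~R) by rewrite addrC subrK.
set y := x - _ in hx; rewrite hx eD e_int ?intr_int // mul1r e_cos_sin.
have y0 : 0 <= y by rewrite subr_ge0 floor_le.
have y1 : y < 1 by rewrite ltrBlDl; have := floorD1_gt x; rewrite intrD.
clearbody y; move=> /eqP; rewrite eq_complex => /andP[/eqP /= h _].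
have [->|yn0] := eqVneq y 0; first by rewrite addr0 intr_int.
have yp : 0 < y by rewrite lt_neqAle eq_sym yn0.
have : 0 < sin (pi * y).
  apply: sin_gt0_pi; rewrite mulr_gt0 ?pi_gt0 //=.
  by rewrite -[X in _ < X]mulr1 ltr_pM2l ?pi_gt0.
have : cos (2 * pi * y) = 1 - 2 * sin (pi * y) ^+ 2.
  rewrite -mulrA mulr_natl cos_mulr2n cos2sin2; ring.
rewrite h => hh s0.
have : sin (pi * y) ^+ 2 = 0 by lra.
by move/eqP; rewrite sqrf_eq0 (gt_eqF s0).
Qed.

End Exponential.

Section SeriesAsymptotics.
Variables (R : realType) (m : nat).
Notation C := R[i].
Notation x := (letter11 R).
Implicit Types (s : seq (R * mpoly m C)) (a : R * mpoly m C) (nu : multinom m).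

Lemma valid_gser_word s d (n : (size s).-tuple 'I_d.+1) :
  valid_word [seq (e p.1.1, p.2.+1) | p : (R * mpoly m C) * 'I_d.+1 <- zip s n].
Proof.
apply/allP => _ /mapP[p _ ->]; by rewrite /valid_letter /= normr_e eqxx.
Qed.

Lemma eq_gser (f g : word R -> C) s :
  (forall w, valid_word w -> f w = g w) -> gser f s = gser g s :> pser R m.
Proof.
move=> h; apply: pserP => nu; rewrite /gser /gen_series; apply: eq_bigr => n _.
by rewrite h // valid_gser_word.
Qed.

(* This is how [d/dT] acts on generating series: a final letter [1,1] is removed,
   so only the coefficients with n_m = 1 survive, and only if [e phi_m = 1]. *)
Lemma gser_rcons_strip (f f' : word R -> C) s a : nocsts (rcons s a) ->
  (forall u b, valid_word u -> valid_letter b ->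
     f' (rcons u b) = if b == x then f u else 0) ->
  gser f' (rcons s a) = if a.1 \is a Num.int then gser f s else 0 :> pser R m.
Proof.
elim: s f f' => [|p s IH] f f' hs h.
  apply: pserP => nu; rewrite (gser_cons _ hs (leqnn _)) big_ord_recl big1 /=.
    rewrite addr0 expr0 ps1 mul1r gser_nil.
    rewrite (h [::] (e a.1, 1%N)) //; last by rewrite /valid_letter /= normr_e eqxx.
    rewrite xpair_eqE /= eqxx andbT e_eq1; case: ifP => _; first by rewrite gser_nil.
    by rewrite scale0r.
  move=> n _; rewrite gser_nil (h [::]) //; last by rewrite /valid_letter /= normr_e eqxx.
  by rewrite xpair_eqE /= andbF scale0r mulr0.
have [hp hs'] := nocsts_cons hs.
apply: pserP => nu; rewrite rcons_cons (gser_cons _ hs (leqnn _)) /=.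
have hsp : nocsts (p :: s).
  by move=> b bs; apply: hs; rewrite mem_rcons inE bs orbT.
transitivity (\sum_(n < (mdeg nu).+1) (ps (p.2 ^+ n) *
   (if a.1 \is a Num.int then gser (fun w => f ((e p.1, n.+1) :: w)) s else 0)) nu).
  apply: eq_bigr => n _; congr ((_ * _ : pser R m) nu); apply: IH => // u b hu hb.
  rewrite -rcons_cons h //.
  by apply/andP; split=> //; rewrite /valid_letter /= normr_e eqxx.
case: ifP => _; first by rewrite (gser_cons _ hsp (leqnn _)).
by rewrite big1 // => n _; rewrite mulr0.
Qed.

(** A polynomial function with its derivative, both kept as functions, so that coefficients of
    series can be differentiated in [T] without naming polynomials. *)
Definition polyder (g g' : C -> C) : Prop :=
  exists p : {poly C}, forall T, g T = p.[T] /\ g' T = p^`().[T].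

Lemma polyder_cst c : polyder (fun=> c) (fun=> 0).
Proof. by exists c%:P => T; rewrite derivC !hornerC. Qed.

Lemma polyderD g g' k k' : polyder g g' -> polyder k k' ->
  polyder (fun T => g T + k T) (fun T => g' T + k' T).
Proof.
move=> [p hp] [q hq]; exists (p + q) => T.
by rewrite derivD !hornerD (hp T).1 (hp T).2 (hq T).1 (hq T).2.
Qed.

Lemma polyderZ c g g' : polyder g g' ->
  polyder (fun T => c * g T) (fun T => c * g' T).
Proof.
move=> [p hp]; exists (c *: p) => T.
by rewrite derivZ !hornerZ (hp T).1 (hp T).2.
Qed.

Lemma polyder_sum (I : Type) (r : seq I) (P : pred I) (g g' : I -> C -> C) :
  (forall i, P i -> polyder (g i) (g' i)) ->
  polyder (fun T => \sum_(i <- r | P i) g i T) (fun T => \sum_(i <- r | P i) g' i T).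
Proof.
move=> h; elim: r => [|i r [p hp]].
  by have [p hp] := polyder_cst 0; exists p => T; rewrite !big_nil.
have [Pi|/negbTE nPi] := boolP (P i).
  have [q hq] := h i Pi; exists (q + p) => T.
  by rewrite !big_cons Pi derivD !hornerD (hp T).1 (hp T).2 (hq T).1 (hq T).2.
by exists p => T; rewrite !big_cons nPi.
Qed.

Lemma polyder_ext g1 g2 g1' g2' : g1 =1 g2 -> g1' =1 g2' ->
  polyder g1 g1' -> polyder g2 g2'.
Proof. by move=> h h' [p hp]; exists p => T; rewrite -h -h'. Qed.

Lemma polyder0_cst g : polyder g (fun=> 0) -> forall T U, g T = g U.
Proof.
move=> [p hp] T U.
have p' : p^`() = 0.
  apply: (@roots_geq_poly_eq0 _ _ [seq k%:R | k <- iota 0 (size p^`())]).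
  - by apply/allP => _ /mapP[k _ ->]; rewrite /root -(hp k%:R).2.
  - by rewrite map_inj_uniq ?iota_uniq // => i j /eqP; rewrite eqr_nat => /eqP.
  - by rewrite size_map size_iota.
rewrite (hp T).1 (hp U).1.
suff -> : p = (p`_0)%:P by rewrite !hornerC.
apply/polyP => -[|i]; rewrite coefC //=.
have := congr1 (fun q : {poly C} => q`_i) p'; rewrite coef_deriv coef0 => /eqP.
by rewrite mulrn_eq0 => /orP[//|/eqP].
Qed.

Variable den : nat -> C.
Hypothesis gden : good_den den.

Notation h n := (trunc_sum den n 0 [:: x]).

Definition Tser (n : nat) s : pser R m := gser (trunc_sum den n 0) s.
(** At [T = c] this is the generating series regularized at [c]. The argument is free because it is
    also differentiated in and evaluated at partial sums. *)
Definition Aser (T : C) s : pser R m := gser (fun w => (asymp_poly den w).[T]) s.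

Lemma Tser_bnd s nu : bnd 0 (fun n => Tser n s nu) /\
  bnd 1 (fun n => Tser n.+1 s nu - Tser n s nu).
Proof.
split.
  apply: bnd_sum => t _.
  apply: (@bnd_ext _ _ (fun n => mcoeff nu (\prod_(p <- zip s t) p.1.2 ^+ p.2) *
    trunc_sum den n 0 [seq (e p.1.1, p.2.+1) | p : (R * mpoly m C) * 'I_(mdeg nu).+1
       <- zip s t])).
    by move=> n; rewrite mulrC.
  apply: bndZ; exact: (trunc_bnd gden (valid_gser_word t)).1.
apply: (@bnd_ext _ _ (fun n => \sum_(t : (size s).-tuple 'I_(mdeg nu).+1)
    mcoeff nu (\prod_(p <- zip s t) p.1.2 ^+ p.2) *
    (trunc_sum den n.+1 0 [seq (e p.1.1, p.2.+1) | p : (R * mpoly m C) * 'I_(mdeg nu).+1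
       <- zip s t] - trunc_sum den n 0 [seq (e p.1.1, p.2.+1) | p :
         (R * mpoly m C) * 'I_(mdeg nu).+1 <- zip s t]))).
  move=> n; rewrite /Tser /gser /gen_series -sumrB; apply: eq_bigr => t _; ring.
apply: bnd_sum => t _; apply: bndZ; exact: (trunc_bnd gden (valid_gser_word t)).2.
Qed.

Lemma Tser_asymp s nu : bnd 1 (fun n => Tser n s nu - Aser (h n) s nu).
Proof.
apply: (@bnd_ext _ _ (fun n => \sum_(t : (size s).-tuple 'I_(mdeg nu).+1)
    mcoeff nu (\prod_(p <- zip s t) p.1.2 ^+ p.2) *
    (trunc_sum den n 0 [seq (e p.1.1, p.2.+1) | p : (R * mpoly m C) * 'I_(mdeg nu).+1
       <- zip s t] - (asymp_poly den [seq (e p.1.1, p.2.+1) | p :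
         (R * mpoly m C) * 'I_(mdeg nu).+1 <- zip s t]).[h n]))).
  move=> n; rewrite /Tser /Aser /gser /gen_series -sumrB; apply: eq_bigr => t _; ring.
apply: bnd_sum => t _; apply: bndZ; exact: (asymp_polyP gden (valid_gser_word t)).
Qed.

Lemma Aser_bnd s nu : bnd 0 (fun n => Aser (h n) s nu).
Proof.
apply: (@bnd_ext _ _ (fun n => Tser n s nu - (Tser n s nu - Aser (h n) s nu))).
  by move=> n; rewrite opprB addrC subrK.
by apply: bndB; [exact: (Tser_bnd s nu).1 | apply: bndW (Tser_asymp s nu)].
Qed.

Lemma Aser_nil T : Aser T [::] = 1.
Proof. by rewrite /Aser gser_nil asymp_poly_nil // hornerC scale1r. Qed.

Lemma Aser_polyder s a nu : nocsts (rcons s a) ->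
  polyder (fun T => Aser T (rcons s a) nu)
    (fun T => if a.1 \is a Num.int then Aser T s nu else 0).
Proof.
move=> hs.
apply: (@polyder_ext (fun T => Aser T (rcons s a) nu) _
   (fun T => (gser (fun w => ((asymp_poly den w)^`()).[T]) (rcons s a) : pser R m) nu)) => //.
  move=> T; rewrite (@gser_rcons_strip (fun w => (asymp_poly den w).[T])) //.
    by case: ifP.
  move=> u b hu hb; rewrite deriv_asymp_poly //; case: ifP => // _.
  by rewrite hornerC.
exists (\sum_(t : (size (rcons s a)).-tuple 'I_(mdeg nu).+1)
  mcoeff nu (\prod_(p <- zip (rcons s a) t) p.1.2 ^+ p.2) *:
  asymp_poly den [seq (e p.1.1, p.2.+1) | p :
         (R * mpoly m C) * 'I_(mdeg nu).+1 <- zip (rcons s a) t]) => T.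
rewrite raddf_sum !horner_sum; split; apply: eq_bigr => t _.
  by rewrite hornerZ mulrC.
by rewrite /= derivZ hornerZ mulrC.
Qed.

End SeriesAsymptotics.

Section Denominators.
Variable R : realType.
Notation C := R[i].
Notation x := (letter11 R).

Lemma normcR (r : R) : normc (r%:C)%C = `|r|.
Proof. by rewrite /= expr0n addr0 sqrtr_sqr. Qed.

Lemma normc_nat n : normc (n%:R : C) = n%:R.
Proof. by rewrite -(rmorph_nat (real_complex R)) normcR ger0_norm ?ler0n. Qed.

Lemma bndR d (a : nat -> R) (b : nat -> C) K :
  (forall n, b n = (a n)%:C%C) -> (forall n, `|a n| <= K / n.+1%:R ^+ d) -> bnd d b.
Proof. by move=> h h'; exists K, 0%N => n; rewrite h normcR expr0 mulr1 h'. Qed.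

Lemma trunc_zeta_x n : trunc_sum (@den_zeta R) n 0 [:: x] = (Lg R n - 1)%:C%C.
Proof.
rewrite /= /Lg addrAC subrr add0r rmorph_sum big_add1 /= big_mkord.
apply: eq_bigr => k _; rewrite expr1n expr1 mul1r mulr1 /den_zeta.
by rewrite fmorphV rmorph_nat.
Qed.

Lemma den_tS k : den_t R k.+1 = ((2 * k.+1%:R - 1)%:C)%C.
Proof. by rewrite rmorphB rmorphM !rmorph_nat rmorph1. Qed.

Lemma trunc_t_x n : trunc_sum (@den_t R) n 0 [:: x] =
  (\sum_(k < n) (2 * k.+1%:R - 1)^-1)%:C%C.
Proof.
rewrite /= rmorph_sum big_add1 /= big_mkord.
apply: eq_bigr => k _; rewrite expr1n expr1 mul1r mulr1 den_tS.
by rewrite fmorphV.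
Qed.

Lemma good_den_zeta : good_den (@den_zeta R).
Proof.
split.
- apply: (@bndR _ (fun k => k.+1%:R^-1) _ 1) => n.
    by rewrite fmorphV rmorph_nat.
  by rewrite mul1r expr1 ger0_norm ?invr_ge0 ?ler0n.
- apply: (@bndR _ (fun k => k.+2%:R^-1 - k.+1%:R^-1) _ 1) => n.
    by rewrite rmorphB !fmorphV !rmorph_nat.
  have p1 : 0 < n.+1%:R :> R by rewrite ltr0n.
  have -> : n.+2%:R = n.+1%:R + 1 :> R by rewrite natr1.
  move: (n.+1%:R) p1 => y y0.
  have y1 : 0 < y + 1 by lra.
  have -> : (y + 1)^-1 - y^-1 = - (y * (y + 1))^-1.
    by field; rewrite !gt_eqF.
  have h : 0 <= (y * (y + 1))^-1 by rewrite invr_ge0 mulr_ge0 // ltW.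
  rewrite normrN ger0_norm // mul1r.
  rewrite lef_pV2 ?posrE ?exprn_gt0 ?mulr_gt0 // expr2 ler_pM2l //; lra.
- move=> A; have [N hN] := Lg_unbounded (A + 1); exists N => n Nn.
  rewrite trunc_zeta_x normcR (le_trans _ (ler_norm _)) //.
  by have := hN n Nn; lra.
Qed.

Lemma two_kS_sub1 (k : nat) : 2 * k.+1%:R - 1 = 2 * k%:R + 1 :> R.
Proof. by rewrite -[k.+1%:R]natr1; ring. Qed.

Lemma good_den_t : good_den (@den_t R).
Proof.
split.
- apply: (@bndR _ (fun k => (2 * k.+1%:R - 1)^-1) _ 1) => n.
    by rewrite den_tS fmorphV.
  rewrite mul1r expr1 two_kS_sub1; have n0 : 0 <= n%:R :> R by rewrite ler0n.
  rewrite ger0_norm ?invr_ge0; last by lra.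
  rewrite -[n.+1%:R]natr1 lef_pV2 ?posrE; lra.
- apply: (@bndR _ (fun k => (2 * k.+2%:R - 1)^-1 - (2 * k.+1%:R - 1)^-1) _ 2) => n.
    by rewrite rmorphB /= !den_tS !fmorphV.
  rewrite !two_kS_sub1 -[n.+1%:R]natr1; have n0 : 0 <= n%:R :> R by rewrite ler0n.
  move: (n%:R) n0 => y y0.
  have -> : 2 * (y + 1) + 1 = (2 * y + 1) + 2 by ring.
  have hu : y + 1 <= 2 * y + 1 by lra.
  move: (2 * y + 1) hu => u hu.
  have u0 : 0 < u by lra.
  have u2 : 0 < u + 2 by lra.
  have -> : (u + 2)^-1 - u^-1 = - (2 / (u * (u + 2))).
    by field; rewrite !gt_eqF.
  have h : 0 <= 2 / (u * (u + 2)) by rewrite divr_ge0 // mulr_ge0 // ltW.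
  rewrite normrN ger0_norm // ler_pM2l // lef_pV2 ?posrE ?exprn_gt0 ?mulr_gt0 //.
    by rewrite expr2; apply: ler_pM; lra.
  by lra.
- move=> A; have [N hN] := Lg_unbounded (2 * A + 1); exists N => n Nn.
  rewrite trunc_t_x normcR (le_trans _ (ler_norm _)) //.
  have : (Lg R n - 1) / 2 <= \sum_(k < n) (2 * k.+1%:R - 1)^-1.
    rewrite /Lg addrAC subrr add0r mulr_suml; apply: ler_sum => k _.
    have k0 : 0 <= (k : nat)%:R :> R by rewrite ler0n.
    rewrite two_kS_sub1 -invfM -[k.+1%:R]natr1; move: ((k : nat)%:R) k0 => u u0.
    by rewrite lef_pV2 ?posrE; lra.
  by have := hN n Nn; lra.
Qed.

End Denominators.

(** * Estimates in two truncation parameters *)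

Section DoubleBounds.
Variable R : realType.
Notation C := R[i].
Implicit Types (X Y : nat -> nat -> C).

(** Such a bound is small only when [p] and [q] are both large, but its mean over the line
    [p + q = n] always tends to 0. *)
Definition bnd2 X : Prop := exists K : R, 0 <= K /\ exists r : nat,
  forall p q, normc (X p q) <= K * Lg R (p + q) ^+ r * (p.+1%:R^-1 + q.+1%:R^-1).

Lemma bnd2_ext X Y : (forall p q, X p q = Y p q) -> bnd2 X -> bnd2 Y.
Proof. by move=> h [K [K0 [r hr]]]; exists K; split=> //; exists r => p q; rewrite -h. Qed.

Lemma inv_sum_ge0 (p q : nat) : 0 <= (p.+1%:R^-1 + q.+1%:R^-1 : R).
Proof. by rewrite addr_ge0 ?invr_ge0 ?ler0n. Qed.

Lemma bnd2D X Y : bnd2 X -> bnd2 Y -> bnd2 (fun p q => X p q + Y p q).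
Proof.
move=> [K [K0 [r h]]] [K' [K0' [r' h']]].
exists (K + K'); split; first exact: addr_ge0.
exists (r + r')%N => p q; apply: le_trans (le_normcD _ _) _.
rewrite !mulrDl; apply: lerD.
  by apply: le_trans (h p q) _; rewrite ler_wpM2r ?inv_sum_ge0 // ler_wpM2l // LgX_homo ?leq_addr.
by apply: le_trans (h' p q) _; rewrite ler_wpM2r ?inv_sum_ge0 // ler_wpM2l // LgX_homo ?leq_addl.
Qed.

Lemma bnd2_0 : bnd2 (fun _ _ => 0).
Proof.
exists 0; split=> //; exists 0%N => p q; by rewrite normc0 !mul0r.
Qed.

Lemma bnd2Z c X : bnd2 X -> bnd2 (fun p q => c * X p q).
Proof.
move=> [K [K0 [r h]]]; exists (normc c * K); split; first by rewrite mulr_ge0 ?normc_ge0.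
exists r => p q; rewrite normcM -!mulrA ler_wpM2l ?normc_ge0 // mulrA; exact: h.
Qed.

Lemma bnd2_sum (I : Type) (r : seq I) (P : pred I) (F : I -> nat -> nat -> C) :
  (forall i, P i -> bnd2 (F i)) -> bnd2 (fun p q => \sum_(i <- r | P i) F i p q).
Proof.
move=> h; elim: r => [|i r IH].
  by apply: bnd2_ext bnd2_0 => p q; rewrite big_nil.
have [Pi|/negbTE nPi] := boolP (P i).
  by apply: bnd2_ext (bnd2D (h i Pi) IH) => p q; rewrite big_cons Pi.
by apply: bnd2_ext IH => p q; rewrite big_cons nPi.
Qed.

Lemma bnd2_swap X : bnd2 X -> bnd2 (fun p q => X q p).
Proof.
move=> [K [K0 [r h]]]; exists K; split=> //; exists r => p q.
by rewrite addnC [_^-1 + _]addrC.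
Qed.

Lemma bnd2_prod (a b : nat -> C) : bnd 1 a -> bnd 0 b -> bnd2 (fun p q => a p * b q).
Proof.
move=> /bnd_pos[K [K0 [r h]]] /bnd_pos[K' [K0' [r' h']]].
exists (K * K'); split; first exact: mulr_ge0.
exists (r + r')%N => p q; rewrite normcM exprD.
apply: (@le_trans _ _ ((K * Lg R (p + q) ^+ r * p.+1%:R^-1) * (K' * Lg R (p + q) ^+ r'))).
  apply: ler_pM; rewrite ?normc_ge0 //.
    apply: le_trans (h p r (leqnn _)) _; rewrite expr1 ler_wpM2r ?invr_ge0 ?ler0n //.
    by rewrite ler_wpM2l // LgXl_homo // leq_addr.
  apply: le_trans (h' q r' (leqnn _)) _; rewrite expr0 divr1.
  by rewrite ler_wpM2l // LgXl_homo // leq_addl.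
have -> : K * Lg R (p + q) ^+ r / p.+1%:R * (K' * Lg R (p + q) ^+ r') =
  K * K' * (Lg R (p + q) ^+ r * Lg R (p + q) ^+ r') * p.+1%:R^-1 by ring.
apply: ler_wpM2l; first by rewrite !mulr_ge0 // LgX_ge0.
by rewrite lerDl invr_ge0 ler0n.
Qed.

(** The mean of [1/(p+1) + 1/(q+1)] over [p + q = n] is [O(log n / n)], so a constant [g] that
    approximates [X] inherits its zero means. *)
Lemma bnd2_mean X g : bnd2 (fun p q => X p q - g) ->
  (forall n, \sum_(p < n.+1) X p (n - p)%N = 0) -> g = 0.
Proof.
move=> [K [K0 [r h]]] hX; apply: bnd1_cst.
exists (4 * K), r.+1 => n; rewrite expr1 ler_pdivlMr ?ltr0n //.
have -> : normc g * n.+1%:R = normc (\sum_(p < n.+1) (X p (n - p)%N - g)).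
  rewrite sumrB hX sub0r normcN sumr_const card_ord -[g *+ _]mulr_natr normcM.
  by rewrite normc_nat.
have -> : 4 * K * Lg R n ^+ r.+1 = K * Lg R n ^+ r * (4 * Lg R n) by rewrite exprS; ring.
apply: (@le_trans _ _ (\sum_(p < n.+1) K * Lg R n ^+ r * (p.+1%:R^-1 + (n - p).+1%:R^-1))).
  elim/big_rec2: _ => [|i y z _ hyz]; first by rewrite normc0.
  apply: le_trans (le_normcD _ _) _; apply: lerD => //.
  by have := h i (n - i)%N; rewrite subnKC // -ltnS.
rewrite -mulr_sumr ler_wpM2l ?mulr_ge0 ?LgX_ge0 // big_split /=.
have -> : \sum_(i < n.+1) ((n - i).+1%:R^-1 : R) = \sum_(i < n.+1) i.+1%:R^-1.
  rewrite (reindex_inj rev_ord_inj) /=; apply: eq_bigr => i _.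
  by rewrite subSS subKn // -ltnS.
have := LgS_le R n; rewrite {1}/Lg; have := Lg_ge1 R n; lra.
Qed.

End DoubleBounds.

(** * The inner sums around the distinguished index *)

Section MarkedSums.
Variables (R : realType) (m : nat).
Notation C := R[i].
Notation item := (R * mpoly m C)%type.
Notation p0 := ((0, 0) : item).
Implicit Types (s : seq item) (a : item) (nu : multinom m).

Definition half_diff (y z : mpoly m C) : mpoly m C := 2^-1 *: (y - z).

(** Below the distinguished index the summation variables are the gaps [k_j - k_i], which grow as
    [i] decreases: hence the reversal and the opposite phases and differences. *)
Definition zleft s (j : nat) : seq item :=
  [seq (- p.1, half_diff (nth p0 s j).2 p.2) | p : item <- rev (take j s)].
Definition zright s (j : nat) : seq item :=
  [seq (p.1, half_diff p.2 (nth p0 s j).2) | p : item <- drop j.+1 s].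

Lemma nocst_half_diff y z : nocst y -> nocst z -> nocst (half_diff y z).
Proof. by rewrite /nocst /half_diff mcoeffZ mcoeffB => -> ->; rewrite subr0 mulr0. Qed.

Lemma nocst0 : nocst (0 : mpoly m C).
Proof. exact: mcoeff0. Qed.

Lemma nocst_nth s j : nocsts s -> nocst (nth p0 s j).2.
Proof.
move=> hs; have [h|h] := ltnP j (size s); first by apply: hs; apply: mem_nth.
by rewrite nth_default //; exact: nocst0.
Qed.

Lemma nocsts_zleft s j : nocsts s -> nocsts (zleft s j).
Proof.
move=> hs _ /mapP[p ps ->] /=; apply: nocst_half_diff; first exact: nocst_nth.
by apply: hs; apply: mem_take (_ : p \in take j s); rewrite -mem_rev.
Qed.

Lemma nocsts_zright s j : nocsts s -> nocsts (zright s j).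
Proof.
move=> hs _ /mapP[p ps ->] /=; apply: nocst_half_diff; last exact: nocst_nth.
by apply: hs; apply: mem_drop ps.
Qed.

Definition phase s (t : seq nat) : R :=
  \sum_(i < size s) (nth p0 s i).1 * (nth 0%N t i)%:R.
Definition total s : R := \sum_(i < size s) (nth p0 s i).1.

(** Half of [2 k - y_i]; the constant -1 of the odd denominators cancels in differences and is
    dropped. *)
Definition shifted s (i k : nat) : pser R m :=
  k%:R *: 1 - 2^-1 *: ps (nth p0 s i).2.

Definition marked_factor s (j i k' k : nat) : pser R m :=
  if (i < j)%N
  then e (- (nth p0 s i).1) ^+ (k - k') *:
    geo (den_zeta R (k - k')) (half_diff (nth p0 s j).2 (nth p0 s i).2)
  else e ((nth p0 s i).1) ^+ (k' - k) *:
    geo (den_zeta R (k' - k)) (half_diff (nth p0 s i).2 (nth p0 s j).2).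

Lemma take_nth_iota s j : (j <= size s)%N -> take j s = [seq nth p0 s i | i <- iota 0 j].
Proof. by move=> h; rewrite map_nth_iota0. Qed.

Lemma drop_nth_iota s j : drop j s = [seq nth p0 s i | i <- iota j (size s - j)].
Proof. by rewrite map_nth_iota ?take_oversize ?size_drop //; lia. Qed.

Lemma nest_zleft s j k : nocsts s -> (j <= size s)%N -> (0 < k)%N ->
  nest [seq marked_factor s j i ^~ k | i <- iota 0 j] k.-1 0 =
  Tser (@den_zeta R) k.-1 (zleft s j).
Proof.
move=> hs js k0; rewrite /Tser gser_trunc_sum; last exact: nocsts_zleft.
rewrite /zleft take_nth_iota // -map_rev -!map_comp /=.
transitivity (nest [seq (fun k' => e (- (nth p0 s i).1) ^+ (k - k') *:
    geo (den_zeta R (k - k')) (half_diff (nth p0 s j).2 (nth p0 s i).2))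
    | i <- iota 0 j] k.-1 0).
  apply: eq_nest => i k'; rewrite mem_iota /marked_factor => h _.
  by rewrite ifT //; lia.
have h : (k.-1 < k)%N by lia.
rewrite -{1}[iota 0 j]revK.
rewrite (nest_rev (rev (iota 0 j)) (fun i k' => e (- (nth p0 s i).1) ^+ k' *:
    geo (den_zeta R k') (half_diff (nth p0 s j).2 (nth p0 s i).2)) 0 h).
by rewrite subn0 subnn.
Qed.

Lemma nest_zright s j k N : nocsts s -> (k <= N)%N ->
  nest [seq marked_factor s j i ^~ k | i <- iota j.+1 (size s - j.+1)] N k =
  Tser (@den_zeta R) (N - k) (zright s j).
Proof.
move=> hs kN; rewrite /Tser gser_trunc_sum; last exact: nocsts_zright.
rewrite /zright drop_nth_iota -!map_comp /=.
transitivity (nest [seq (fun k' => e (nth p0 s i).1 ^+ (k' - k) *: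
    geo (den_zeta R (k' - k)) (half_diff (nth p0 s i).2 (nth p0 s j).2))
    | i <- iota j.+1 (size s - j.+1)] N k).
  apply: eq_nest => i k'; rewrite mem_iota /marked_factor => h _.
  by rewrite ifF //; lia.
exact: (nest_shift_sub (iota j.+1 (size s - j.+1)) (fun i k' => e (nth p0 s i).1 ^+ k' *:
    geo (den_zeta R k') (half_diff (nth p0 s i).2 (nth p0 s j).2)) kN).
Qed.

Lemma subrBB (V : zmodType) (u v w z : V) : (u - v) - (w - z) = (u - w) - (v - z).
Proof. by rewrite !opprB [z - w]addrC addrACA [- v + z]addrC. Qed.

(** The constant term of the difference is the nonzero integer [k - k'], and this decides
    invertibility. *)
Lemma natr_unit_sub s i j k k' : nocsts s -> k != k' ->
  shifted s i k - shifted s j k' \is a GRing.unit.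
Proof.
wlog kk : i j k k' / (k' < k)%N.
  move=> h hs kk'; have [lt|lt|/eqP] := ltngtP k' k; last by rewrite eq_sym (negbTE kk').
    exact: h.
  by rewrite -opprB unitrN; apply: h => //; rewrite eq_sym.
move=> hs _.
have c0 : (k - k')%:R != 0 :> C by rewrite pnatr_eq0; lia.
have [u _] := geo_unit c0 (nocst_half_diff (nocst_nth i hs) (nocst_nth j hs)).
suff -> : shifted s i k - shifted s j k' = (k - k')%:R *: 1 -
    ps (half_diff (nth p0 s i).2 (nth p0 s j).2) by [].
rewrite /shifted /half_diff psZ psB natrB; last by lia.
by rewrite scalerBl scalerBr subrBB.
Qed.

Lemma marked_factorE s j i k' k : nocsts s -> (i < j)%N = (k' < k)%N -> k' != k ->
  marked_factor s j i k' k = ((-1) ^+ (i < j)%N * e ((nth p0 s i).1 * (k'%:R - k%:R))) *: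
     (shifted s i k' - shifted s j k)^-1.
Proof.
have G i1 j1 k1 k1' : nocsts s -> (k1' < k1)%N ->
    geo (den_zeta R (k1 - k1')) (half_diff (nth p0 s i1).2 (nth p0 s j1).2) =
    (shifted s i1 k1 - shifted s j1 k1')^-1.
  move=> hs lt; have c0 : (k1 - k1')%:R != 0 :> C by rewrite pnatr_eq0; lia.
  have [_ ->] := geo_unit c0 (nocst_half_diff (nocst_nth i1 hs) (nocst_nth j1 hs)).
  congr (_^-1); rewrite /shifted /half_diff psZ psB natrB; last by lia.
  by rewrite scalerBl scalerBr subrBB.
move=> hs ij kk; rewrite /marked_factor; case: ifP => ij'; rewrite ij' in ij.
  rewrite G // -[shifted s j k - _]opprB invrN scalerN -scaleNr; congr (_ *: _).
  rewrite expr1 mulN1r; congr (- _); rewrite eX natrB ?(ltnW (esym ij)) //.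
  by congr e; ring.
have lt : (k < k')%N by rewrite ltn_neqAle eq_sym kk leqNgt -ij.
by rewrite G // expr0 mul1r eX natrB // ltnW.
Qed.

Lemma path_ltn_nth (t : seq nat) i j l : path ltn l t -> (i < size t)%N -> (j < size t)%N ->
  ((nth 0%N t i < nth 0%N t j) = (i < j))%N.
Proof.
move=> pt hi hj; have st : sorted ltn t by apply: path_sorted pt.
have M : forall u v, (u < size t)%N -> (v < size t)%N -> (u < v)%N ->
    (nth 0%N t u < nth 0%N t v)%N.
  by move=> u v hu hv uv; apply: (sorted_ltn_nth ltn_trans) => //; rewrite inE.
have [ij|ji|->] := ltngtP i j; first exact: M.
  by apply/negbTE; rewrite -leqNgt ltnW // M.
by rewrite ltnn.
Qed.

(** The relative phases [e (phi_i (k_i - k_j))] multiply to the full phase times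
    [e (- total * k_j)]. This is why the distinguished index sees only the sum of all [phi_i], as in
    [B^t]. *)
Lemma marked_sum s (X : nat -> nat -> pser R m) N : nocsts s ->
  \sum_(j < size s) \sum_(1 <= k < N.+1) X j k *
    ((-1) ^+ j *: (Tser (@den_zeta R) k.-1 (zleft s j) *
       Tser (@den_zeta R) (N - k) (zright s j))) =
  sum_incr (size s) (fun t => e (phase s t) *: \sum_(j < size s)
    (e (- (total s * (nth 0%N t j)%:R)) *: X j (nth 0%N t j)) *
     \prod_(i < size s | i != j :> nat)
       (shifted s i (nth 0%N t i) - shifted s j (nth 0%N t j))^-1) N 0.
Proof.
move=> hs.
transitivity (\sum_(j < size s) sum_incr (size s) (fun t =>
   ((-1) ^+ j *: X j (nth 0%N t j)) * \prod_(i < size s | i != j :> nat)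
      marked_factor s j i (nth 0%N t i) (nth 0%N t j)) N 0).
  apply: eq_bigr => j _.
  rewrite (sum_incr_marker (fun k => (-1) ^+ j *: X j k) (marked_factor s j)) //.
  apply: eq_big_nat => k /andP[k0 kN].
  by rewrite nest_zleft ?nest_zright // ?(ltnW (ltn_ord j)) // -scalerAl -scalerAr.
rewrite -sum_incr_sum; apply: eq_sum_incr => t st pt _.
rewrite scaler_sumr; apply: eq_bigr => j _.
have tt i : (i < size s)%N -> i != j -> nth 0%N t i != nth 0%N t j.
  move=> hi ij; rewrite neq_ltn !(@path_ltn_nth _ _ _ 0) ?st //.
  by rewrite -neq_ltn.
transitivity (((-1) ^+ j *: X j (nth 0%N t j)) *
   (\prod_(i < size s | i != j :> nat) ((-1) ^+ (i < j)%N *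
        e ((nth p0 s i).1 * ((nth 0%N t i)%:R - (nth 0%N t j)%:R))) *:
   \prod_(i < size s | i != j :> nat)
       (shifted s i (nth 0%N t i) - shifted s j (nth 0%N t j))^-1)).
  congr (_ * _); rewrite -scaler_prod; apply: eq_bigr => i ij.
  by rewrite marked_factorE // ?(path_ltn_nth (l := 0)) ?st // tt.
rewrite -scalerAl -!scalerAr -!scalerAl !scalerA; congr (_ *: _).
rewrite big_split /=.
(* Each [i < j] contributes a sign, [k_i - k_j] being negative; these [j] signs cancel the
   prefactor. *)
have -> : \prod_(i < size s | i != j :> nat) (-1) ^+ (i < j)%N = (-1) ^+ j :> C.
  rewrite prodrXr; congr (_ ^+ _).
  rewrite (eq_bigr (fun i : 'I_(size s) => if (i < j)%N then 1%N else 0%N)); last first.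
    by move=> i _; case: ltnP.
  rewrite -big_mkcondr (eq_bigl (fun i : 'I_(size s) => (i < j)%N)); last first.
    by move=> i; rewrite andb_idl // => /ltn_eqF ->.
  by rewrite (big_ord_narrow (ltnW (ltn_ord j))) sum1_card card_ord.
rewrite mulrA -exprD -signr_odd addnn odd_double expr0 mul1r -e_sum -eD.
congr e.
rewrite /phase /total mulr_suml -sumrB [RHS](bigD1 j) //= subrr add0r.
by apply: eq_bigr => i _; rewrite mulrBr.
Qed.

End MarkedSums.

(** * Decay of the alternating sum of the inner sums *)

Section MarkedVanishing.
Variables (R : realType) (m : nat).
Notation C := R[i].
Notation item := (R * mpoly m C)%type.
Notation p0 := ((0, 0) : item).
Notation den := (@den_zeta R).
Notation h n := (trunc_sum den n 0 [:: letter11 R]).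
Implicit Types (s : seq item) (a : item) (nu : multinom m).

Let gz := good_den_zeta R.

Lemma totalE s : total s = \sum_(p <- s) p.1.
Proof. by rewrite /total (big_nth p0) big_mkord. Qed.

Definition marked_trunc (p q : nat) s : pser R m :=
  \sum_(j < size s) (-1) ^+ j *: (Tser den p (zleft s j) * Tser den q (zright s j)).

Definition marked_reg (T U : C) s : pser R m :=
  \sum_(j < size s) (-1) ^+ j *: (Aser den T (zleft s j) * Aser den U (zright s j)).

Lemma marked_asymp s nu :
  bnd2 (fun p q => marked_trunc p q s nu - marked_reg (h p) (h q) s nu).
Proof.
apply: (@bnd2_ext _ (fun p q => \sum_(j < size s) (-1) ^+ j *
   \sum_(k : bmultinom m (mdeg nu).+1 * bmultinom m (mdeg nu).+1
           | nu == mnm_add k.1 k.2)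
     ((Tser den p (zleft s j) k.1 - Aser den (h p) (zleft s j) k.1) *
        Tser den q (zright s j) k.2 +
      (Tser den q (zright s j) k.2 - Aser den (h q) (zright s j) k.2) *
        Aser den (h p) (zleft s j) k.1))).
  move=> p q; rewrite /marked_trunc /marked_reg !pser_sumE -sumrB.
  apply: eq_bigr => j _; rewrite !pserZE !pserME -mulrBr -sumrB; congr (_ * _).
  by apply: eq_bigr => k _; ring.
apply: bnd2_sum => j _; apply: bnd2Z; apply: bnd2_sum => k _; apply: bnd2D.
  by apply: bnd2_prod; [exact: Tser_asymp | exact: (Tser_bnd gz _ _).1].
apply: (bnd2_swap (X := fun q p => (Tser den q (zright s j) k.2 -
   Aser den (h q) (zright s j) k.2) * Aser den (h p) (zleft s j) k.1)).
by apply: bnd2_prod; [exact: Tser_asymp | exact: (Aser_bnd gz)].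
Qed.

(* An integral total phase makes the sum insensitive to the distinguished index;
   what remains is [sum_j prod_(i != j) 1/(x_i - x_j) = 0]. *)
Lemma marked_trunc_mean s n : nocsts s -> total s \is a Num.int -> (1 < size s)%N ->
  \sum_(p < n.+1) marked_trunc p (n - p) s = 0.
Proof.
move=> hs hi s2.
transitivity (\sum_(j < size s) \sum_(1 <= k < n.+2) (1 : pser R m) *
    ((-1) ^+ j *: (Tser den k.-1 (zleft s j) *
       Tser den (n.+1 - k) (zright s j)))).
  rewrite [RHS]exchange_big /= [RHS]big_add1 /= big_mkord; apply: eq_bigr => p _.
  by apply: eq_bigr => j _; rewrite mul1r subSS.
rewrite (marked_sum (fun _ _ => 1)) // -[RHS](sum_incr0 _ (size s) n.+1 0).
apply: eq_sum_incr => t st pt _.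
rewrite (eq_bigr (fun j : 'I_(size s) => \prod_(i < size s | i != j :> nat)
    ((shifted s i (nth 0%N t i) - shifted s j (nth 0%N t j))^-1 : pser R m))).
  case: (size s) st s2 => [//|[//|k]] st _.
  rewrite (partial_fractions0 (X := fun i => shifted s i (nth 0%N t i))) ?scaler0 //.
  move=> i j hi' hj ij; apply: natr_unit_sub => //.
  by rewrite neq_ltn !(@path_ltn_nth _ _ _ 0) ?st // -neq_ltn.
move=> j _; rewrite e_int ?scale1r ?mul1r //.
by rewrite rpredN rpredM // intr_nat.
Qed.

Lemma polyder_mulr (F F' : C -> pser R m) (K : pser R m) nu :
  (forall mu, polyder (fun T => F T mu) (fun T => F' T mu)) ->
  polyder (fun T => (F T * K) nu) (fun T => (F' T * K) nu).
Proof.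
move=> hF; apply: (@polyder_ext _
  (fun T => \sum_(k : bmultinom m (mdeg nu).+1 * bmultinom m (mdeg nu).+1
           | nu == mnm_add k.1 k.2) K k.2 * F T k.1) _
  (fun T => \sum_(k : bmultinom m (mdeg nu).+1 * bmultinom m (mdeg nu).+1
           | nu == mnm_add k.1 k.2) K k.2 * F' T k.1)).
- by move=> T; rewrite pserME; apply: eq_bigr => k _; rewrite mulrC.
- by move=> T; rewrite pserME; apply: eq_bigr => k _; rewrite mulrC.
- by apply: polyder_sum => k _; apply: polyderZ.
Qed.

Lemma Aser_polyderP s a : nocsts (rcons s a) -> forall mu,
  polyder (fun T => Aser den T (rcons s a) mu)
   (fun T => (if a.1 \is a Num.int then Aser den T s else 0) mu).
Proof.
move=> hs mu; apply: (polyder_ext _ _ (Aser_polyder gz mu hs)) => // T.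
by case: ifP.
Qed.

Lemma zleft_cons a s j :
  zleft (a :: s) j.+1 = rcons (zleft s j) (- a.1, half_diff (nth p0 s j).2 a.2).
Proof. by rewrite /zleft /= rev_cons map_rcons. Qed.

Lemma zright_rcons a s j : (j < size s)%N ->
  zright (rcons s a) j = rcons (zright s j) (a.1, half_diff a.2 (nth p0 s j).2).
Proof. by move=> js; rewrite /zright drop_rcons // map_rcons nth_rcons js. Qed.

(** The item [a] ends every left list except that of [j = 0], which is empty. Stripping it shifts
    [j] by 1, hence the sign. *)
Lemma marked_reg_cons U a s nu : nocsts (a :: s) ->
  polyder (fun T => marked_reg T U (a :: s) nu)
    (fun T => if a.1 \is a Num.int then - marked_reg T U s nu else 0).
Proof.
move=> has; have [ha hs] := nocsts_cons has.
apply: (@polyder_ext _ (fun T => (Aser den U (zright (a :: s) 0)) nu +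
   \sum_(j < size s) - (-1) ^+ j *
     (Aser den T (rcons (zleft s j) (- a.1, half_diff (nth p0 s j).2 a.2)) *
      Aser den U (zright s j)) nu) _
  (fun T => 0 + \sum_(j < size s) - (-1) ^+ j *
     ((if - a.1 \is a Num.int then Aser den T (zleft s j) else 0) *
      Aser den U (zright s j)) nu)).
- move=> T; rewrite /marked_reg pser_sumE /= big_ord_recl; congr (_ + _).
    by rewrite expr0 scale1r (_ : zleft _ _ = [::]) // (Aser_nil _ gz) mul1r.
  by apply: eq_bigr => j _; rewrite pserZE lift0 zleft_cons exprS mulN1r.
- move=> T; rewrite add0r rpredN; case: ifP => _; last first.
    by rewrite big1 // => j _; rewrite mul0r mulr0.
  rewrite /marked_reg pser_sumE -sumrN; apply: eq_bigr => j _.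
  by rewrite pserZE mulNr.
apply: polyderD; first exact: polyder_cst.
apply: polyder_sum => j _; apply: polyderZ; apply: polyder_mulr.
apply: Aser_polyderP; rewrite -zleft_cons; exact: nocsts_zleft.
Qed.

(** The item [a] ends every right list except that of the last [j], which is empty; stripping it
    keeps the signs. *)
Lemma marked_reg_rcons T a s nu : nocsts (rcons s a) ->
  polyder (fun U => marked_reg T U (rcons s a) nu)
    (fun U => if a.1 \is a Num.int then marked_reg T U s nu else 0).
Proof.
move=> has.
apply: (@polyder_ext _ (fun U => \sum_(j < size s) (-1) ^+ j *
     (Aser den U (rcons (zright s j) (a.1, half_diff a.2 (nth p0 s j).2)) *
      Aser den T (zleft s j)) nu +
    ((-1) ^+ size s *: Aser den T (zleft (rcons s a) (size s))) nu) _
  (fun U => \sum_(j < size s) (-1) ^+ j *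
     ((if a.1 \is a Num.int then Aser den U (zright s j) else 0) *
      Aser den T (zleft s j)) nu + 0)).
- move=> U; rewrite /marked_reg pser_sumE size_rcons big_ord_recr /=; congr (_ + _).
    apply: eq_bigr => j _; rewrite pserZE zright_rcons // [_ * Aser _ T _]mulrC.
    congr (_ * (Aser _ _ _ * _ : pser R m) nu).
    by rewrite /zleft nth_rcons ltn_ord -cats1 takel_cat // ltnW.
  by rewrite /zright drop_oversize ?size_rcons //= (Aser_nil _ gz) mulr1.
- move=> U; rewrite addr0; case: ifP => _; last first.
    by rewrite big1 // => j _; rewrite mul0r mulr0.
  rewrite /marked_reg pser_sumE; apply: eq_bigr => j _.
  by rewrite pserZE mulrC [_ * Aser _ T _]mulrC mulrC.
apply: polyderD; last exact: polyder_cst.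
apply: polyder_sum => j _; apply: polyderZ; apply: polyder_mulr.
apply: Aser_polyderP; rewrite -zright_rcons //; exact: nocsts_zright.
Qed.

(* By induction, [marked_reg] does not depend on [T] and [U], since differentiating
   strips a letter. Its constant value is the limit of the means of [marked_trunc]
   on the lines [p + q = n], which are 0. *)
Lemma marked_reg_eq0 s nu : nocsts s -> (0 < size s)%N -> total s \is a Num.int ->
  ~~ all (fun p => p.1 \is a Num.int) s || (nu != mnm0) ->
  forall T U, marked_reg T U s nu = 0.
Proof.
have [n] := ubnP (size s); elim: n s => // n IH s sn hs s0 tot hnu.
(* With a single item the sum is the series 1. The total is then the only phase and is an integer,
   so [nu] is not 0 and the coefficient vanishes. *)
have [s1|s2] := leqP (size s) 1.
  case: s s1 s0 hs tot hnu {sn IH} => [//|a [|//]] _ _ hs tot hnu T U.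
  rewrite /marked_reg big_ord1 expr0 scale1r.
  rewrite (_ : zleft _ _ = [::]) // (_ : zright _ _ = [::]) // !(Aser_nil _ gz) mulr1.
  rewrite pser1E; move: hnu tot; rewrite totalE big_seq1 /= andbT => /orP[/negbTE -> //|].
  by move=> /negbTE ->.
have cT U T T' : marked_reg T U s nu = marked_reg T' U s nu.
  case: s s0 sn s2 hs tot hnu => [//|a s] _ sn s2 has tot hnu.
  have [ha hs] := nocsts_cons has.
  apply: (@polyder0_cst _ (fun T => marked_reg T U (a :: s) nu)); apply: polyder_ext (marked_reg_cons U nu has) => // V.
  (* Only a letter with integral phase is stripped, so the total remains integral and a non-integral
     phase, if any, remains in the list. *)
  case: ifP => // ai; rewrite IH ?oppr0 //.
    by move: tot; rewrite !totalE big_cons rpredDl.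
  by move: hnu; rewrite /= ai.
have cU T U U' : marked_reg T U s nu = marked_reg T U' s nu.
  case/lastP: s s0 sn s2 hs tot hnu {cT} => [//|s a] _ sn s2 has tot hnu.
  have hs : nocsts s by move=> b bs; apply: has; rewrite mem_rcons inE bs orbT.
  rewrite size_rcons in sn s2.
  apply: (@polyder0_cst _ (fun U => marked_reg T U (rcons s a) nu)); apply: polyder_ext (marked_reg_rcons T nu has) => // V.
  case: ifP => // ai; rewrite IH //.
    by move: tot; rewrite !totalE -cats1 big_cat big_seq1 rpredDr.
  by move: hnu; rewrite all_rcons /= ai.
have cTU T U : marked_reg T U s nu = marked_reg 0 0 s nu.
  by rewrite (cT U T 0) (cU 0 U 0).
suff g0 : marked_reg 0 0 s nu = 0 by move=> T U; rewrite cTU.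
apply: (@bnd2_mean _ (fun p q => marked_trunc p q s nu)).
  by apply: bnd2_ext (marked_asymp s nu) => p q; rewrite cTU.
move=> k; have := congr1 (fun F : pser R m => F nu) (marked_trunc_mean k hs tot s2).
by rewrite pser_sumE.
Qed.

Lemma marked_trunc_bnd s nu : nocsts s -> (0 < size s)%N -> total s \is a Num.int ->
  ~~ all (fun p => p.1 \is a Num.int) s || (nu != mnm0) ->
  bnd2 (fun p q => marked_trunc p q s nu).
Proof.
move=> hs s0 tot hnu; apply: bnd2_ext (marked_asymp s nu) => p q.
by rewrite marked_reg_eq0 // subr0.
Qed.

End MarkedVanishing.

(** * Summation over the distinguished index *)

Section TriangularSums.
Variable R : realType.
Notation C := R[i].
Notation L := (Lg R).
Implicit Types (X : nat -> nat -> C) (a b : nat -> C).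

(** Common majorant, up to logarithms, of the error at distance [k] from the centre; partial
    fractions show that its sum is [O(log M / M)]. *)
Definition tri (M k : nat) : R := (k.+1%:R * (M - k)%:R)^-1.

Lemma tri_sum M : \sum_(k < M) tri M k <= 2 * L M / M.+1%:R.
Proof.
have -> : \sum_(k < M) tri M k = \sum_(k < M) (k.+1%:R^-1 + (M - k)%:R^-1) / M.+1%:R.
  apply: eq_bigr => k _; rewrite /tri.
  have -> : M.+1%:R = k.+1%:R + (M - k)%:R :> R.
    by rewrite -natrD; congr _%:R; have := ltn_ord k; lia.
  have : k.+1%:R != 0 :> R by rewrite pnatr_eq0.
  have : (M - k)%:R != 0 :> R by rewrite pnatr_eq0; have := ltn_ord k; lia.
  have : k.+1%:R + (M - k)%:R != 0 :> R by rewrite -natrD pnatr_eq0.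
  by move: k.+1%:R (M - k)%:R => y z h h1 h2; field; rewrite h h1 h2.
rewrite -mulr_suml ler_wpM2r ?invr_ge0 ?ler0n // big_split /=.
have -> : \sum_(i < M) ((M - i)%:R^-1 : R) = \sum_(i < M) i.+1%:R^-1.
  rewrite (reindex_inj rev_ord_inj) /=; apply: eq_bigr => i _.
  by congr (_%:R^-1); have := ltn_ord i; lia.
rewrite /Lg; lra.
Qed.

Lemma tri_ge0 M k : 0 <= tri M k.
Proof. by rewrite invr_ge0 mulr_ge0 // ler0n. Qed.

Lemma bnd1_tri X (K : R) r : 0 <= K ->
  (forall M k, (k < M)%N -> normc (X M k) <= K * L M ^+ r * tri M k) ->
  bnd 1 (fun M => \sum_(k < M) X M k).
Proof.
move=> K0 h; exists (K * 2), r.+1 => M; rewrite expr1.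
apply: (@le_trans _ _ (\sum_(k < M) K * L M ^+ r * tri M k)).
  elim/big_rec2: _ => [|i y z _ hyz]; first by rewrite normc0.
  by apply: le_trans (le_normcD _ _) _; apply: lerD => //; apply: h.
rewrite -mulr_sumr.
have -> : K * 2 * L M ^+ r.+1 / M.+1%:R = K * L M ^+ r * (2 * L M / M.+1%:R).
  by rewrite exprS; ring.
by rewrite ler_wpM2l ?mulr_ge0 ?LgX_ge0 // tri_sum.
Qed.

Lemma inv_le_tri M k : (k < M)%N -> (k.+1%:R * M.+1%:R)^-1 <= tri M k.
Proof.
move=> kM; rewrite /tri lef_pV2 ?posrE ?mulr_gt0 ?ltr0n ?subn_gt0 //.
by rewrite ler_pM2l ?ltr0n // ler_nat; lia.
Qed.

Lemma Lg_addn M k r : (k <= M)%N -> L (M + k) ^+ r <= 2 ^+ r * L M ^+ r.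
Proof.
move=> kM; rewrite -exprMn lerXn2r ?nnegrE ?mulr_ge0 ?Lg_ge0 //.
by apply: le_trans (Lg_double R M); apply: Lg_homo; rewrite leq_add2l.
Qed.

Lemma normc_telescope a (K : R) r (i n : nat) :
  (forall j, normc (a j.+1 - a j) <= K * L j ^+ r / j.+1%:R) -> 0 <= K ->
  normc (a (i + n)%N - a i) <= K * L (i + n) ^+ r * \sum_(j < n) (i + j).+1%:R^-1.
Proof.
move=> h K0; elim: n => [|n IH].
  by rewrite addn0 subrr normc0 big_ord0 mulr0.
rewrite addnS big_ord_recr /= mulrDr.
have -> : a (i + n).+1 - a i = (a (i + n)%N - a i) + (a (i + n).+1 - a (i + n)%N).
  by ring.
apply: le_trans (le_normcD _ _) _; apply: lerD.
  apply: le_trans IH _; rewrite ler_wpM2r //; last by rewrite ler_wpM2l // LgXl_homo.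
  by apply: sumr_ge0 => j _; rewrite invr_ge0 ler0n.
apply: le_trans (h _) _; rewrite ler_wpM2r ?invr_ge0 ?ler0n // ler_wpM2l //.
by rewrite LgXl_homo.
Qed.

Lemma sum_top_le M n : (0 < M)%N -> (n <= M)%N ->
  \sum_(j < n) ((M - n + j).+1%:R^-1 : R) <= 2 * n%:R * L M / M.+1%:R.
Proof.
move=> M0 nM; have Mp : 0 < M%:R :> R by rewrite ltr0n.
apply: (@le_trans _ _ (n%:R * L M / M%:R)); last first.
  have -> : 2 * n%:R * L M / M.+1%:R = n%:R * L M * (2 / M.+1%:R) by ring.
  rewrite ler_wpM2l ?mulr_ge0 ?ler0n ?Lg_ge0 //.
  rewrite ler_pdivlMr ?ltr0n // mulrC ler_pdivrMr // -natrM ler_nat; lia.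
rewrite ler_pdivlMr //.
(* Each denominator [D] satisfies [M <= D + n], so [M / D <= 1 + n / D]; the sum over the [n] terms
   is at most [n * L M]. *)
apply: (@le_trans _ _ (\sum_(j < n) (1 + n%:R * (M - n + j).+1%:R^-1))).
  rewrite mulr_suml; apply: ler_sum => j _.
  rewrite mulrC ler_pdivrMr ?ltr0n // mulrDl mul1r mulfVK ?pnatr_eq0 //.
  by rewrite -natrD ler_nat; lia.
rewrite big_split /= -mulr_sumr sumr_const card_ord -[1 *+ n]/(n%:R).
rewrite -[X in X + _]mulr1 -mulrDr ler_wpM2l ?ler0n // /Lg lerD2l.
have sp u v : \sum_(k < u + v) k.+1%:R^-1 = \sum_(k < u) k.+1%:R^-1 +
    \sum_(j < v) (u + j).+1%:R^-1 :> R by rewrite big_split_ord.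
have := sp (M - n)%N n; rewrite subnK // => ->; rewrite lerDr.
by apply: sumr_ge0 => j _; rewrite invr_ge0 ler0n.
Qed.

Definition slow a : Prop := bnd 0 a /\ bnd 1 (fun n => a n.+1 - a n).

(* The increments needed for an Abel summation of [z ^ k X(M + k, M - k - 1) / (2 k + 1)]. *)
Definition tame X : Prop := exists K : R, 0 <= K /\ exists r : nat, forall M k,
  ((k < M)%N -> normc (X (M + k)%N (M - k.+1)%N - X M M) <=
     K * L M ^+ r * (k.+1%:R / M.+1%:R)) /\
  ((k.+1 < M)%N -> normc (X (M + k.+1)%N (M - k.+2)%N - X (M + k)%N (M - k.+1)%N) <=
     K * L M ^+ r / (M - k.+1)%:R).

(** The upper argument stays above [M], where increments are [O(log^r M / M)]. The lower one may
    descend to 0, but [sum_top_le] still bounds its total variation by about [k / M] up to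
    logarithms. *)
Lemma slow_tame a b : slow a -> slow b -> tame (fun p q => a p * b q).
Proof.
move=> [/bnd_pos[Ka [Ka0 [ra ha]]] /bnd_pos[Ka' [Ka0' [ra' ha']]]].
move=> [/bnd_pos[Kb [Kb0 [rb hb]]] /bnd_pos[Kb' [Kb0' [rb' hb']]]].
pose r := (ra + ra' + rb + rb')%N.
pose K := Ka + Ka' + Kb + Kb'.
have K0 : 0 <= K by rewrite /K; lra.
have KL n : 0 <= K * L n ^+ r by rewrite mulr_ge0 ?LgX_ge0.
have Ha n : normc (a n) <= K * L n ^+ r.
  have := ha n r; rewrite expr0 divr1 => h; apply: le_trans (h _) _; first by rewrite /r; lia.
  by rewrite ler_wpM2r ?LgX_ge0 // /K; lra.
have Hb n : normc (b n) <= K * L n ^+ r.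
  have := hb n r; rewrite expr0 divr1 => h; apply: le_trans (h _) _; first by rewrite /r; lia.
  by rewrite ler_wpM2r ?LgX_ge0 // /K; lra.
have Ha' n : normc (a n.+1 - a n) <= K * L n ^+ r / n.+1%:R.
  have := ha' n r; rewrite expr1 => h; apply: le_trans (h _) _; first by rewrite /r; lia.
  by rewrite ler_wpM2r ?invr_ge0 ?ler0n // ler_wpM2r ?LgX_ge0 // /K; lra.
have Hb' n : normc (b n.+1 - b n) <= K * L n ^+ r / n.+1%:R.
  have := hb' n r; rewrite expr1 => h; apply: le_trans (h _) _; first by rewrite /r; lia.
  by rewrite ler_wpM2r ?invr_ge0 ?ler0n // ler_wpM2r ?LgX_ge0 // /K; lra.
clear ha ha' hb hb'; clearbody r K.
pose K2 := K * 2 ^+ r.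
have up M k : (k <= M)%N -> K * L (M + k) ^+ r <= K2 * L M ^+ r.
  by move=> kM; rewrite /K2 -mulrA ler_wpM2l // Lg_addn.
have K20 : 0 <= K2 by rewrite mulr_ge0 ?exprn_ge0.
have dn M k : (k <= M)%N -> K * L k ^+ r <= K2 * L M ^+ r.
  move=> kM; rewrite /K2 -mulrA ler_wpM2l // -exprMn lerXn2r ?nnegrE ?mulr_ge0 ?Lg_ge0 //.
  by have := @Lg_homo R _ _ kM; have := Lg_ge0 R M; lra.
have K2L n : 0 <= K2 * L n ^+ r by rewrite mulr_ge0 ?LgX_ge0.
exists (4 * K2 * K2); split; first by rewrite !mulr_ge0.
exists (r + r).+1 => M k; split=> kM.
  have M0 : (0 < M)%N by lia.
  have -> : a (M + k)%N * b (M - k.+1)%N - a M * b M =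
    (a (M + k)%N - a M) * b (M - k.+1)%N + a M * - (b M - b (M - k.+1)%N) by ring.
  have h1 : normc (a (M + k)%N - a M) <= K2 * L M ^+ r * (k.+1%:R / M.+1%:R).
    apply: le_trans (normc_telescope M k Ha' K0) _; apply: ler_pM => //.
    - by apply: sumr_ge0 => j _; rewrite invr_ge0 ler0n.
    - by apply: up; apply: ltnW.
    - apply: (@le_trans _ _ (\sum_(j < k) M.+1%:R^-1)).
        apply: ler_sum => j _; rewrite lef_pV2 ?posrE ?ltr0n // ler_nat; lia.
      rewrite sumr_const card_ord -[_ *+ k]mulr_natl ler_wpM2r ?invr_ge0 ?ler0n //.
      by rewrite ler_nat.
  have h2 : normc (b M - b (M - k.+1)%N) <= K2 * L M ^+ r * (2 * k.+1%:R * L M / M.+1%:R).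
    have e1 : (M - k.+1 + k.+1)%N = M by lia.
    have := normc_telescope (M - k.+1) k.+1 Hb' K0; rewrite e1 => h.
    apply: le_trans h _; apply: ler_pM => //.
    - by apply: sumr_ge0 => j _; rewrite invr_ge0 ler0n.
    - exact: dn.
    - by apply: sum_top_le.
  apply: le_trans (le_normcD _ _) _; rewrite !normcM normcN.
  apply: (@le_trans _ _ (K2 * L M ^+ r * (k.+1%:R / M.+1%:R) * (K2 * L M ^+ r) +
     K2 * L M ^+ r * (K2 * L M ^+ r * (2 * k.+1%:R * L M / M.+1%:R)))).
    apply: lerD; apply: ler_pM; rewrite ?normc_ge0 //.
      by apply: le_trans (Hb _) (dn _ _ _); lia.
    by apply: le_trans (Ha _) (dn _ _ _).
  have -> : 4 * K2 * K2 * L M ^+ (r + r).+1 * (k.+1%:R / M.+1%:R) =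
     (K2 * K2 * (L M ^+ r * L M ^+ r) * (k.+1%:R / M.+1%:R)) * (4 * L M).
    by rewrite exprS exprD; ring.
  have -> : K2 * L M ^+ r * (k.+1%:R / M.+1%:R) * (K2 * L M ^+ r) +
     K2 * L M ^+ r * (K2 * L M ^+ r * (2 * k.+1%:R * L M / M.+1%:R)) =
     (K2 * K2 * (L M ^+ r * L M ^+ r) * (k.+1%:R / M.+1%:R)) * (1 + 2 * L M) by ring.
  rewrite ler_wpM2l //; last by have := Lg_ge1 R M; lra.
  by rewrite !mulr_ge0 ?LgX_ge0 ?invr_ge0 ?ler0n.
have -> : a (M + k.+1)%N * b (M - k.+2)%N - a (M + k)%N * b (M - k.+1)%N =
    (a (M + k.+1)%N - a (M + k)%N) * b (M - k.+2)%N
    + a (M + k)%N * - (b (M - k.+1)%N - b (M - k.+2)%N) by ring.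
have p : 0 < (M - k.+1)%:R :> R by rewrite ltr0n; lia.
have h1 : normc (a (M + k.+1)%N - a (M + k)%N) <= K2 * L M ^+ r / (M - k.+1)%:R.
  rewrite addnS; apply: le_trans (Ha' _) _; apply: ler_pM => //.
  - by apply: up; lia.
  - by rewrite lef_pV2 ?posrE ?ltr0n ?ler_nat //; lia.
have h2 : normc (b (M - k.+1)%N - b (M - k.+2)%N) <= K2 * L M ^+ r / (M - k.+1)%:R.
  have -> : (M - k.+1 = (M - k.+2).+1)%N by lia.
  apply: le_trans (Hb' _) _; rewrite ler_wpM2r ?invr_ge0 ?ler0n //; apply: dn; lia.
apply: le_trans (le_normcD _ _) _; rewrite !normcM normcN.
apply: (@le_trans _ _ (K2 * L M ^+ r / (M - k.+1)%:R * (K2 * L M ^+ r) +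
     K2 * L M ^+ r * (K2 * L M ^+ r / (M - k.+1)%:R))).
  apply: lerD; apply: ler_pM; rewrite ?normc_ge0 //.
    by apply: le_trans (Hb _) (dn _ _ _); lia.
  by apply: le_trans (Ha _) (up _ _ _); lia.
have -> : 4 * K2 * K2 * L M ^+ (r + r).+1 / (M - k.+1)%:R =
   (K2 * K2 * (L M ^+ r * L M ^+ r) / (M - k.+1)%:R) * (4 * L M).
  by rewrite exprS exprD; ring.
have -> : K2 * L M ^+ r / (M - k.+1)%:R * (K2 * L M ^+ r) +
     K2 * L M ^+ r * (K2 * L M ^+ r / (M - k.+1)%:R) =
   (K2 * K2 * (L M ^+ r * L M ^+ r) / (M - k.+1)%:R) * 2 by ring.
rewrite ler_wpM2l //; last by have := Lg_ge1 R M; lra.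
by rewrite !mulr_ge0 ?LgX_ge0 ?invr_ge0 ?ler0n.
Qed.

Lemma tame_ext X Y : (forall p q, X p q = Y p q) -> tame X -> tame Y.
Proof.
move=> h [K [K0 [r H]]]; exists K; split=> //; exists r => M k; rewrite -!h; exact: H.
Qed.

Lemma tame0 : tame (fun _ _ => 0).
Proof.
by exists 0; split=> //; exists 0%N => M k; rewrite subrr normc0 !mul0r.
Qed.

Lemma tameD X Y : tame X -> tame Y -> tame (fun p q => X p q + Y p q).
Proof.
move=> [K [K0 [r H]]] [K' [K0' [r' H']]].
exists (K + K'); split; first exact: addr_ge0.
exists (r + r')%N => M k.
have B (u v : C) (c : R) : 0 <= c -> normc u <= K * L M ^+ r * c ->
    normc v <= K' * L M ^+ r' * c -> normc (u + v) <= (K + K') * L M ^+ (r + r') * c.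
  move=> c0 hu hv; apply: le_trans (le_normcD _ _) _; rewrite !mulrDl; apply: lerD.
    apply: le_trans hu _; rewrite ler_wpM2r // ler_wpM2l // LgX_homo // leq_addr //.
  apply: le_trans hv _; rewrite ler_wpM2r // ler_wpM2l // LgX_homo // leq_addl //.
have E (u v w z : C) : (u + v) - (w + z) = (u - w) + (v - z) by ring.
split=> kM; rewrite E; apply: B.
- by rewrite divr_ge0 ?ler0n.
- exact: (H M k).1.
- exact: (H' M k).1.
- by rewrite invr_ge0 ler0n.
- exact: (H M k).2.
- exact: (H' M k).2.
Qed.

Lemma tameZ c X : tame X -> tame (fun p q => c * X p q).
Proof.
move=> [K [K0 [r H]]]; exists (normc c * K); split; first by rewrite mulr_ge0 ?normc_ge0.
exists r => M k; split=> kM; rewrite -mulrBr normcM -!mulrA ler_wpM2l ?normc_ge0 // !mulrA.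
  by rewrite -[X in _ <= X]mulrA; exact: (H M k).1.
exact: (H M k).2.
Qed.

Lemma tame_sum (I : Type) (s : seq I) (P : pred I) (F : I -> nat -> nat -> C) :
  (forall i, P i -> tame (F i)) -> tame (fun p q => \sum_(i <- s | P i) F i p q).
Proof.
move=> h; elim: s => [|i s IH].
  by apply: tame_ext tame0 => p q; rewrite big_nil.
have [Pi|/negbTE nPi] := boolP (P i).
  by apply: tame_ext (tameD (h i Pi) IH) => p q; rewrite big_cons Pi.
by apply: tame_ext IH => p q; rewrite big_cons nPi.
Qed.

(** The weight [O(log^r k / k^2)] absorbs the loss [k/M] and leaves [1/(k M)] up to logarithms. *)
Lemma tame_bnd2_sum X (rho : nat -> C) : tame X -> bnd 2 rho ->
  bnd 1 (fun M => \sum_(k < M) rho k * (X (M + k)%N (M - k.+1)%N - X M M)).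
Proof.
move=> [K [K0 [r H]]] /bnd_pos[K' [K0' [r' h]]].
apply: (@bnd1_tri (fun M k => rho k * (X (M + k)%N (M - k.+1)%N - X M M)) (K' * K) (r' + r)).
  exact: mulr_ge0.
move=> M k kM; rewrite normcM.
apply: (@le_trans _ _ ((K' * L M ^+ r' / k.+1%:R ^+ 2) *
   (K * L M ^+ r * (k.+1%:R / M.+1%:R)))).
  apply: ler_pM; rewrite ?normc_ge0 //; last exact: (H M k).1.
  apply: le_trans (h k r' (leqnn _)) _; rewrite ler_wpM2r ?invr_ge0 ?exprn_ge0 ?ler0n //.
  by rewrite ler_wpM2l // LgXl_homo // ltnW.
have -> : K' * L M ^+ r' / k.+1%:R ^+ 2 * (K * L M ^+ r * (k.+1%:R / M.+1%:R)) =
    K' * K * L M ^+ (r' + r) * (k.+1%:R * M.+1%:R)^-1.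
  have : k.+1%:R != 0 :> R by rewrite pnatr_eq0.
  have : M.+1%:R != 0 :> R by rewrite pnatr_eq0.
  by move: k.+1%:R M.+1%:R => y z y0 z0; rewrite exprD; field; rewrite y0 z0.
by rewrite ler_wpM2l ?mulr_ge0 ?LgX_ge0 // inv_le_tri.
Qed.

Definition odd_inv (k : nat) : C := ((2 * k%:R + 1)^-1)%:C%C.

Lemma normc_odd_inv k : normc (odd_inv k) = (2 * k%:R + 1)^-1.
Proof.
by rewrite /odd_inv normcR ger0_norm // invr_ge0.
Qed.

Lemma odd_inv_le k : (2 * k%:R + 1)^-1 <= k.+1%:R^-1 :> R.
Proof.
have k0 : 0 <= k%:R :> R by rewrite ler0n.
by rewrite -[k.+1%:R]natr1; move: (k%:R) k0 => u u0; rewrite lef_pV2 ?posrE; lra.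
Qed.

(** Both reciprocals in [bnd2] are at most [1/(M-k)] here, and with the weight they form [tri]. *)
Lemma bnd2_odd_sum X : bnd2 X ->
  bnd 1 (fun M => \sum_(k < M) odd_inv k * X (M + k)%N (M - k.+1)%N).
Proof.
move=> [K [K0 [r h]]].
apply: (@bnd1_tri (fun M k => odd_inv k * X (M + k)%N (M - k.+1)%N) (K * 2 ^+ r * 2) r); first by rewrite !mulr_ge0 ?exprn_ge0.
move=> M k kM; rewrite normcM normc_odd_inv.
apply: (@le_trans _ _ (k.+1%:R^-1 * (K * (2 ^+ r * L M ^+ r) * (2 * (M - k)%:R^-1)))).
  apply: ler_pM; rewrite ?normc_ge0 ?odd_inv_le //.
  apply: le_trans (h _ _) _; apply: ler_pM.
  - by rewrite mulr_ge0 ?LgX_ge0.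
  - exact: inv_sum_ge0.
  - rewrite ler_wpM2l //; apply: le_trans (Lg_addn r (leqnn M)).
    by apply: LgXl_homo; lia.
  - rewrite mulr_natl mulr2n; apply: lerD; rewrite lef_pV2 ?posrE ?ltr0n ?ler_nat //; lia.
rewrite /tri invfM le_eqVlt; apply/orP; left; apply/eqP; ring.
Qed.

(** The weight [1/(2k+1)] alone does not absorb the loss [k/M]. Abel summation against [z^k]
    replaces the terms by their increments, which are bounded by [tri]. *)
Lemma tame_osc_sum X (z : C) : tame X -> `|z| = 1 -> z != 1 ->
  bnd 1 (fun M => \sum_(k < M) z ^+ k *
     (odd_inv k * (X (M + k)%N (M - k.+1)%N - X M M))).
Proof.
move=> [K [K0 [r H]]] z1 zn1.
pose g M k := odd_inv k * (X (M + k)%N (M - k.+1)%N - X M M).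
have nz k : normc (z ^+ k) = 1.
  by elim: k => [|k IH]; rewrite ?expr0 ?normc1 // exprS normcM (normc_unit z1) mul1r.
have hg M k : (k < M)%N -> normc (g M k) <= K * L M ^+ r / M.+1%:R.
  move=> kM; rewrite normcM normc_odd_inv.
  apply: (@le_trans _ _ (k.+1%:R^-1 * (K * L M ^+ r * (k.+1%:R / M.+1%:R)))).
    apply: ler_pM; rewrite ?normc_ge0 ?odd_inv_le //; last exact: (H M k).1.
  have : k.+1%:R != 0 :> R by rewrite pnatr_eq0.
  have : M.+1%:R != 0 :> R by rewrite pnatr_eq0.
  move: k.+1%:R M.+1%:R => y w w0 y0; rewrite le_eqVlt; apply/orP; left; apply/eqP; field.
  by rewrite y0 w0.
pose d M k := if k is k'.+1 then g M k - g M k' else g M k.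
have abel M : \sum_(k < M) z ^+ k * g M k =
    (z - 1)^-1 * ((if M is M'.+1 then z ^+ M * g M M' else 0) -
       \sum_(k < M) z ^+ k * d M k).
  have zz : z - 1 != 0 by rewrite subr_eq0.
  have A N : \sum_(k < N) z ^+ k * g M k =
    (z - 1)^-1 * ((if N is N'.+1 then z ^+ N * g M N' else 0) -
       \sum_(k < N) z ^+ k * d M k).
    elim: N => [|N IH]; first by rewrite !big_ord0 subrr mulr0.
    rewrite !big_ord_recr /= IH; case: N {IH} => [|N]; rewrite /d.
      by rewrite !big_ord0 !expr0 expr1; field.
    by rewrite !exprS; field.
  exact: A.
apply: (@bnd_ext _ _ (fun M => (z - 1)^-1 *
    ((if M is M'.+1 then z ^+ M * g M M' else 0) - \sum_(k < M) z ^+ k * d M k))).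
  by move=> M; rewrite -abel.
apply: bndZ; apply: bndB.
  exists K, r => M; rewrite expr1; case: M => [|M].
    by rewrite normc0 divr1 mulr_ge0 // LgX_ge0.
  by rewrite normcM nz mul1r hg.
apply: (@bnd1_tri (fun M k => z ^+ k * d M k) (4 * K) r); first by rewrite mulr_ge0.
move=> M k kM; rewrite normcM nz mul1r /d.
have KL : 0 <= K * L M ^+ r by rewrite mulr_ge0 ?LgX_ge0.
have t0 := tri_ge0 M k.
suff : normc (if k is k'.+1 then g M k - g M k' else g M k) <= (K * L M ^+ r) * (3 * tri M k).
  move/le_trans; apply; rewrite -[4 * K * _]mulrA.
  have -> : 4 * (K * L M ^+ r) * tri M k = (K * L M ^+ r) * (4 * tri M k) by ring.
  by rewrite ler_wpM2l //; lra.
case: k kM t0 => [|k] kM t0.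
  apply: le_trans (hg M 0%N kM) _; rewrite ler_wpM2l //.
  have := inv_le_tri kM; rewrite mul1r => /le_trans; apply.
  by move: (tri M 0) t0 => u; lra.
(* Discrete Leibniz rule: either the inner truncations move by one, or the weight changes, which
   gains a factor of order [1/k]. *)
have -> : g M k.+1 - g M k =
   odd_inv k.+1 * (X (M + k.+1)%N (M - k.+2)%N - X (M + k)%N (M - k.+1)%N)
   + (odd_inv k.+1 - odd_inv k) * (X (M + k)%N (M - k.+1)%N - X M M).
  rewrite /g; ring.
apply: le_trans (le_normcD _ _) _; rewrite !normcM.
have kM' : (k < M)%N by lia.
have y0 : 0 <= k%:R :> R by rewrite ler0n.
have h1 : normc (odd_inv k.+1) * normc (X (M + k.+1)%N (M - k.+2)%N -
    X (M + k)%N (M - k.+1)%N) <= K * L M ^+ r * tri M k.+1.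
  rewrite normc_odd_inv.
  apply: (@le_trans _ _ (k.+2%:R^-1 * (K * L M ^+ r / (M - k.+1)%:R))).
    apply: ler_pM; rewrite ?normc_ge0 ?odd_inv_le //; last exact: (H M k).2.
  by rewrite /tri invfM le_eqVlt; apply/orP; left; apply/eqP; ring.
have h2 : normc (odd_inv k.+1 - odd_inv k) * normc (X (M + k)%N (M - k.+1)%N - X M M) <=
    K * L M ^+ r * (2 * tri M k.+1).
  have -> : normc (odd_inv k.+1 - odd_inv k) =
      2 / ((2 * k%:R + 1) * (2 * k.+1%:R + 1)).
    rewrite /odd_inv -rmorphB normcR -[k.+1%:R]natr1.
    have u0 : 0 < 2 * k%:R + 1 :> R by lra.
    have -> : 2 * (k%:R + 1) + 1 = 2 * k%:R + 1 + 2 :> R by ring.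
    move: (2 * k%:R + 1) u0 => u u0.
    have u2 : 0 < u + 2 by lra.
    have -> : (u + 2)^-1 - u^-1 = - (2 / (u * (u + 2))) by field; rewrite !gt_eqF.
    by rewrite normrN ger0_norm // divr_ge0 // mulr_ge0 // ltW.
  apply: (@le_trans _ _ (2 / (k.+1%:R * k.+2%:R) * (K * L M ^+ r * (k.+1%:R / M.+1%:R)))).
    apply: ler_pM; rewrite ?normc_ge0 //; last exact: (H M k).1.
    by rewrite ler_pM2l // !invfM; apply: ler_pM; rewrite ?odd_inv_le ?invr_ge0 //.
  apply: (@le_trans _ _ (K * L M ^+ r * (2 * (k.+2%:R * M.+1%:R)^-1))).
    have : k.+1%:R != 0 :> R by rewrite pnatr_eq0.
    have : k.+2%:R != 0 :> R by rewrite pnatr_eq0.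
    have : M.+1%:R != 0 :> R by rewrite pnatr_eq0.
    move: k.+1%:R k.+2%:R M.+1%:R => y z' w hy hz hw.
    by rewrite le_eqVlt; apply/orP; left; apply/eqP; field; rewrite hy hz hw.
  by rewrite ler_wpM2l // ler_pM2l // inv_le_tri.
apply: le_trans (lerD h1 h2) _; rewrite -mulrDr ler_wpM2l //; lra.
Qed.

End TriangularSums.

(** * The cosine product *)

(* The nested sums of the [- 1 / (2 k - 1)^2] are compared with those of the
   [- (pi / (4 M))^2 / sin^2 ((2 k - 1) pi / (4 M))], which are explicit: up to
   scaling, these are the coefficients of the polynomial in [sin^2 t] that is equal
   to [cos (2 M t)]. *)
Section CosineProduct.

(** With equal entries a nested sum is an elementary symmetric polynomial. *)
Lemma nest_nseq_coef (A : comNzRingType) n (b : nat -> A) N :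
  nest (nseq n b) N 0 = (\prod_(k < N) (1 + b k.+1 *: 'X))`_n.
Proof.
elim: N n => [|N IH] [|n].
- by rewrite /= big_ord0 coef1.
- by rewrite /= big_ord0 coef1 big_geq.
- rewrite /= big_ord_recr /= mulrDr mulr1 coefD -scalerAr coefZ coefMX /= mulr0 addr0.
  by rewrite -IH.
have rcons_nseq k : nseq k.+1 b = rcons (nseq k b) b by elim: k => //= k <-.
rewrite rcons_nseq nestS_rcons -rcons_nseq !IH big_ord_recr /= mulrDr mulr1 coefD.
by rewrite -scalerAr coefZ coefMX /= mulrC.
Qed.

Lemma nest_nseqZ (A : comNzRingType) n (c : A) (b : nat -> A) N l :
  nest (nseq n (fun k => c * b k)) N l = c ^+ n * nest (nseq n b) N l.
Proof.
elim: n l => [|n IH] l; first by rewrite expr0 mul1r.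
rewrite /= big_distrr /=; apply: eq_bigr => k _.
by rewrite IH exprS; ring.
Qed.

Variable R : realType.
Implicit Types (y z : R).

Definition cons_prod n z : R := \prod_(j < n) (z + j%:R).

Lemma cons_prodSr n z : cons_prod n.+1 z = cons_prod n z * (z + n%:R).
Proof. by rewrite /cons_prod big_ord_recr. Qed.

Lemma cons_prodSl n z : cons_prod n.+1 z = z * cons_prod n (z + 1).
Proof.
rewrite /cons_prod big_ord_recl addr0; congr (_ * _).
by apply: eq_bigr => j _; rewrite lift0 -natr1; ring.
Qed.

Definition diff_sq r y : R := \prod_(k < r) (y ^+ 2 - k%:R ^+ 2).

Lemma diff_sqE r y : diff_sq r.+1 y = y * cons_prod (r.*2.+1) (y - r%:R).
Proof.
elim: r => [|r IH].
  by rewrite /diff_sq /cons_prod !big_ord1 addr0 subr0 expr0n subr0 expr2.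
rewrite /diff_sq big_ord_recr /= -/(diff_sq r.+1 y) IH doubleS.
rewrite [in RHS]cons_prodSl [in RHS]cons_prodSr.
have -> : y - r.+1%:R + 1 = y - r%:R by rewrite -natr1; ring.
have -> : r.*2.+1%:R = r%:R + r%:R + 1 :> R by rewrite -natr1 -addnn natrD.
rewrite -[r.+1%:R]natr1; ring.
Qed.

(** This second difference in [y] becomes, through [cheb_coef], the three-term recurrence of
    Chebyshev polynomials. *)
Lemma diff_sq_rec r y : diff_sq r.+1 (y + 1) + diff_sq r.+1 (y - 1) =
  2 * diff_sq r.+1 y + r.+1.*2%:R * r.*2.+1%:R * diff_sq r y.
Proof.
case: r => [|r].
  rewrite /diff_sq !big_ord1 big_ord0 -[1.*2%:R]/(2 : R) -[0.*2.+1%:R]/(1 : R); ring.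
rewrite !diff_sqE.
have e1 : y + 1 - r.+1%:R = y - r%:R by rewrite -natr1; ring.
have e2 : y - 1 - r.+1%:R = y - r%:R - 1 - 1 by rewrite -natr1; ring.
have e3 : y - r.+1%:R = y - r%:R - 1 by rewrite -natr1; ring.
rewrite e1 e2 e3.
have -> : cons_prod r.+1.*2.+1 (y - r%:R) = cons_prod r.*2.+1 (y - r%:R) *
   (y + r%:R + 1) * (y + r%:R + 2).
  rewrite doubleS !cons_prodSr -addnn -![_.+1%:R]natr1 natrD; ring.
have -> : cons_prod r.+1.*2.+1 (y - r%:R - 1 - 1) = (y - r%:R - 1 - 1) * (y - r%:R - 1) *
   cons_prod r.*2.+1 (y - r%:R).
  by rewrite doubleS 2!cons_prodSl !subrK mulrA.
have -> : cons_prod r.+1.*2.+1 (y - r%:R - 1) = (y - r%:R - 1) *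
   cons_prod r.*2.+1 (y - r%:R) * (y + r%:R + 1).
  rewrite doubleS cons_prodSl subrK cons_prodSr -addnn -![_.+1%:R]natr1 natrD; ring.
rewrite !doubleS -addnn -![_.+1%:R]natr1 natrD; ring.
Qed.

(** Up to sign, the coefficient of [sin^(2r) t] in [cos (2 M t)]. *)
Definition cheb_coef (M r : nat) : R := 4 ^+ r / (r.*2)`!%:R * diff_sq r M%:R.

Lemma cheb_coef0 M : cheb_coef M 0 = 1.
Proof. by rewrite /cheb_coef /diff_sq big_ord0 fact0 divr1 mulr1 expr0. Qed.

Lemma cheb_coef_gt M r : (M < r)%N -> cheb_coef M r = 0.
Proof.
move=> Mr; rewrite /cheb_coef /diff_sq (bigD1 (Ordinal Mr)) //= subrr mul0r mulr0 //.
Qed.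

Lemma cheb_coef_rec M r : cheb_coef M.+2 r.+1 + cheb_coef M r.+1 =
  2 * cheb_coef M.+1 r.+1 + 4 * cheb_coef M.+1 r.
Proof.
rewrite /cheb_coef.
have := diff_sq_rec r M.+1%:R; rewrite natr1.
have -> : M.+1%:R - 1 = M%:R :> R by rewrite -natr1 addrK.
move=> h.
have f0 : r.*2`!%:R != 0 :> R by rewrite pnatr_eq0 -lt0n fact_gt0.
have a0 : r.*2.+1%:R != 0 :> R by rewrite pnatr_eq0.
have b0 : r.*2.+2%:R != 0 :> R by rewrite pnatr_eq0.
rewrite -mulrDr h doubleS !factS !natrM exprS.
move: (r.*2.+1%:R) (r.*2.+2%:R) (r.*2`!%:R) a0 b0 f0 => a b f a0 b0 f0.
by field; rewrite a0 b0 f0.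
Qed.

(** The Chebyshev polynomial [T_M] at [1 - 2 X]. *)
Definition cheb M : {poly R} := \poly_(r < M.+1) ((-1) ^+ r * cheb_coef M r).

Lemma coef_cheb M r : (cheb M)`_r = (-1) ^+ r * cheb_coef M r.
Proof.
by rewrite coef_poly ltnS; case: leqP => // h; rewrite cheb_coef_gt // mulr0.
Qed.

Lemma cheb_rec M : cheb M.+2 = 2%:P * (1 - 2%:P * 'X) * cheb M.+1 - cheb M.
Proof.
apply/polyP => r.
have -> : 2%:P * (1 - 2%:P * 'X) * cheb M.+1 = 2 *: cheb M.+1 - 4 *: (cheb M.+1 * 'X).
  have e4 : (4 : R)%:P = 2%:P * 2%:P by rewrite -polyCM; congr (_%:P); ring.
  rewrite -!mul_polyC e4; ring.
rewrite !coefB !coefZ coefMX; case: r => [|r] /=; rewrite !coef_cheb.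
  by rewrite !cheb_coef0; ring.
have := cheb_coef_rec M r; rewrite exprS => h.
have -> : cheb_coef M.+2 r.+1 =
   2 * cheb_coef M.+1 r.+1 + 4 * cheb_coef M.+1 r - cheb_coef M r.+1 by rewrite -h addrK.
ring.
Qed.

Lemma cheb0 : cheb 0 = 1.
Proof.
apply/polyP => r; rewrite coef_cheb coef1; case: r => [|r] /=.
  by rewrite cheb_coef0 mulr1.
by rewrite cheb_coef_gt // mulr0.
Qed.

Lemma cheb1 : cheb 1 = 1 - 2%:P * 'X.
Proof.
apply/polyP => r; rewrite coef_cheb coefB coef1 coefCM coefX; case: r => [|[|r]] /=.
- by rewrite cheb_coef0; ring.
- rewrite /cheb_coef /diff_sq big_ord1 expr1 expr0n subr0 expr1n /=.
  have -> : 1.*2`!%:R = 2 :> R by [].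
  by field.
- by rewrite cheb_coef_gt //; ring.
Qed.

Lemma horner_cheb M (t : R) : (cheb M).[sin t ^+ 2] = cos (2 * M%:R * t).
Proof.
suff : (cheb M).[sin t ^+ 2] = cos (2 * M%:R * t) /\
    (cheb M.+1).[sin t ^+ 2] = cos (2 * M.+1%:R * t) by case.
have c2 : cos (2 * t) = 1 - 2 * sin t ^+ 2.
  rewrite mulr_natl cos_mulr2n cos2sin2; ring.
elim: M => [|M [IH1 IH2]].
  rewrite cheb0 cheb1 !hornerE.
  rewrite ?mulr0n ?mulr0 ?mul0r cos0 ?mulr1 c2.
  by split=> //; rewrite expr2 mulrA.
split=> //; rewrite cheb_rec !hornerE IH1 IH2.
have -> : 2 * M.+2%:R * t = 2 * M.+1%:R * t + 2 * t by rewrite -[M.+2%:R]natr1; ring.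
have -> : 2 * M%:R * t = 2 * M.+1%:R * t - 2 * t by rewrite -[M.+1%:R]natr1; ring.
rewrite cosB cosD c2. rewrite /=; ring.
Qed.

(** For [k < M], the zeros of [cos (2 M t)] between 0 and [pi / 2]. *)
Definition node (M k : nat) : R := (2 * k%:R + 1) * pi / (4 * M%:R).

Lemma node_bounds M k : (k < M)%N -> 0 < node M k < pi / 2.
Proof.
move=> kM; have M0 : 0 < M%:R :> R by rewrite ltr0n; lia.
have k0 : 0 <= k%:R :> R by rewrite ler0n.
have p0 := pi_gt0 R; apply/andP; split.
  by rewrite /node divr_gt0 ?mulr_gt0 //; lra.
rewrite /node ltr_pdivrMr ?mulr_gt0 //.
have : k%:R + 1 <= M%:R :> R by rewrite natr1 ler_nat.
move=> h; have -> : pi / 2 * (4 * M%:R) = (2 * M%:R) * pi :> R by field.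
by rewrite ltr_pM2r //; lra.
Qed.

Lemma cos_odd_pihalf k : cos ((2 * k%:R + 1) * (pi / 2)) = 0 :> R.
Proof.
elim: k => [|k IH]; first by rewrite mulr0 add0r mul1r cos_pihalf.
have -> : (2 * k.+1%:R + 1) * (pi / 2) = (2 * k%:R + 1) * (pi / 2) + pi :> R.
  by rewrite -natr1; field.
by rewrite cosDpi IH oppr0.
Qed.

Lemma sin_node_gt0 M k : (k < M)%N -> 0 < sin (node M k).
Proof. by move=> h; apply/sin_gt0_pihalf/node_bounds. Qed.

Lemma root_cheb_node M k : (k < M)%N -> (cheb M).[sin (node M k) ^+ 2] = 0.
Proof.
move=> kM; rewrite horner_cheb -(cos_odd_pihalf k); congr cos.
have M0 : M%:R != 0 :> R by rewrite pnatr_eq0; lia.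
by rewrite /node; field.
Qed.

Lemma sin_node_inj M i j : (i < M)%N -> (j < M)%N ->
  sin (node M i) ^+ 2 = sin (node M j) ^+ 2 -> i = j.
Proof.
move=> hi hj /eqP; rewrite eqrXn2 ?(ltW (sin_node_gt0 _)) // => /eqP.
have inI k : (k < M)%N -> node M k \in `[(- (pi / 2)), (pi / 2)].
  move=> /node_bounds /andP[h1 h2]; rewrite in_itv /=; apply/andP; split; last exact: ltW.
  by apply: le_trans (ltW h1); rewrite oppr_le0 divr_ge0 // pi_ge0.
move=> /(sin_inj (inI _ hi) (inI _ hj)) /eqP; rewrite /node.
have M0 : (4 * M%:R)^-1 != 0 :> R.
  by rewrite invr_eq0 mulf_neq0 ?pnatr_eq0 //; lia.
have p0 : pi != 0 :> R by rewrite gt_eqF // pi_gt0.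
rewrite (inj_eq (mulIf M0)) (inj_eq (mulIf p0)) (inj_eq (addIr 1)).
by rewrite (inj_eq (mulfI _)) ?pnatr_eq0 // eqr_nat => /eqP.
Qed.

Lemma size_prod_1X (b : nat -> R) M : (size (\prod_(k < M) (1 + b k *: 'X))%R <= M.+1)%N.
Proof.
elim: M => [|M IH]; first by rewrite big_ord0 size_polyC oner_eq0.
rewrite big_ord_recr /=; apply: leq_trans (size_polyMleq _ _) _.
have : (size (1 + b M *: 'X)%R <= 2)%N.
  apply: leq_trans (size_polyD _ _) _; rewrite geq_max size_polyC oner_eq0 /=.
  by apply: leq_trans (size_scale_leq _ _) _; rewrite size_polyX.
move: IH; move: (size _) (size _) => u v; lia.
Qed.

(** Both sides have degree at most [M] and agree at [M + 1] points: they are 1 at 0 and vanish at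
    the [sin^2] of the nodes. *)
Lemma cheb_prod M : cheb M = \prod_(k < M) (1 + - (sin (node M k) ^+ 2)^-1 *: 'X).
Proof.
apply/eqP; rewrite -subr_eq0; apply/eqP.
apply: (@roots_geq_poly_eq0 _ _ (0 :: [seq sin (node M k) ^+ 2 | k <- iota 0 M])).
- rewrite /= !rootE; apply/andP; split.
    rewrite hornerD hornerN horner_coef0 coef_cheb cheb_coef0 mulr1 expr0.
    rewrite horner_prod big1 ?subrr // => k _.
    by rewrite hornerD hornerZ hornerX hornerC mulr0 addr0.
  apply/allP => z /mapP[k]; rewrite mem_iota => /= kM ->; rewrite rootE.
  rewrite hornerD hornerN root_cheb_node // horner_prod.
  rewrite (bigD1 (Ordinal kM)) //= hornerD hornerZ hornerX hornerC mulNr mulVf ?subrr ?mul0r ?subr0 //.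
  by rewrite expf_neq0 // gt_eqF // sin_node_gt0.
- rewrite /= map_inj_in_uniq ?iota_uniq ?andbT; last first.
    move=> i j; rewrite !mem_iota => /= hi hj; exact: sin_node_inj.
  apply/mapP => -[k]; rewrite mem_iota => /= kM /eqP.
  by rewrite eq_sym sqrf_eq0 gt_eqF // sin_node_gt0.
- rewrite /= size_map size_iota.
  apply: leq_trans (size_polyD _ _) _; rewrite geq_max size_polyN.
  apply/andP; split; first exact: size_poly.
  exact: (size_prod_1X (fun k => - (sin (node M k) ^+ 2)^-1)).
Qed.

Lemma sin_bounds (t : R) : 0 < t < pi / 2 -> t * cos t <= sin t <= t.
Proof.
move=> /andP[t0 t2].
have [c] := @MVT R sin cos 0 t t0 (fun x _ => is_derive_sin x)
   (continuous_subspaceT (@continuous_sin R)).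
rewrite in_itv /= sin0 !subr0 => /andP[c0 ct] ->.
have pp := pi_gt0 R.
rewrite mulrC ler_pM2r // ler_piMl ?cos_le1 ?andbT ?ltW //.
by rewrite ltr_cos ?in_itv /=; [| lra | lra].
Qed.

Lemma inv_sin2_bounds (t : R) : 0 < t < pi / 2 ->
  0 <= (sin t ^+ 2)^-1 - (t ^+ 2)^-1 <= 1.
Proof.
move=> ht; have /andP[t0 _] := ht; have /andP[h1 h2] := sin_bounds ht.
have s0 := sin_gt0_pihalf ht.
rewrite subr_ge0 lef_pV2 ?posrE ?exprn_gt0 //; apply/andP; split.
  by rewrite lerXn2r ?nnegrE // ltW.
rewrite lerBlDr.
(* Since [1 / sin^2 = 1 + cot^2], the upper bound reduces to [cot t <= 1 / t], which is
   [t cos t <= sin t]. *)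
have -> : (sin t ^+ 2)^-1 = 1 + (cos t / sin t) ^+ 2.
  rewrite expr_div_n cos2sin2; field; exact: lt0r_neq0.
rewrite lerD2l -exprVn; have c0 : 0 <= cos t.
  by apply: ltW; apply: cos_gt0_pihalf; move: ht; have := pi_gt0 R; lra.
rewrite lerXn2r ?nnegrE ?divr_ge0 ?invr_ge0 ?(ltW t0) ?(ltW s0) //.
by rewrite ler_pdivrMr // mulrC ler_pdivlMr // mulrC.
Qed.

End CosineProduct.

(** * Limits of the nested sums of inverse odd numbers *)

Section CosineLimit.
Variable R : realType.
Notation C := R[i].
Implicit Types (b c : nat -> R).

Lemma nest_nseq_bound b N B r l : \sum_(1 <= k < N.+1) `|b k| <= B ->
  `|nest (nseq r b) N l| <= B ^+ r.
Proof.
move=> hB; have B0 : 0 <= B by apply: le_trans hB; apply: sumr_ge0 => k _.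
elim: r l => [|r IH] l /=; first by rewrite normr1 expr0.
apply: le_trans (ler_norm_sum _ _ _) _; rewrite exprS.
apply: (@le_trans _ _ (\sum_(l.+1 <= k < N.+1) `|b k| * B ^+ r)).
  by apply: ler_sum => k _; rewrite normrM ler_wpM2l.
rewrite -mulr_suml ler_wpM2r ?exprn_ge0 //; apply: le_trans hB.
have [lN|Nl] := leqP l.+1 N.+1; last by rewrite big_geq ?sumr_ge0 // ltnW.
rewrite [X in _ <= X](big_cat_nat (n := l.+1)) //= lerDr.
by apply: sumr_ge0.
Qed.

Lemma nest_nseq_diff b c N B D r l :
  \sum_(1 <= k < N.+1) `|b k| <= B -> \sum_(1 <= k < N.+1) `|c k| <= B ->
  \sum_(1 <= k < N.+1) `|b k - c k| <= D ->
  `|nest (nseq r b) N l - nest (nseq r c) N l| <= r%:R * B ^+ r.-1 * D.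
Proof.
move=> hb hc hd; have B0 : 0 <= B by apply: le_trans hb; apply: sumr_ge0 => k _.
have D0 : 0 <= D by apply: le_trans hd; apply: sumr_ge0 => k _.
have sub f j : (forall k, 0 <= f k) ->
    \sum_(j.+1 <= k < N.+1) f k <= \sum_(1 <= k < N.+1) f k :> R.
  move=> f0; have [lN|Nl] := leqP j.+1 N.+1; last by rewrite big_geq ?sumr_ge0 // ltnW.
  rewrite [X in _ <= X](big_cat_nat (n := j.+1)) //= lerDr.
  by apply: sumr_ge0.
elim: r l => [|r IH] l /=; first by rewrite subrr normr0 !mul0r.
rewrite -sumrB; apply: le_trans (ler_norm_sum _ _ _) _.
apply: (@le_trans _ _ (\sum_(l.+1 <= k < N.+1)
   (`|b k - c k| * B ^+ r + `|c k| * (r%:R * B ^+ r.-1 * D)))).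
  apply: ler_sum => k _.
  have -> : b k * nest (nseq r b) N k - c k * nest (nseq r c) N k =
    (b k - c k) * nest (nseq r b) N k + c k * (nest (nseq r b) N k - nest (nseq r c) N k).
    by ring.
  apply: le_trans (ler_normD _ _) _; rewrite !normrM; apply: lerD.
    by rewrite ler_wpM2l // nest_nseq_bound.
  by rewrite ler_wpM2l.
rewrite big_split /= -!mulr_suml.
have p : 0 <= r%:R * B ^+ r.-1 * D by rewrite !mulr_ge0 ?ler0n ?exprn_ge0.
apply: (@le_trans _ _ (D * B ^+ r + B * (r%:R * B ^+ r.-1 * D))).
  apply: lerD; rewrite ler_wpM2r ?exprn_ge0 //.
    by apply: le_trans (sub _ _ _) hd.
  by apply: le_trans (sub _ _ _) hc.
rewrite le_eqVlt; apply/orP; left; apply/eqP.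
case: r {IH p} => [|r]; first by rewrite expr0 mulr0n; ring.
by rewrite /= exprS -[r.+2%:R]natr1; ring.
Qed.

Definition odd_sq (k : nat) : R := - ((2 * k%:R - 1) ^+ 2)^-1.
(** Equal to [(pi / (4 M))^2], so that dividing it by the square of a node gives exactly the inverse
    of an odd square. *)
Definition scale_sq (M : nat) : R := (pi / 2) ^+ 2 / (4 * M%:R ^+ 2).
Definition odd_sin (M k : nat) : R := scale_sq M * - (sin (node R M k.-1) ^+ 2)^-1.

Lemma sum_odd_sq M : \sum_(1 <= k < M.+1) `|odd_sq k| <= 3.
Proof.
rewrite big_add1 /= big_mkord.
(* The strengthened bound makes the induction telescope: each new term is at most
   [2/(M+1) - 2/(M+2)]. *)
apply: (@le_trans _ _ (3 - 2 / M.+1%:R)); last by rewrite gerBl divr_ge0 // ler0n.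
elim: M => [|M IH]; first by rewrite big_ord0 invr1; lra.
rewrite big_ord_recr /=; apply: le_trans (lerD IH (lexx _)) _.
have M0 : 0 <= M%:R :> R by rewrite ler0n.
rewrite normrN ger0_norm ?invr_ge0 ?sqr_ge0 //.
rewrite -[M.+2%:R]natr1 -[M.+1%:R]natr1; move: (M%:R) M0 => y y0.
have -> : 2 * (y + 1) - 1 = 2 * y + 1 by ring.
have y1 : 0 < y + 1 by lra.
have y2 : 0 < y + 1 + 1 by lra.
suff : ((2 * y + 1) ^+ 2)^-1 <= 2 / (y + 1) - 2 / (y + 1 + 1).
  by move: (2 / (y + 1)) (2 / (y + 1 + 1)) => u v; lra.
have -> : 2 / (y + 1) - 2 / (y + 1 + 1) = 2 / ((y + 1) * (y + 1 + 1)).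
  by field; rewrite !gt_eqF.
rewrite ler_pdivlMr ?mulr_gt0 // mulrC ler_pdivrMr; first nra.
by rewrite exprn_gt0 //; lra.
Qed.

Lemma odd_sin_diff M k : (0 < k <= M)%N -> `|odd_sq k - odd_sin M k| <= scale_sq M.
Proof.
move=> /andP[k0 kM]; have kM' : (k.-1 < M)%N by lia.
have /andP[h1 h2] := inv_sin2_bounds (node_bounds R kM').
have M0 : M%:R != 0 :> R by rewrite pnatr_eq0; lia.
have s0 : 0 <= scale_sq M by rewrite divr_ge0 ?sqr_ge0 // mulr_ge0 // sqr_ge0.
have E : odd_sq k = - (scale_sq M * (node R M k.-1 ^+ 2)^-1).
  rewrite /odd_sq /scale_sq /node; congr (- _).
  have -> : 2 * (k.-1)%:R + 1 = 2 * k%:R - 1 :> R.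
    by case: (k) k0 => // k' _; rewrite /= -[k'.+1%:R]natr1; ring.
  have p0 : pi != 0 :> R by rewrite gt_eqF // pi_gt0.
  have q0 : 2 * k%:R - 1 != 0 :> R.
    apply/eqP; have : 1 <= k%:R :> R by rewrite ler1n.
    by move=> + h; lra.
  move: (2 * k%:R - 1) q0 (pi : R) p0 => q q0 P P0; field; by rewrite M0 P0 q0.
rewrite E /odd_sin mulrN opprK addrC -mulrBr normrM !ger0_norm //.
by rewrite ler_piMr.
Qed.

Lemma scale_sq_le M : (0 < M)%N -> M%:R * scale_sq M <= M%:R^-1.
Proof.
move=> M0; have M1 : 0 < M%:R :> R by rewrite ltr0n.
have h : (pi / 2) ^+ 2 <= 4 :> R.
  have := pihalf_lt2 R; have := pihalf_ge1 R; rewrite expr2.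
  by move: (pi / 2) => u h1 h2; nra.
have -> : M%:R * scale_sq M = (pi / 2) ^+ 2 / 4 * M%:R^-1.
  by rewrite /scale_sq; field; rewrite gt_eqF.
by apply: ler_piMl; [rewrite invr_ge0 ltW | rewrite ler_pdivrMr // mul1r].
Qed.

Lemma nest_odd_sin M r : (0 < M)%N -> nest (nseq r (odd_sin M)) M 0 =
  (-1) ^+ r * (pi / 2) ^+ (r.*2) / (r.*2)`!%:R * \prod_(k < r) (1 - (k%:R / M%:R) ^+ 2).
Proof.
move=> M0; rewrite /odd_sin nest_nseqZ nest_nseq_coef /= -cheb_prod coef_cheb.
rewrite /cheb_coef /diff_sq.
have M1 : M%:R != 0 :> R by rewrite pnatr_eq0; lia.
have -> : \prod_(k < r) (M%:R ^+ 2 - k%:R ^+ 2) =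
    (M%:R ^+ 2) ^+ r * \prod_(k < r) (1 - (k%:R / M%:R) ^+ 2) :> R.
  rewrite -[X in _ ^+ X * _]card_ord -prodr_const -big_split /=.
  by apply: eq_bigr => k _; field.
have f0 : (r.*2)`!%:R != 0 :> R by rewrite pnatr_eq0 -lt0n fact_gt0.
have -> : (pi / 2) ^+ r.*2 = ((pi / 2) ^+ 2) ^+ r :> R by rewrite -exprM mul2n.
rewrite /scale_sq [(_ / (4 * _)) ^+ r]expr_div_n [(4 * _) ^+ r]exprMn.
have a0 : (4 : R) ^+ r != 0 by rewrite expf_neq0 // pnatr_eq0.
have b0 : (M%:R ^+ 2) ^+ r != 0 :> R by rewrite !expf_neq0.
move: (4 ^+ r) ((M%:R ^+ 2) ^+ r) ((r.*2)`!%:R) (((pi / 2) ^+ 2) ^+ r) a0 b0 f0.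
move=> a b f q a0 b0 f0.
by field; rewrite a0 b0 f0.
Qed.

Lemma bnd_prod_lim r : bnd 1 (fun M => ((\prod_(k < r) (1 - (k%:R / M%:R) ^+ 2) - 1 : R))%:C%C).
Proof.
elim: r => [|r IH].
  by apply: bnd_ext (bnd0 R 1) => M; rewrite big_ord0 subrr.
have h : bnd 1 (fun M => (((r%:R / M%:R) ^+ 2 : R))%:C%C).
  apply: (@bndR R _ (fun M => (r%:R / M%:R) ^+ 2) _ (2 * r%:R ^+ 2)) => // M.
  rewrite expr1 ger0_norm ?sqr_ge0 //; case: M => [|M].
    by rewrite invr0 mulr0 expr0n divr1 mulr_ge0 // sqr_ge0.
  rewrite expr_div_n -mulrA mulrCA ler_wpM2l ?sqr_ge0 //.
  rewrite ler_pdivlMr ?ltr0n // mulrC ler_pdivrMr ?exprn_gt0 ?ltr0n //.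
  by rewrite -natrX -natrM ler_nat; nia.
have h2 : bnd 1 (fun M => (\prod_(k < r) (1 - (k%:R / M%:R) ^+ 2) - 1 : R)%:C%C *
    ((r%:R / M%:R) ^+ 2 : R)%:C%C).
  by apply: bndW (bndM IH h).
apply: bnd_ext (bndB (bndB IH h2) h) => M.
by rewrite big_ord_recr /= -rmorphM -!rmorphB; congr (_%:C%C); ring.
Qed.

Lemma nest_odd_sq_lim r : bnd 1 (fun M => (nest (nseq r odd_sq) M 0)%:C%C -
  ((-1) ^+ r * (pi / 2) ^+ (r.*2) / (r.*2)`!%:R : R)%:C%C).
Proof.
set c := (_ / _ : R).
pose g M : R := nest (nseq r odd_sq) M 0 - nest (nseq r (odd_sin M)) M 0.
have hg : bnd 1 (fun M => (g M)%:C%C).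
  apply: (@bndR R _ g _ (r%:R * 4 ^+ r.-1 * 2)) => // M; rewrite expr1.
  case: (posnP M) => [->|M0].
    have -> : g 0%N = 0 by rewrite /g; case: (r) => [|r']; rewrite /= ?big_geq ?subrr.
    by rewrite normr0 !mulr_ge0 ?invr_ge0 ?ler0n ?exprn_ge0.
  have D : \sum_(1 <= k < M.+1) `|odd_sq k - odd_sin M k| <= M%:R^-1.
    apply: le_trans (scale_sq_le M0).
    apply: (@le_trans _ _ (\sum_(1 <= k < M.+1) scale_sq M)).
      by apply: ler_sum_nat => k hk; apply: odd_sin_diff.
    by rewrite sumr_const_nat subn1 [X in _ <= X]mulr_natl.
  have iM : M%:R^-1 <= 1 :> R by rewrite invf_le1 ?ltr0n // ler1n.
  (* [nest_nseq_diff] needs one bound for both families: 4 is 3 plus the total comparison error,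
     which is at most 1. *)
  have B1 : \sum_(1 <= k < M.+1) `|odd_sq k| <= 4.
    by apply: le_trans (sum_odd_sq M) _; rewrite ler_nat.
  have B2 : \sum_(1 <= k < M.+1) `|odd_sin M k| <= 4.
    apply: (@le_trans _ _ (\sum_(1 <= k < M.+1) `|odd_sq k| +
      \sum_(1 <= k < M.+1) `|odd_sq k - odd_sin M k|)).
      rewrite -big_split /=; apply: ler_sum => k _.
      rewrite -{1}[odd_sin M k](subKr (odd_sq k)).
      by apply: le_trans (ler_normB _ _) _.
    by apply: le_trans (lerD (sum_odd_sq M) (le_trans D iM)) _; lra.
  apply: le_trans (nest_nseq_diff r 0 B1 B2 D) _.
  rewrite -[X in _ <= X]mulrA ler_wpM2l ?mulr_ge0 ?ler0n ?exprn_ge0 //.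
  rewrite ler_pdivlMr ?ltr0n // mulrC ler_pdivrMr ?ltr0n // -natrM ler_nat; lia.
have hc : bnd 1 (fun M => (nest (nseq r (odd_sin M)) M 0 - c)%:C%C).
  have h := bndZ (c%:C)%C (bnd_prod_lim r).
  have [K [q hq]] := h.
  exists (K + `|nest (nseq r (odd_sin 0)) 0 0 - c|), q => M.
  case: (posnP M) => [->|M0].
    rewrite normcR Lg0 expr1n mulr1 expr1 divr1.
    have := le_trans (normc_ge0 _) (hq 0%N); rewrite Lg0 expr1n mulr1 expr1 divr1.
    lra.
  have := hq M; rewrite -rmorphM nest_odd_sin // -/c.
  have -> : c * \prod_(k < r) (1 - (k%:R / M%:R) ^+ 2) - c =
     c * (\prod_(k < r) (1 - (k%:R / M%:R) ^+ 2) - 1) by ring.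
  move=> h'; apply: le_trans h' _.
  by rewrite ler_wpM2r ?invr_ge0 ?exprn_ge0 ?ler0n // ler_wpM2r ?LgX_ge0 // lerDl.
by apply: bnd_ext (bndD hg hc) => M; rewrite -!rmorphD -rmorphB; congr (_%:C%C); rewrite /g addrA subrK.
Qed.

(** The indices [M - k] and [M + k + 1] carry opposite odd denominators, and their factors multiply
    to [1 - X^2 / (2k+1)^2]. *)
Lemma prod_full M : \prod_(k < M + M) (1 + (2 * k.+1%:R - 1 - 2 * M%:R)^-1 *: 'X) =
  (\prod_(k < M) (1 + odd_sq k.+1 *: 'X)) \Po 'X^2 :> {poly R}.
Proof.
rewrite big_split_ord /= (reindex_inj rev_ord_inj) /= -big_split /= rmorph_prod.
apply: eq_bigr => k _ /=.
have k0 : 0 <= (k : nat)%:R :> R by rewrite ler0n.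
have -> : (2 * (M - k.+1).+1%:R - 1 - 2 * M%:R)^-1 = - (2 * (k : nat)%:R + 1)^-1 :> R.
  have -> : (M - k.+1).+1%:R = M%:R - (k : nat)%:R :> R.
    by rewrite subnSK // natrB // ltnW.
  by rewrite -invrN; congr (_^-1); ring.
have -> : 2 * (M + k).+1%:R - 1 - 2 * M%:R = 2 * (k : nat)%:R + 1 :> R.
  by rewrite -[(M + k).+1%:R]natr1 natrD; ring.
rewrite /odd_sq.
have -> : 2 * k.+1%:R - 1 = 2 * (k : nat)%:R + 1 :> R by rewrite -[k.+1%:R]natr1; ring.
rewrite comp_polyD comp_polyZ comp_polyX comp_polyC -!mul_polyC -exprVn.
rewrite !polyCN polyCM /=; ring.
Qed.

Lemma nest_rmorph (A B : comNzRingType) (f : {rmorphism A -> B}) (n : nat) (g : nat -> A) N l :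
  f (nest (nseq n g) N l) = nest (nseq n (f \o g)) N l.
Proof.
elim: n l => [|n IH] l /=; first exact: rmorph1.
by rewrite rmorph_sum; apply: eq_bigr => k _; rewrite rmorphM IH.
Qed.

Lemma cos_nest_lim n : bnd 1 (fun M =>
  nest (nseq n (fun k => (2 * k%:R - 1 - 2 * M%:R : C)^-1)) (M + M) 0 -
  (if odd n then 0 else (n`!%:R)^-1 * ('i%C * pi%:C%C / 2) ^+ n)).
Proof.
have E M : nest (nseq n (fun k => (2 * k%:R - 1 - 2 * M%:R : C)^-1)) (M + M) 0 =
    (if odd n then 0 else (nest (nseq n./2 odd_sq) M 0)%:C%C).
  transitivity ((nest (nseq n (fun k => (2 * k%:R - 1 - 2 * M%:R : R)^-1)) (M + M) 0)%:C)%C.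
    rewrite (nest_rmorph (real_complex R)); congr (nest (nseq n _) _ _).
    apply/funext => k /=; rewrite fmorphV !rmorphB !rmorphM !rmorph_nat rmorph1 //.
  rewrite nest_nseq_coef prod_full coef_comp_poly_Xn // dvdn2.
  by case: odd => //=; rewrite -divn2 nest_nseq_coef.
have [on|en] := boolP (odd n).
  by apply: bnd_ext (bnd0 R 1) => M; rewrite E on subrr.
apply: bnd_ext (nest_odd_sq_lim n./2) => M; rewrite E (negbTE en); congr (_ - _).
have -> : n./2.*2 = n by rewrite halfK (negbTE en) subn0.
rewrite !rmorphM fmorphV rmorph_nat !rmorphXn rmorphN1 mulrC; congr (_ * _).
have -> : 'i%C * pi%:C%C / 2 = 'i%C * (pi / 2)%:C%C :> C.
  by rewrite rmorphM fmorphV rmorph_nat mulrA.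
rewrite exprMn; congr (_ * _).
by rewrite -[n in RHS](even_halfK en) -mul2n exprM sqr_i.
Qed.

End CosineLimit.

(** * The bilateral sum *)

Section Bilateral.
Variables (R : realType) (m : nat).
Notation C := R[i].
Notation item := (R * mpoly m C)%type.
Notation p0 := ((0, 0) : item).
Notation denz := (@den_zeta R).
Notation dent := (@den_t R).
Notation odd_inv := (odd_inv R).
Implicit Types (s : seq item) (a : item) (nu : multinom m) (eta : mpoly m C).

Definition bicenter (M k : nat) : C := 2 * k%:R - 1 - 2 * M%:R.

Definition biterm (M : nat) a (k : nat) : pser R m :=
  e (a.1 * (k%:R - M%:R)) *: geo (bicenter M k) a.2.

(* The truncation of the bilateral sum over [1 - M <= k_1 < ... < k_r <= M] of
   the products of the [e (phi_i k_i) / (2 k_i - 1 - y_i)], with all summation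
   indices shifted by [M]. *)
Definition bilat (M : nat) s : pser R m := nest [seq biterm M p | p <- s] (M + M) 0.

Definition opp_items s : seq item := [seq (- p.1, - p.2) | p : item <- s].

Lemma nestZ (c : item -> C) (F : item -> nat -> pser R m) s N l :
  nest [seq (fun k => c p *: F p k) | p <- s] N l =
  (\prod_(p <- s) c p) *: nest [seq F p | p <- s] N l.
Proof.
elim: s l => [|p s IH] l /=; first by rewrite big_nil scale1r.
rewrite big_cons scaler_sumr; apply: eq_bigr => k _.
by rewrite IH -scalerAl -scalerAr scalerA.
Qed.

Lemma geoN (c : C) eta : geo (- c) eta = - geo c (- eta) :> pser R m.
Proof.
apply: pserP => nu; rewrite pserNE /geo -sumrN; apply: eq_bigr => n _.
rewrite invrN exprNn [in RHS]exprNn -signr_odd -[in RHS]signr_odd /=.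
have E (z : C) (p : mpoly m C) : mcoeff nu (z *: p) = z * mcoeff nu p by rewrite mcoeffZ.
case: (odd n) => /=; rewrite ?expr1 ?expr0 ?mulN1r ?mul1r ?mcoeffN; ring.
Qed.

Lemma nocst_opp eta : nocst eta -> nocst (- eta).
Proof. by rewrite /nocst mcoeffN => ->; rewrite oppr0. Qed.

Lemma nocsts_opp_items s : nocsts s -> nocsts (opp_items s).
Proof. by move=> hs _ /mapP[p ps ->]; apply: nocst_opp; apply: hs. Qed.

Lemma nocsts_drop s j : nocsts s -> nocsts (drop j s).
Proof. by move=> hs p ps; apply: hs; apply: mem_drop ps. Qed.

Lemma nocsts_revtake s j : nocsts s -> nocsts (rev (take j s)).
Proof. by move=> hs p; rewrite mem_rev => ps; apply: hs; apply: mem_take ps. Qed.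

(** Indices above the cut [M] give the first factor. The others are reflected by [k -> M + 1 - k],
    which reverses the list and turns the denominator into its opposite, with [y] negated, and the
    phase into [e(phi) e(- phi)^k]: each contributes [- e(phi)] to the prefactor. *)
Lemma bilat_split M s : nocsts s -> bilat M s =
  \sum_(j < (size s).+1) ((-1) ^+ j * e (\sum_(p <- take j s) p.1)) *:
    (Tser dent M (drop j s) * Tser dent M (opp_items (rev (take j s)))).
Proof.
move=> hs; rewrite /bilat (@nest_split _ _ _ M) ?leq_addr // size_map.
apply: eq_bigr => j _; rewrite -map_take -map_drop.
have -> : nest [seq biterm M p | p <- drop j s] (M + M) M = Tser dent M (drop j s).
  rewrite /Tser gser_trunc_sum; last exact: nocsts_drop.
  have := nest_shift (drop j s) (biterm M) M 0 M; rewrite add0n => <-.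
  apply: eq_nest => p k _ _.
  rewrite /biterm /bicenter eX natrD addrK; congr (_ *: geo _ _).
  by rewrite /den_t; ring.
rewrite mulrC scalerAr; congr (_ * _).
rewrite /Tser gser_trunc_sum; last by apply: nocsts_opp_items; apply: nocsts_revtake.
rewrite /opp_items -map_comp /=.
have := @nest_rev _ item (take j s) (biterm M) M 0 M.+1 (leqnn _).
rewrite /= subn0 subnn => <-.
transitivity (nest [seq (fun k => - e p.1 *: (e (- p.1) ^+ k *: geo (dent k) (- p.2)))
    | p : item <- rev (take j s)] M 0).
  apply: eq_nest => p k _ /andP[k0 kM]; rewrite /biterm [RHS]scalerA.
  have -> : - e p.1 * e (- p.1) ^+ k = - e (p.1 * ((M.+1 - k)%:R - M%:R)).
    rewrite eX mulNr -eD natrB; last exact: leqW.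
    by congr (- e _); rewrite -[M.+1%:R]natr1; ring.
  have -> : bicenter M (M.+1 - k) = - dent k.
    rewrite /bicenter /den_t natrB; last exact: leqW.
    by rewrite -[M.+1%:R]natr1; ring.
  by rewrite geoN scalerN scaleNr.
rewrite nestZ; congr (_ *: _).
have -> : \prod_(p <- rev (take j s)) - e p.1 = \prod_(p <- take j s) (- e p.1).
  by apply: perm_big; rewrite perm_rev.
rewrite e_sum; have st : size (take j s) = j by rewrite size_takel // -ltnS.
rewrite -{2}st; elim: (take j s) => [|p t IH]; first by rewrite !big_nil mulr1.
by rewrite !big_cons IH /= exprS; ring.
Qed.

Lemma bicenter_neq0 M k : bicenter M k != 0.
Proof.
rewrite /bicenter -addrA -opprD subr_eq0 -natrM -[1]/(1%:R) -natrM -natrD eqr_nat.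
by apply/eqP; lia.
Qed.

Lemma bilat_partial_fractions M s n : nocsts s -> size s = n.+1 -> bilat M s =
  (2 ^+ n)^-1 *: \sum_(j < size s) \sum_(1 <= k < (M + M).+1)
    (e (total s * (k%:R - M%:R)) *: geo (bicenter M k) (nth p0 s j).2) *
    ((-1) ^+ j *: (Tser denz k.-1 (zleft s j) * Tser denz (M + M - k) (zright s j))).
Proof.
move=> hs sn.
rewrite (marked_sum (fun j k => e (total s * (k%:R - M%:R)) *:
   geo (bicenter M k) (nth p0 s j).2)) //.
have -> : bilat M s = nest [seq biterm M (nth p0 s i) | i <- iota 0 (size s)] (M + M) 0.
  by rewrite /bilat -[s in LHS](mkseq_nth p0) /mkseq -map_comp.
rewrite nest_sum_incr.
have -> : forall g : seq nat -> pser R m, (2 ^+ n)^-1 *: sum_incr (size s) g (M + M) 0 =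
   sum_incr (size s) (fun t => (2 ^+ n)^-1 *: 1 * g t) (M + M) 0.
  by move=> g; rewrite sum_incrZ -scalerAl mul1r.
apply: eq_sum_incr => t st pt _.
pose X i : pser R m := bicenter M (nth 0%N t i) *: 1 - ps (nth p0 s i).2.
have gX i : (X i \is a GRing.unit) /\ geo (bicenter M (nth 0%N t i)) (nth p0 s i).2 = (X i)^-1.
  by apply: geo_unit; [exact: bicenter_neq0 | exact: nocst_nth].
have dX i j : X i - X j = 2 *: (shifted s i (nth 0%N t i) - shifted s j (nth 0%N t j)).
  have S k : X k = 2 *: shifted s k (nth 0%N t k) - (1 + 2 * M%:R) *: 1.
    rewrite /X /shifted scalerBr !scalerA divff ?pnatr_eq0 // scale1r.
    by rewrite addrAC -scalerBl /bicenter opprD addrA.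
  by rewrite !S subrBB subrr subr0 -scalerBr.
have u2 (z : pser R m) : z \is a GRing.unit -> (2 : C) *: z \is a GRing.unit.
  move=> uz; apply/unitrP; exists (2^-1 *: z^-1).
  have z1 := mulVr uz; have z2 := mulrV uz.
  split; rewrite -scalerAl -scalerAr scalerA.
    by rewrite z1 mulVf ?pnatr_eq0 // scale1r.
  by rewrite z2 divff ?pnatr_eq0 // scale1r.
have v2 (z : pser R m) : z \is a GRing.unit -> ((2 : C) *: z)^-1 = 2^-1 *: z^-1.
  move=> uz; have z1 := mulVr uz; apply: (mulIr (u2 _ uz)); rewrite (mulVr (u2 _ uz)).
  by rewrite -scalerAl -scalerAr scalerA z1 mulVf ?pnatr_eq0 // scale1r.
have tt i j : (i < size s)%N -> (j < size s)%N -> i != j -> nth 0%N t i != nth 0%N t j.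
  by move=> hi hj ij; rewrite neq_ltn !(@path_ltn_nth _ _ _ 0) ?st // -neq_ltn.
have sX : separated X (size s).
  move=> i j hi hj ij; rewrite dX; apply: u2; apply: natr_unit_sub => //; exact: tt.
transitivity (e (phase s t - total s * M%:R) *: \prod_(i < size s) (X i)^-1).
  transitivity (\prod_(i < size s) (e ((nth p0 s i).1 * ((nth 0%N t i)%:R - M%:R)) *: (X i)^-1)).
    by apply: eq_bigr => i _; rewrite add0n /biterm (gX i).2.
  rewrite scaler_prod -e_sum; congr (e _ *: _).
  by rewrite /phase /total mulr_suml -sumrB; apply: eq_bigr => i _; rewrite mulrBr.
have -> : \prod_(i < size s) (X i)^-1 = \sum_(j < size s) (X j)^-1 *
    \prod_(i < size s | i != j :> nat) (X i - X j)^-1.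
  move: sX; rewrite sn => sX; apply: partial_fractions => // i _; exact: (gX i).1.
rewrite -scalerAl mul1r [RHS]scalerA [X in _ = X *: _]mulrC -[RHS]scalerA.
rewrite eD -[LHS]scalerA; congr (_ *: _); rewrite !scaler_sumr; apply: eq_bigr => j _.
rewrite (gX j).2.
(* The phase at [k_j] undoes the factor [e (- total * k_j)] of [marked_sum], so that one common
   phase comes out of the sum over [j]. *)
have -> : e (- (total s * (nth 0%N t j)%:R)) *:
    (e (total s * ((nth 0%N t j)%:R - M%:R)) *: (X j)^-1) =
    e (- (total s * M%:R)) *: (X j)^-1.
  by rewrite scalerA -eD; congr (e _ *: _); ring.
rewrite -[in RHS]scalerAl [RHS]scalerA [X in _ = X *: _]mulrC -[RHS]scalerA.
congr (_ *: _); rewrite [RHS]scalerAr; congr (_ * _).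
rewrite (eq_bigr (fun i : 'I_(size s) => 2^-1 *:
   ((shifted s i (nth 0%N t i) - shifted s j (nth 0%N t j))^-1 : pser R m))); last first.
  by move=> i ij; rewrite dX v2 //; apply: natr_unit_sub => //; apply: tt.
rewrite scaler_prod prodr_const -exprVn; congr (_ ^+ _ *: _).
rewrite (eq_card (B := predC1 j)); last by move=> i; rewrite !inE.
by rewrite cardC1 card_ord sn.
Qed.

(** The removed part [c^-1] does not depend on [eta], so it comes out of the sum over [j] and meets
    [marked_trunc]; the rest is [O(c^-2)] and can be treated separately for each [j]. *)
Definition geo_rest (c : C) eta : pser R m := geo c eta - c^-1 *: 1.

Lemma geo_rest_bnd eta nu (w : nat -> C) : bnd 0 w ->
  bnd 2 (fun k => w k * geo_rest (dent k.+1) eta nu).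
Proof.
move=> hw; have [hd _ _] := good_den_t R.
apply: (@bnd_ext _ _ (fun k => \sum_(n < mdeg nu)
   mcoeff nu (eta ^+ n.+1) * (w k * ((dent k.+1)^-1 ^+ n * ((dent k.+1)^-1 * (dent k.+1)^-1))))).
  move=> k; rewrite /geo_rest pserBE pserZE /geo big_ord_recl /= expr0 -ps1 /ps expr1.
  rewrite addrAC subrr add0r mulr_sumr; apply: eq_bigr => n _.
  by rewrite /bump /= add1n !exprS; ring.
apply: bnd_sum => n _; apply: bndZ; apply: (@bndM _ 0 2) => //.
apply: (@bndM _ 0 2); first by apply: bnd_exp; apply: bndW hd.
exact: (bndM hd hd).
Qed.

Lemma sum_bilat (F : nat -> pser R m) M :
  \sum_(1 <= k < (M + M).+1) F k =
  \sum_(k < M) F (M + k).+1 + \sum_(k < M) F (M - k)%N.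
Proof.
rewrite big_add1 /= big_mkord big_split_ord /= addrC; congr (_ + _).
rewrite (reindex_inj rev_ord_inj) /=; apply: eq_bigr => k _.
by rewrite subnSK.
Qed.

Definition marked_pair s (j p q : nat) : pser R m :=
  (-1) ^+ j *: (Tser denz p (zleft s j) * Tser denz q (zright s j)).

Definition wplus s (k : nat) : C := e (total s * k.+1%:R).
Definition wminus s (k : nat) : C := e (- (total s * k%:R)).

(** The positions [M + k + 1] and [M - k] are paired: their denominators are opposite up to the sign
    of [y_j], and their inner truncations are exchanged. *)
Lemma bilat_folded M s n : nocsts s -> size s = n.+1 -> bilat M s =
  (2 ^+ n)^-1 *: \sum_(j < size s) \sum_(k < M)
    ((wplus s k *: geo (dent k.+1) (nth p0 s j).2) * marked_pair s j (M + k) (M - k.+1) -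
     (wminus s k *: geo (dent k.+1) (- (nth p0 s j).2)) * marked_pair s j (M - k.+1) (M + k)).
Proof.
move=> hs sn; rewrite (bilat_partial_fractions M hs sn); congr (_ *: _).
have E (u u' : R) (c c' : C) et (p p' q q' j : nat) : u = u' -> c = c' -> p = p' -> q = q' ->
    (e u *: geo c et) * ((-1) ^+ j *: (Tser denz p (zleft s j) * Tser denz q (zright s j))) =
    (e u' *: geo c' et) * marked_pair s j p' q' by move=> -> -> -> ->.
apply: eq_bigr => j _; rewrite sum_bilat sumrB -sumrN; congr (_ + _); apply: eq_bigr => k _.
  apply: E.
  - by rewrite -addnS natrD; ring.
  - by rewrite /bicenter /den_t -addnS natrD; ring.
  - by [].
  - by rewrite -addnS subnDl.
have kM := ltnW (ltn_ord k).
have -> : bicenter M (M - k) = - dent k.+1.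
  by rewrite /bicenter /den_t natrB // -[k.+1%:R]natr1; ring.
rewrite geoN scalerN mulNr; congr (- _); apply: E.
- by rewrite natrB //; ring.
- by [].
- by rewrite subnS.
- by lia.
Qed.

Definition bt_trunc (M : nat) s eta : pser R m :=
  Tser dent M [:: (total s, eta)] - e (total s) *: Tser dent M [:: (- total s, - eta)].

Lemma nest1 (A : comNzRingType) (F : nat -> A) N : nest [:: F] N 0 = \sum_(k < N) F k.+1.
Proof. by rewrite /= big_add1 big_mkord; apply: eq_bigr => k _; rewrite mulr1. Qed.

Lemma Tser1 M (u : R) eta : nocst eta ->
  Tser dent M [:: (u, eta)] = \sum_(k < M) e (u * k.+1%:R) *: geo (dent k.+1) eta.
Proof.
move=> he; have n1 : nocsts [:: (u, eta)] by move=> a; rewrite inE => /eqP ->.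
rewrite /Tser (gser_trunc_sum _ _ _ n1) [map _ _]/= nest1.
by apply: eq_bigr => k _; rewrite eX.
Qed.

Lemma bt_truncE M s eta : nocst eta -> bt_trunc M s eta =
  \sum_(k < M) (wplus s k *: geo (dent k.+1) eta - wminus s k *: geo (dent k.+1) (- eta)).
Proof.
move=> he; rewrite /bt_trunc (Tser1 M _ he) (Tser1 M _ (nocst_opp he)).
rewrite [e _ *: _]scaler_sumr -[LHS]sumrB; apply: eq_bigr => k _.
congr (_ - _); rewrite [LHS]scalerA -eD; congr (e _ *: _).
by rewrite -[k.+1%:R]natr1; ring.
Qed.

(** The folded sum with both inner truncations frozen at [M], so that the sum over [k] becomes
    [bt_trunc]. *)
Definition folded_main (M : nat) s (n : nat) : pser R m :=
  (2 ^+ n)^-1 *: \sum_(j < size s) (-1) ^+ j *: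
     (Tser denz M (zleft s j) * bt_trunc M s (nth p0 s j).2 * Tser denz M (zright s j)).

Lemma Tser_slow s nu den : good_den den -> slow (fun n => Tser den n s nu).
Proof. by move=> gden; exact: (Tser_bnd gden s nu). Qed.

Lemma marked_pair_tame s j nu : tame (fun p q => marked_pair s j p q nu) /\
  tame (fun p q => marked_pair s j q p nu).
Proof.
have gz := good_den_zeta R; split.
  apply: (@tame_ext _ (fun p q => (-1) ^+ j *
   \sum_(k : bmultinom m (mdeg nu).+1 * bmultinom m (mdeg nu).+1
           | nu == mnm_add k.1 k.2)
     (Tser denz p (zleft s j) k.1 * Tser denz q (zright s j) k.2))) => //.
  by apply: tameZ; apply: tame_sum => k _; apply: slow_tame; apply: Tser_slow.
apply: (@tame_ext _ (fun p q => (-1) ^+ j *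
   \sum_(k : bmultinom m (mdeg nu).+1 * bmultinom m (mdeg nu).+1
           | nu == mnm_add k.1 k.2)
     (Tser denz p (zright s j) k.2 * Tser denz q (zleft s j) k.1))).
  move=> p q; rewrite /marked_pair pserZE pserME; congr (_ * _).
  by apply: eq_bigr => k _; rewrite mulrC.
by apply: tameZ; apply: tame_sum => k _; apply: slow_tame; apply: Tser_slow.
Qed.

Lemma bnd_wplus s : bnd 0 (wplus s).
Proof.
apply: (@bnd_ext _ _ (fun k => e (total s) ^+ k.+1)).
  by move=> k; rewrite eX.
by apply: (bndS (bnd_unitX (normr_e _))).
Qed.

Lemma bnd_wminus s : bnd 0 (wminus s).
Proof.
apply: (@bnd_ext _ _ (fun k => e (- total s) ^+ k)).
  by move=> k; rewrite eX mulNr.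
exact: (bnd_unitX (normr_e _)).
Qed.

Lemma rest_part_bnd (w : nat -> C) eta (X : nat -> nat -> pser R m) nu : bnd 0 w ->
  (forall mu, tame (fun p q => X p q mu)) ->
  bnd 1 (fun M => \sum_(k < M) ((w k *: geo_rest (dent k.+1) eta) *
     (X (M + k)%N (M - k.+1)%N - X M M)) nu).
Proof.
move=> hw hX.
apply: (@bnd_ext _ _ (fun M =>
   \sum_(i : bmultinom m (mdeg nu).+1 * bmultinom m (mdeg nu).+1
           | nu == mnm_add i.1 i.2) \sum_(k < M)
     (w k * geo_rest (dent k.+1) eta i.1) *
       (X (M + k)%N (M - k.+1)%N i.2 - X M M i.2))).
  by move=> M; rewrite exchange_big /=; apply: eq_bigr => k _; rewrite pserME.
apply: bnd_sum => i _; exact: (tame_bnd2_sum (X := fun p q => X p q i.2) (hX i.2) (geo_rest_bnd eta i.1 hw)).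
Qed.

Lemma odd_inv_den k : odd_inv k = (dent k.+1)^-1.
Proof.
rewrite /odd_inv den_tS fmorphV; congr ((_)%:C%C^-1).
by rewrite -natr1; ring.
Qed.

Lemma main_part_bnd s nu : nocsts s -> (0 < size s)%N ->
  ~~ all (fun p => p.1 \is a Num.int) s || (nu != mnm0) ->
  bnd 1 (fun M => \sum_(k < M)
    (wplus s k * (odd_inv k * (marked_trunc (M + k) (M - k.+1) s nu - marked_trunc M M s nu)) -
     wminus s k * (odd_inv k * (marked_trunc (M - k.+1) (M + k) s nu - marked_trunc M M s nu)))).
Proof.
move=> hs s0 hnu; have [ti|tn] := boolP (total s \is a Num.int).
  have hb := marked_trunc_bnd hs s0 ti hnu.
  apply: (@bnd_ext _ _ (fun M =>
     \sum_(k < M) odd_inv k * marked_trunc (M + k) (M - k.+1) s nu -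
     \sum_(k < M) odd_inv k * marked_trunc (M - k.+1) (M + k) s nu)).
    move=> M; rewrite -sumrB; apply: eq_bigr => k _.
    have -> : wplus s k = 1 by rewrite /wplus e_int // rpredM // intr_nat.
    have -> : wminus s k = 1 by rewrite /wminus e_int // rpredN rpredM // intr_nat.
    by rewrite !mul1r -mulrBr -[RHS]mulrBr opprB addrA subrK.
  apply: bndB; first exact: (bnd2_odd_sum hb).
  exact: (bnd2_odd_sum (bnd2_swap hb)).
have T1 : tame (fun p q => marked_trunc p q s nu).
  apply: (@tame_ext _ (fun p q => \sum_(j < size s) marked_pair s j p q nu)).
    by move=> p q; rewrite /marked_trunc pser_sumE.
  by apply: tame_sum => j _; exact: (marked_pair_tame s j nu).1.
have T2 : tame (fun p q => marked_trunc q p s nu).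
  apply: (@tame_ext _ (fun p q => \sum_(j < size s) marked_pair s j q p nu)).
    by move=> p q; rewrite /marked_trunc pser_sumE.
  by apply: tame_sum => j _; exact: (marked_pair_tame s j nu).2.
have n1 : e (total s) != 1 by rewrite e_eq1.
have n2 : e (- total s) != 1 by rewrite e_eq1 rpredN.
have h1 := tame_osc_sum T1 (normr_e _) n1.
have h2 := tame_osc_sum T2 (normr_e _) n2.
apply: bnd_ext (bndB (bndZ (e (total s)) h1) h2) => M.
rewrite mulr_sumr -sumrB; apply: eq_bigr => k _.
have -> : wplus s k = e (total s) * e (total s) ^+ k.
  by rewrite /wplus eX -eD; congr e; rewrite -[k.+1%:R]natr1; ring.
have -> : wminus s k = e (- total s) ^+ k by rewrite eX mulNr.
by rewrite [in LHS]mulrA.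
Qed.

Lemma bilat_asymp s n nu : nocsts s -> size s = n.+1 ->
  ~~ all (fun p => p.1 \is a Num.int) s || (nu != mnm0) ->
  bnd 1 (fun M => bilat M s nu - folded_main M s n nu).
Proof.
move=> hs sn hnu; have s0 : (0 < size s)%N by rewrite sn.
pose eta j := (nth p0 s j).2.
have he j : nocst (eta j) by apply: nocst_nth.
apply: (@bnd_ext _ _ (fun M => (2 ^+ n)^-1 * (
   \sum_(k < M)
    (wplus s k * (odd_inv k * (marked_trunc (M + k) (M - k.+1) s nu - marked_trunc M M s nu)) -
     wminus s k * (odd_inv k * (marked_trunc (M - k.+1) (M + k) s nu - marked_trunc M M s nu)))
  + \sum_(j < size s) (\sum_(k < M) ((wplus s k *: geo_rest (dent k.+1) (eta j)) *
     (marked_pair s j (M + k)%N (M - k.+1)%N - marked_pair s j M M)) nu -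
    \sum_(k < M) ((wminus s k *: geo_rest (dent k.+1) (- eta j)) *
     (marked_pair s j (M - k.+1)%N (M + k)%N - marked_pair s j M M)) nu)))).
  move=> M; rewrite -pserBE (bilat_folded M hs sn) /folded_main -scalerBr pserZE; congr (_ * _).
  rewrite -sumrB pser_sumE.
  have A1 (c : C) (u v w : pser R m) : c *: (u * v * w) = v * (c *: (u * w)).
    by rewrite -scalerAr; congr (_ *: _); rewrite mulrAC mulrC.
  have A2 (a b x y z : pser R m) :
      a * x - b * y - (a - b) * z = a * (x - z) - b * (y - z) by ring.
  pose D (j k : nat) : pser R m :=
    (wplus s k *: geo (dent k.+1) (eta j)) *
       (marked_pair s j (M + k) (M - k.+1) - marked_pair s j M M) -
     (wminus s k *: geo (dent k.+1) (- eta j)) *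
       (marked_pair s j (M - k.+1) (M + k) - marked_pair s j M M).
  have ED (j : nat) : \sum_(k < M)
    ((wplus s k *: geo (dent k.+1) (nth p0 s j).2) * marked_pair s j (M + k) (M - k.+1) -
     (wminus s k *: geo (dent k.+1) (- (nth p0 s j).2)) * marked_pair s j (M - k.+1) (M + k)) -
    (-1) ^+ j *: (Tser denz M (zleft s j) * bt_trunc M s (nth p0 s j).2 *
       Tser denz M (zright s j)) = \sum_(k < M) D j k.
    have -> : (-1) ^+ j *: (Tser denz M (zleft s j) * bt_trunc M s (nth p0 s j).2 *
       Tser denz M (zright s j)) = bt_trunc M s (nth p0 s j).2 * marked_pair s j M M.
      exact: A1.
    rewrite (bt_truncE M s (he j)) mulr_suml -sumrB; apply: eq_bigr => k _.
    exact: A2.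
  transitivity (\sum_(j < size s) \sum_(k < M) D j k nu); last first.
    by apply: eq_bigr => j _; rewrite ED pser_sumE.
  transitivity (\sum_(k < M) \sum_(j < size s)
     (wplus s k * (odd_inv k * (marked_pair s j (M + k) (M - k.+1) nu - marked_pair s j M M nu)) -
     wminus s k * (odd_inv k * (marked_pair s j (M - k.+1) (M + k) nu - marked_pair s j M M nu)))
   + \sum_(j < size s) (\sum_(k < M) (((wplus s k *: geo_rest (dent k.+1) (eta j)) *
     (marked_pair s j (M + k)%N (M - k.+1)%N - marked_pair s j M M)) nu -
      ((wminus s k *: geo_rest (dent k.+1) (- eta j)) *
     (marked_pair s j (M - k.+1)%N (M + k)%N - marked_pair s j M M)) nu))).
    congr (_ + _); last by apply: eq_bigr => j _; rewrite sumrB.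
    apply: eq_bigr => k _; rewrite /marked_trunc !pser_sumE sumrB -!mulr_sumr !sumrB.
    by [].
  rewrite exchange_big -big_split /=; apply: eq_bigr => j _.
  rewrite -big_split /=; apply: eq_bigr => k _.
  have G et : geo (dent k.+1) et = odd_inv k *: 1 + geo_rest (dent k.+1) et.
    by rewrite /geo_rest odd_inv_den addrC subrK.
  have H (w c : C) (g r X Y : pser R m) : g = c *: 1 + r ->
    ((w *: g) * (X - Y)) nu = w * (c * (X nu - Y nu)) + ((w *: r) * (X - Y)) nu.
    move=> ->; rewrite scalerDr mulrDl pserDE; congr (_ + _).
    by rewrite -!scalerAl mul1r !pserZE.
  have A3 (u1 v1 u2 v2 : C) : (u1 + v1) - (u2 + v2) = (u1 - u2) + (v1 - v2) by ring.
  have d1 := H (wplus s k) _ _ _ (marked_pair s j (M + k) (M - k.+1))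
    (marked_pair s j M M) (G (eta j)).
  have d2 := H (wminus s k) _ _ _ (marked_pair s j (M - k.+1) (M + k))
    (marked_pair s j M M) (G (- eta j)).
  have dD : D j k nu = ((wplus s k *: geo (dent k.+1) (eta j)) *
       (marked_pair s j (M + k) (M - k.+1) - marked_pair s j M M)) nu -
     ((wminus s k *: geo (dent k.+1) (- eta j)) *
       (marked_pair s j (M - k.+1) (M + k) - marked_pair s j M M)) nu by exact: pserBE.
  apply: esym; apply: (etrans dD).
  exact: (etrans (congr2 (fun u v => u - v) d1 d2) (A3 _ _ _ _)).
apply: bndZ; apply: bndD; first exact: main_part_bnd.
apply: bnd_sum => j _; apply: bndB.
  apply: (rest_part_bnd (eta j) (X := marked_pair s j)); first exact: bnd_wplus.
  by move=> mu; exact: (marked_pair_tame s j mu).1.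
apply: (rest_part_bnd (- eta j) (X := fun p q => marked_pair s j q p)); first exact: bnd_wminus.
by move=> mu; exact: (marked_pair_tame s j mu).2.
Qed.

End Bilateral.

(** * Odd harmonic numbers and [log 2] *)

Section LogTwo.
Variable R : realType.
Notation C := R[i].
Notation x := (letter11 R).

Lemma ln_succ_ge n : (n.+2%:R)^-1 <= ln (n.+2%:R) - ln (n.+1%:R) :> R.
Proof.
have p1 : 0 < n.+1%:R :> R by rewrite ltr0n.
have p2 : 0 < n.+2%:R :> R by rewrite ltr0n.
rewrite -lerN2 opprB -ln_div ?posrE //.
have -> : n.+1%:R / n.+2%:R = 1 + (- n.+2%:R^-1) :> R.
  rewrite -[n.+2%:R]natr1 in p2 *; move: (n.+1%:R) p1 p2 => y y0 y1.
  by field; rewrite gt_eqF.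
by apply: le_ln1Dx; rewrite ltrN2 invf_lt1 // ltr1n.
Qed.

Lemma ln_succ_le n : ln (n.+2%:R) - ln (n.+1%:R) <= (n.+1%:R)^-1 :> R.
Proof.
have p1 : 0 < n.+1%:R :> R by rewrite ltr0n.
have p2 : 0 < n.+2%:R :> R by rewrite ltr0n.
rewrite -ln_div ?posrE //.
have -> : n.+2%:R / n.+1%:R = 1 + n.+1%:R^-1 :> R.
  rewrite -[n.+2%:R]natr1; move: (n.+1%:R) p1 => y y0.
  by field; rewrite gt_eqF.
by apply: le_ln1Dx; apply: lt_trans (_ : 0 < _); rewrite ?invr_gt0 // ltrN10.
Qed.

Lemma sum_ln_ge n k : \sum_(j < k) (n + j).+2%:R^-1 <= ln ((n + k).+1%:R) - ln (n.+1%:R) :> R.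
Proof.
elim: k => [|k IH]; first by rewrite big_ord0 addn0 subrr.
rewrite big_ord_recr /= addnS.
by apply: le_trans (lerD IH (ln_succ_ge (n + k))) _; rewrite addrC addrA subrK.
Qed.

Lemma sum_ln_le n k : ln ((n + k).+1%:R) - ln (n.+1%:R) <= \sum_(j < k) (n + j).+1%:R^-1 :> R.
Proof.
elim: k => [|k IH]; first by rewrite big_ord0 addn0 subrr.
rewrite big_ord_recr /= addnS.
by apply: le_trans (lerD IH (ln_succ_le (n + k))); rewrite [X in _ <= X]addrC addrA subrK.
Qed.

(** The odd reciprocals below [2 M] sum to [H_(2M) - H_M / 2], that is [H_M / 2] plus the block
    [H_(2M) - H_M], which tends to [log 2]. *)
Lemma sum_odd_inv M : \sum_(k < M) (2 * k.+1%:R - 1)^-1 =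
  2^-1 * (Lg R M - 1) + \sum_(k < M) (M + k).+1%:R^-1 :> R.
Proof.
have E : \sum_(k < M) (M + k).+1%:R^-1 = Lg R (M + M) - Lg R M :> R.
  have sp : \sum_(k < M + M) k.+1%:R^-1 = \sum_(k < M) k.+1%:R^-1 +
      \sum_(k < M) (M + k).+1%:R^-1 :> R by rewrite big_split_ord.
  by rewrite /Lg sp addrA [_ + _ - _]addrAC subrr add0r.
rewrite E; elim: M {E} => [|M IH].
  by rewrite big_ord0 addn0 subrr addr0 Lg0 subrr mulr0.
rewrite big_ord_recr /= IH addSn addnS !LgS -[(M + M).+2%:R]natr1 -[(M + M).+1%:R]natr1 natrD.
rewrite -[M.+1%:R]natr1.
have M0 : 0 <= M%:R :> R by rewrite ler0n.
move: (Lg R M) (Lg R (M + M)) (M%:R) M0 => u v y y0.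
have -> : 2 * (y + 1) - 1 = 2 * y + 1 by ring.
have -> : y + y + 1 = 2 * y + 1 by ring.
have -> : 2 * y + 1 + 1 = 2 * (y + 1) by ring.
have y1 : y + 1 != 0 by rewrite gt_eqF //; lra.
have y2 : 2 * y + 1 != 0 by rewrite gt_eqF //; lra.
by field; rewrite y1 y2.
Qed.

Lemma half_log_shift : bnd 1 (fun M => trunc_sum (@den_t R) M 0 [:: x] -
  (2^-1 * trunc_sum (@den_zeta R) M 0 [:: x] + clog2 R)).
Proof.
apply: (@bndR R _ (fun M => \sum_(k < M) (M + k).+1%:R^-1 - ln 2) _ (2 + ln 2)).
  move=> M; rewrite trunc_t_x trunc_zeta_x sum_odd_inv /clog2.
  have -> : (2^-1 : C) = (2^-1 : R)%:C%C by rewrite fmorphV rmorph_nat.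
  by rewrite -rmorphM -rmorphD -rmorphB; congr (_%:C%C); ring.
have l2 : 0 <= ln 2 :> R by apply: ln_ge0; rewrite ler1n.
move=> M; rewrite expr1; case: M => [|M].
  by rewrite big_ord0 sub0r normrN ger0_norm // invr1 mulr1; lra.
have p n : 0 < n.+1%:R :> R by rewrite ltr0n.
have D : ln (M.+1 + M.+1)%:R - ln M.+1%:R = ln 2 :> R.
  rewrite -ln_div ?posrE ?p //; congr ln.
  by rewrite addnn -mul2n natrM mulfK // pnatr_eq0.
have up : \sum_(k < M.+1) (M.+1 + k).+1%:R^-1 <= ln 2 :> R.
  by have h := sum_ln_ge M M.+1; rewrite -[(M + M.+1).+1]addSn D in h; exact: h.
have lo : ln 2 <= \sum_(k < M.+1) (M.+1 + k).+1%:R^-1 + M.+1%:R^-1 :> R.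
  have h := sum_ln_le M M.+1; rewrite -[(M + M.+1).+1]addSn D in h.
  apply: le_trans h _; rewrite big_ord_recl addn0 addrC lerD2r.
  rewrite [X in _ <= X]big_ord_recr /= ler_wpDr ?invr_ge0 ?ler0n //.
  by apply: ler_sum => k _; rewrite /bump /= add1n addnS addSn.
have iM : 0 <= M.+2%:R^-1 :> R by rewrite invr_ge0 ler0n.
have iM' : M.+1%:R^-1 <= 2 / M.+2%:R :> R.
  by rewrite ler_pdivlMr // mulrC ler_pdivrMr // -natrM ler_nat; lia.
have l3 : 0 <= ln 2 / M.+2%:R :> R by rewrite divr_ge0 // ler0n.
rewrite mulrDl ler_norml; apply/andP; split; last first.
  apply: (@le_trans _ _ 0); first by rewrite subr_le0.
  by rewrite addr_ge0 // divr_ge0 // ler0n.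
rewrite lerNl opprB lerBlDl; apply: le_trans lo _; rewrite lerD2l.
by apply: le_trans iM' _; rewrite lerDl.
Qed.

End LogTwo.

(** * Comparison of the regularized values *)

Section Assembly.
Variables (R : realType) (m : nat).
Notation C := R[i].
Notation x := (letter11 R).
Notation item := (R * mpoly m C)%type.
Notation p0 := ((0, 0) : item).
Notation denz := (@den_zeta R).
Notation dent := (@den_t R).
Notation hz n := (trunc_sum denz n 0 [:: x]).
Notation ht n := (trunc_sum dent n 0 [:: x]).
Implicit Types (s : seq item) (nu : multinom m) (eta : mpoly m C).
Implicit Types (F G : nat -> pser R m).

Definition sim F G : Prop := forall nu, bnd 1 (fun M => F M nu - G M nu).
Definition pbd F : Prop := forall nu, bnd 0 (fun M => F M nu).

Lemma simZ (c : C) F F' : sim F F' -> sim (fun M => c *: F M) (fun M => c *: F' M).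
Proof.
move=> h nu; apply: bnd_ext (bndZ c (h nu)) => M.
by rewrite !pserZE mulrBr.
Qed.

Lemma sim_sum (I : Type) (r : seq I) (F F' : I -> nat -> pser R m) :
  (forall i, sim (F i) (F' i)) ->
  sim (fun M => \sum_(i <- r) F i M) (fun M => \sum_(i <- r) F' i M).
Proof.
move=> h nu; apply: (@bnd_ext _ _ (fun M => \sum_(i <- r) (F i M nu - F' i M nu))).
  by move=> M; rewrite !pser_sumE sumrB.
by apply: bnd_sum => i _; apply: h.
Qed.

Lemma simM F F' G G' : sim F F' -> sim G G' -> pbd F -> pbd G' ->
  sim (fun M => F M * G M) (fun M => F' M * G' M).
Proof.
move=> h h' hF hG nu.
apply: (@bnd_ext _ _ (fun M =>
   \sum_(i : bmultinom m (mdeg nu).+1 * bmultinom m (mdeg nu).+1 | nu == mnm_add i.1 i.2)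
     (F M i.1 * (G M i.2 - G' M i.2) + (F M i.1 - F' M i.1) * G' M i.2))).
  by move=> M; rewrite !pserME -sumrB; apply: eq_bigr => i _; ring.
apply: bnd_sum => i _; apply: bndD; first exact: (bndM (hF _) (h' _)).
exact: (bndM (h _) (hG _)).
Qed.

Lemma pbdM F G : pbd F -> pbd G -> pbd (fun M => F M * G M).
Proof. by move=> hF hG nu; apply: bnd_sum => i _; exact: (bndM (hF _) (hG _)). Qed.

Definition polyfun (g : C -> C) : Prop := exists p : {poly C}, forall T, g T = p.[T].
Definition pspoly (f : C -> pser R m) : Prop := forall nu, polyfun (fun T => f T nu).

Lemma polyfun_sum (I : Type) (r : seq I) (P : pred I) (g : I -> C -> C) :
  (forall i, P i -> polyfun (g i)) -> polyfun (fun T => \sum_(i <- r | P i) g i T).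
Proof.
move=> h; elim: r => [|i r [p hp]]; first by exists 0 => T; rewrite big_nil horner0.
have [Pi|/negbTE nPi] := boolP (P i).
  have [q hq] := h i Pi; exists (q + p) => T.
  by rewrite big_cons Pi hornerD hq hp.
by exists p => T; rewrite big_cons nPi.
Qed.

Lemma polyfunM g k : polyfun g -> polyfun k -> polyfun (fun T => g T * k T).
Proof. by move=> [p hp] [q hq]; exists (p * q) => T; rewrite hornerM hp hq. Qed.

Lemma polyfun_cst c : polyfun (fun=> c).
Proof. by exists c%:P => T; rewrite hornerC. Qed.

Lemma pspolyM f g : pspoly f -> pspoly g -> pspoly (fun T => f T * g T).
Proof.
by move=> hf hg nu; apply: polyfun_sum => i _; exact: (polyfunM (hf _) (hg _)).
Qed.

Lemma pspolyZ c f : pspoly f -> pspoly (fun T => c *: f T).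
Proof. by move=> hf nu; exact: (polyfunM (polyfun_cst c) (hf nu)). Qed.

Lemma pspoly_cst c : pspoly (fun=> c).
Proof. by move=> nu; exact: polyfun_cst. Qed.

Lemma pspoly_sum (I : Type) (r : seq I) (f : I -> C -> pser R m) :
  (forall i, pspoly (f i)) -> pspoly (fun T => \sum_(i <- r) f i T).
Proof.
move=> h nu; have [p hp] := polyfun_sum r (P := xpredT) (fun i _ => h i nu).
by exists p => T; rewrite pser_sumE.
Qed.

Lemma pspoly_Aser den s : pspoly (fun T => Aser den T s).
Proof.
move=> nu; apply: polyfun_sum => t _; apply: polyfunM; last exact: polyfun_cst.
by exists (asymp_poly den [seq (e p.1.1, p.2.+1) | p :
         (R * mpoly m C) * 'I_(mdeg nu).+1 <- zip s t]).
Qed.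

Lemma Tser_sim den s : good_den den ->
  sim (fun M => Tser den M s) (fun M => Aser den (trunc_sum den M 0 [:: x]) s).
Proof. by move=> gden nu; exact: Tser_asymp. Qed.

Lemma Tser_pbd den s : good_den den -> pbd (fun M => Tser den M s).
Proof. by move=> gden nu; exact: (Tser_bnd gden s nu).1. Qed.

Lemma Aser_pbd den s : good_den den -> pbd (fun M => Aser den (trunc_sum den M 0 [:: x]) s).
Proof. by move=> gden nu; exact: Aser_bnd. Qed.

Definition bilat_reg (T : C) s : pser R m :=
  \sum_(j < (size s).+1) ((-1) ^+ j * e (\sum_(p <- take j s) p.1)) *:
    (Aser dent T (drop j s) * Aser dent T (opp_items (rev (take j s)))).

Definition bt_reg (T : C) s eta : pser R m :=
  Aser dent T [:: (total s, eta)] - e (total s) *: Aser dent T [:: (- total s, - eta)].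

(** Here [T] governs the zeta factors only: by [bt_reg_cst] the middle factor is the same at every
    value, and it is written at [log 2]. *)
Definition folded_reg (T : C) s (n : nat) : pser R m :=
  (2 ^+ n)^-1 *: \sum_(j < size s) (-1) ^+ j *:
     (Aser denz T (zleft s j) * bt_reg (clog2 R) s (nth p0 s j).2 * Aser denz T (zright s j)).

Lemma bilat_sim s : nocsts s ->
  sim (fun M => bilat M s) (fun M => bilat_reg (ht M) s).
Proof.
move=> hs nu; have gt := good_den_t R.
apply: (@bnd_ext _ _ (fun M => (\sum_(j < (size s).+1) ((-1) ^+ j * e (\sum_(p <- take j s) p.1)) *:
    (Tser dent M (drop j s) * Tser dent M (opp_items (rev (take j s)))) : pser R m) nu
    - bilat_reg (ht M) s nu)).
  by move=> M; rewrite bilat_split.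
apply: (@sim_sum _ _ (fun (j : 'I_(size s).+1) M => ((-1) ^+ j * e (\sum_(p <- take j s) p.1)) *:
    (Tser dent M (drop j s) * Tser dent M (opp_items (rev (take j s)))))
  (fun (j : 'I_(size s).+1) M => ((-1) ^+ j * e (\sum_(p <- take j s) p.1)) *:
    (Aser dent (ht M) (drop j s) * Aser dent (ht M) (opp_items (rev (take j s)))))) => j.
apply: simZ; apply: simM; [exact: Tser_sim|exact: Tser_sim|exact: Tser_pbd|exact: Aser_pbd].
Qed.

Lemma nocsts1 (u : R) eta : nocst eta -> nocsts [:: (u, eta)].
Proof. by move=> he a; rewrite inE => /eqP ->. Qed.

(** Each of the two series has derivative 1 in [T] if the total phase is an integer and 0 otherwise;
    in the first case [e (total s) = 1] and the derivatives cancel. *)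
Lemma bt_reg_cst s eta T U : nocst eta -> bt_reg T s eta = bt_reg U s eta.
Proof.
move=> he; apply: pserP => nu; have gt := good_den_t R.
apply: (@polyder0_cst _ (fun T => bt_reg T s eta nu)).
have h1 := @Aser_polyder _ _ _ gt [::] (total s, eta) nu (nocsts1 he).
have h2 := @Aser_polyder _ _ _ gt [::] (- total s, - eta) nu
  (nocsts1 (nocst_opp he)).
apply: polyder_ext (polyderD h1 (polyderZ (- e (total s)) h2)) => V.
  by rewrite /bt_reg pserBE pserZE mulNr.
rewrite /= rpredN !(Aser_nil _ gt); case: ifP => [/e_int ->|_].
  by rewrite mulN1r subrr.
by rewrite mulr0 addr0.
Qed.

Lemma bt_sim s eta : nocst eta ->
  sim (fun M => bt_trunc M s eta) (fun=> bt_reg (clog2 R) s eta).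
Proof.
move=> he nu; have gt := good_den_t R.
apply: (@bnd_ext _ _ (fun M => bt_trunc M s eta nu - bt_reg (ht M) s eta nu)).
  by move=> M; rewrite (bt_reg_cst s (ht M) (clog2 R) he).
have h1 := Tser_asymp gt [:: (total s, eta)] nu.
have h2 := Tser_asymp gt [:: (- total s, - eta)] nu.
apply: bnd_ext (bndB h1 (bndZ (e (total s)) h2)) => M.
by rewrite /bt_trunc /bt_reg !pserBE !pserZE; ring.
Qed.

Lemma folded_sim s n : nocsts s ->
  sim (fun M => folded_main M s n) (fun M => folded_reg (hz M) s n).
Proof.
move=> hs; have gz := good_den_zeta R; have gt := good_den_t R.
have bt_pbd eta : pbd (fun M => bt_trunc M s eta).
  move=> nu; apply: (bndB (Tser_pbd _ gt _)).
  by apply: bndZ; exact: (Tser_pbd _ gt).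
apply: simZ; apply: sim_sum => j; apply: simZ.
have he : nocst (nth p0 s j).2 by apply: nocst_nth.
apply: simM; [ | exact: Tser_sim | | exact: Aser_pbd].
  apply: simM; [exact: Tser_sim | exact: bt_sim | exact: Tser_pbd |].
  by move=> nu; exact: bnd_cst.
by apply: pbdM; [exact: Tser_pbd | exact: bt_pbd].
Qed.

Lemma pspoly_bilat_reg s : pspoly (fun T => bilat_reg T s).
Proof.
by apply: pspoly_sum => j; apply: pspolyZ; apply: pspolyM; apply: pspoly_Aser.
Qed.

Lemma pspoly_folded_reg s n : pspoly (fun T => folded_reg T s n).
Proof.
apply: pspolyZ; apply: pspoly_sum => j; apply: pspolyZ; apply: pspolyM; last exact: pspoly_Aser.
by apply: pspolyM; [exact: pspoly_Aser | exact: pspoly_cst].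
Qed.

(* The two sides are regularized at different values because
   [ht M = hz M / 2 + log 2 + o(1)]. *)
Lemma bilat_reg_generic s n nu : nocsts s -> size s = n.+1 ->
  ~~ all (fun p => p.1 \is a Num.int) s || (nu != mnm0) ->
  bilat_reg (clog2 R) s nu = folded_reg 0 s n nu.
Proof.
move=> hs sn hnu; have [_ _ uz] := good_den_zeta R.
have [p hp] := pspoly_bilat_reg s nu; have [q hq] := pspoly_folded_reg s n nu.
pose r : {poly C} := 2^-1 *: 'X + (clog2 R)%:P.
have hr T : (p \Po r - q).[T] = p.[2^-1 * T + clog2 R] - q.[T].
  by rewrite hornerD hornerN horner_comp hornerD hornerZ hornerX hornerC.
(* The substitution [T / 2 + log 2] makes both sides polynomials in the same harmonic numbers;
   evaluation at 0 gives the two regularized values. *)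
suff h0 : p \Po r - q = 0.
  have := hr 0; rewrite h0 horner0 mulr0 add0r -hp -hq => /esym/eqP.
  by rewrite subr_eq0 => /eqP.
apply: (null_horner uz); apply: bnd1_null.
have bz : bnd 0 (fun M => 2^-1 * hz M + clog2 R).
  by apply: bndD; [apply: bndZ; exact: (bnd_h (good_den_zeta R)) | exact: bnd_cst].
have hd := half_log_shift R.
pose d M := ht M - (2^-1 * hz M + clog2 R).
have t1 := bnd_horner_taylor p bz hd.
have t2 : bnd 1 (fun M => p.[ht M] - p.[2^-1 * hz M + clog2 R]).
  have t3 : bnd 1 (fun M => d M * p^`().[2^-1 * hz M + clog2 R]).
    exact: (bndM hd (bnd_horner p^`() bz)).
  apply: bnd_ext (bndD (bndW (isT : (1 <= 2)%N) t1) t3) => M.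
  have E : 2^-1 * hz M + clog2 R + (ht M - (2^-1 * hz M + clog2 R)) = ht M.
    by rewrite addrC subrK.
  by rewrite E /d subrK.
have b1 := bilat_sim hs nu; have b2 := folded_sim n hs nu.
have b3 := bilat_asymp hs sn hnu.
apply: bnd_ext (bndD (bndB b3 b1) (bndB b2 t2)) => M.
by rewrite hr !hp !hq; ring.
Qed.

Lemma nest_mnm0 (T : Type) (F : T -> nat -> pser R m) (r : seq T) N l :
  nest [seq F p | p <- r] N l mnm0 = nest [seq (fun k => F p k mnm0) | p <- r] N l.
Proof.
elim: r l => [|p r IH] l /=; first by rewrite pser1E eqxx.
by rewrite pser_sumE; apply: eq_bigr => k _; rewrite pserM0 IH.
Qed.

Lemma geo_mnm0 (c : C) eta : geo c eta mnm0 = c^-1.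
Proof. by rewrite /geo mdeg0 big_ord1 expr1 expr0 mcoeff1 eqxx mulr1. Qed.

Lemma bt_reg_mnm0 s eta T : nocst eta -> total s \is a Num.int ->
  bt_reg T s eta mnm0 = 0.
Proof.
move=> he ti.
have E (u : R) (et : mpoly m C) : nocst et -> Aser dent T [:: (u, et)] mnm0 = (asymp_poly dent [:: (e u, 1%N)]).[T].
  move=> het; rewrite /Aser (gser_cons _ (nocsts1 het) (leqnn _)) mdeg0 big_ord1 /=.
  by rewrite expr0 ps1 mul1r gser_nil pserZE pser1E eqxx mulr1.
rewrite /bt_reg pserBE pserZE !E //; last exact: nocst_opp.
by rewrite !e_int ?rpredN // mul1r subrr.
Qed.

(** For integral phases the constant coefficient of the bilateral sum is the nested sum of
    [cos_nest_lim]. As it converges, the asymptotic polynomial is constant and the value at [log 2]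
    is the limit. *)
Lemma bilat_reg_int s : nocsts s -> all (fun p => p.1 \is a Num.int) s ->
  bilat_reg (clog2 R) s mnm0 =
  if odd (size s) then 0 else ((size s)`!%:R)^-1 * ('i%C * pi%:C%C / 2) ^+ size s.
Proof.
move=> hs ai; have [p hp] := pspoly_bilat_reg s mnm0.
set c := (if _ then _ else _).
suff h0 : p - c%:P = 0.
  rewrite hp; apply/eqP; rewrite -subr_eq0; apply/eqP.
  by have := congr1 (fun q : {poly C} => q.[clog2 R]) h0; rewrite hornerD hornerN hornerC horner0.
have [_ _ ut] := good_den_t R; apply: (null_horner ut); apply: bnd1_null.
have b1 := bilat_sim hs mnm0; have b2 := cos_nest_lim R (size s).
apply: bnd_ext (bndB b2 b1) => M.
have -> : bilat M s mnm0 = nest (nseq (size s) (fun k => (2 * k%:R - 1 - 2 * M%:R : C)^-1)) (M + M) 0.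
  rewrite /bilat nest_mnm0.
  transitivity (nest [seq (fun k => (2 * k%:R - 1 - 2 * M%:R : C)^-1) | _ <- s] (M + M) 0).
    apply: eq_nest => a k /(allP ai) ain _.
    rewrite /biterm pserZE geo_mnm0 e_int ?mul1r //.
    by rewrite rpredM // rpredB // intr_nat.
  by congr (nest _ _ _); elim: (s) => //= a t ->.
by rewrite hornerD hornerN hornerC -hp opprB [LHS]addrC addrA subrK.
Qed.

(** For an integral total the two halves of [B^t] have the same constant coefficient, so every term
    vanishes there and the exceptional value comes from the bilateral side alone. *)
Lemma folded_reg_int s n : nocsts s -> all (fun p => p.1 \is a Num.int) s ->
  folded_reg 0 s n mnm0 = 0.
Proof.
move=> hs ai; rewrite /folded_reg pserZE pser_sumE big1 ?mulr0 // => j _.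
rewrite pserZE !pserM0 bt_reg_mnm0 ?mulr0 ?mul0r ?mulr0 //; first exact: nocst_nth.
rewrite totalE; elim: s ai {hs j} => [|a s IH] /=; first by rewrite big_nil.
by move=> /andP[ha hs]; rewrite big_cons rpredD // IH.
Qed.

Lemma bilat_reg_identity s n nu : nocsts s -> size s = n.+1 ->
  bilat_reg (clog2 R) s nu - folded_reg 0 s n nu =
  if nu == mnm0 then
    (if all (fun p => p.1 \is a Num.int) s && ~~ odd (size s)
     then ((size s)`!%:R)^-1 * ('i%C * pi%:C%C / 2) ^+ size s else 0)
  else 0.
Proof.
move=> hs sn.
have [h|] := boolP (~~ all (fun p => p.1 \is a Num.int) s || (nu != mnm0)).
  rewrite (bilat_reg_generic hs sn h) subrr; case: eqP h => [_|//].
  by rewrite orbF => /negbTE ->.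
rewrite negb_or !negbK => /andP[ai /eqP ->].
by rewrite eqxx ai bilat_reg_int // folded_reg_int // subr0; case: odd.
Qed.

End Assembly.

(** * Index lists of the statement as prefixes and suffixes *)

Section OrdinalLists.

Lemma filter_leq_enum n j : [seq i : 'I_n <- enum 'I_n | (j <= i)%N] = drop j (enum 'I_n).
Proof.
apply: (inj_map val_inj); rewrite map_drop val_enum_ord -(filter_map val (leq j)) val_enum_ord.
have [jn|nj] := leqP j n.
  rewrite -{1}(subnKC jn) iotaD add0n filter_cat drop_iota add0n.
  rewrite (eq_in_filter (a2 := pred0)) ?filter_pred0; last first.
    by move=> i; rewrite mem_iota /= => h; lia.
  apply/all_filterP/allP => i; rewrite mem_iota => h; lia.
rewrite drop_oversize ?size_iota ?(ltnW nj) //.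
rewrite (eq_in_filter (a2 := pred0)) ?filter_pred0 //.
by move=> i; rewrite mem_iota /= => h; lia.
Qed.

Lemma filter_ltn_enum n j : [seq i : 'I_n <- enum 'I_n | (i < j)%N] = take j (enum 'I_n).
Proof.
apply: (inj_map val_inj); rewrite map_take val_enum_ord -(filter_map val (fun i => i < j)%N).
rewrite val_enum_ord.
have [jn|nj] := leqP j n.
  rewrite -{1}(subnKC jn) iotaD add0n filter_cat take_iota (minn_idPl jn).
  rewrite [X in _ ++ X](eq_in_filter (a2 := pred0)) ?filter_pred0 ?cats0; last first.
    by move=> i; rewrite mem_iota /= => h; lia.
  apply/all_filterP/allP => i; rewrite mem_iota => h; lia.
rewrite take_oversize ?size_iota ?(ltnW nj) //.
apply/all_filterP/allP => i; rewrite mem_iota => h; lia.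
Qed.

End OrdinalLists.

Section MainIdentity.
Variables (R : realType) (m : nat) (phi : 'I_m -> R).
Notation C := R[i].
Notation item := (R * mpoly m C)%type.
Notation p0 := ((0, 0) : item).

Definition items : seq item := [seq (phi i, yvar R i) | i : 'I_m <- enum 'I_m].

Lemma size_items : size items = m.
Proof. by rewrite size_map size_enum_ord. Qed.

Lemma nocst_yvar (i : 'I_m) : nocst (yvar R i).
Proof. by rewrite /nocst /yvar mcoeffX mnm1_eq0. Qed.

Lemma nocsts_items : nocsts items.
Proof. by move=> _ /mapP[i _ ->]; apply: nocst_yvar. Qed.

Lemma nth_items (j : 'I_m) : nth p0 items j = (phi j, yvar R j).
Proof. by rewrite (nth_map j) ?size_enum_ord // nth_ord_enum. Qed.

Lemma total_items : total items = \sum_(i < m) phi i.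
Proof. by rewrite totalE big_map big_enum. Qed.

Lemma all_items : all (fun p : item => p.1 \is a Num.int) items =
  [forall i, phi i \is a Num.int].
Proof.
rewrite all_map; apply/allP/forallP => h i; first exact: h (mem_enum _ _).
by move=> _; apply: h.
Qed.

Lemma sum_take_items j : \sum_(p <- take j items) p.1 = \sum_(i < m | (i < j)%N) phi i.
Proof. by rewrite -map_take big_map -filter_ltn_enum big_filter big_enum_cond. Qed.

Lemma Lit_Aser (c : C) (s : seq item) : Lit c s = Aser (@den_t R) c s.
Proof.
by apply: eq_gser => w hw; rewrite /reg_t reg_asymp_poly //; exact: good_den_t.
Qed.

Lemma Li_Aser (c : C) (s : seq item) : Li c s = Aser (@den_zeta R) c s.
Proof.
by apply: eq_gser => w hw; rewrite /reg_zeta reg_asymp_poly //; exact: good_den_zeta.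
Qed.

Lemma bilat_reg_items : bilat_reg (clog2 R) items =
  \sum_(j < m.+1)
     ((-1) ^+ j * e (\sum_(i < m | (i < j)%N) phi i)) *:
       fps_mul
         (Lit (clog2 R)
            [seq (phi i, yvar R i) | i : 'I_m <- enum 'I_m & (j <= i)%N])
         (Lit (clog2 R)
            [seq (- phi i, - yvar R i) | i : 'I_m <- rev (enum 'I_m) & (i < j)%N]).
Proof.
rewrite /bilat_reg size_items; apply: eq_bigr => j _.
rewrite sum_take_items !Lit_Aser filter_leq_enum filter_rev filter_ltn_enum.
by rewrite /items -map_drop -map_take /opp_items -map_rev -map_comp.
Qed.

Lemma folded_reg_items n : m = n.+1 -> folded_reg 0 items n =
  (2 ^+ m.-1)^-1 *:
    \sum_(j < m)
       (-1) ^+ j *: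
         fps_mul
           (fps_mul
              (Li 0 [seq (- phi i, 2^-1 *: (yvar R j - yvar R i))
                    | i : 'I_m <- rev (enum 'I_m) & (i < j)%N])
              (Bt (\sum_(i < m) phi i) (yvar R j)))
           (Li 0 [seq (phi i, 2^-1 *: (yvar R i - yvar R j))
                 | i : 'I_m <- enum 'I_m & (j < i)%N]).
Proof.
move=> mn; have en : n = m.-1 by rewrite mn.
rewrite /folded_reg size_items en; apply: (congr1 (fun z : pser R m => (2 ^+ m.-1)^-1 *: z)).
apply: eq_bigr => j _.
rewrite !Li_Aser filter_leq_enum filter_rev filter_ltn_enum.
have -> : zleft items j = [seq (- phi i, 2^-1 *: (yvar R j - yvar R i))
                          | i <- rev (take j (enum 'I_m))].
  by rewrite /zleft nth_items /items -map_take -map_rev -map_comp.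
have -> : zright items j = [seq (phi i, 2^-1 *: (yvar R i - yvar R j))
                           | i <- drop j.+1 (enum 'I_m)].
  by rewrite /zright nth_items /items -map_drop -map_comp.
by rewrite /Bt !Lit_Aser nth_items /bt_reg total_items.
Qed.

End MainIdentity.

(* The variables phi_1, ..., phi_m and y_1, ..., y_m are indexed from 0. *)
Theorem mainTheorem5 (R : realType) (m : nat) (phi : 'I_m -> R) :
  (0 < m)%N ->
  \sum_(j < m.+1)
     ((-1) ^+ j * e (\sum_(i < m | (i < j)%N) phi i)) *:
       fps_mul
         (Lit (clog2 R)
            [seq (phi i, yvar R i) | i : 'I_m <- enum 'I_m & (j <= i)%N])
         (Lit (clog2 R)
            [seq (- phi i, - yvar R i) | i : 'I_m <- rev (enum 'I_m) & (i < j)%N])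
  - (2 ^+ m.-1)^-1 *:
    \sum_(j < m)
       (-1) ^+ j *:
         fps_mul
           (fps_mul
              (Li 0 [seq (- phi i, 2^-1 *: (yvar R j - yvar R i))
                    | i : 'I_m <- rev (enum 'I_m) & (i < j)%N])
              (Bt (\sum_(i < m) phi i) (yvar R j)))
           (Li 0 [seq (phi i, 2^-1 *: (yvar R i - yvar R j))
                 | i : 'I_m <- enum 'I_m & (j < i)%N])
  = fps_const
      (if [forall i, phi i \is a Num.int] && ~~ odd m
       then (m`!%:R)^-1 * ('i%C * pi%:C%C / 2) ^+ m
       else 0).
Proof.
move=> m0; have mn : m = m.-1.+1 by rewrite prednK.
have sn : size (items phi) = m.-1.+1 by rewrite size_items.
rewrite -bilat_reg_items -(folded_reg_items phi mn).
apply/funext => nu; rewrite /fps_const.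
have := bilat_reg_identity nu (@nocsts_items R m phi) sn.
by rewrite all_items size_items.
Qed.
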